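(* For all $\delta\in(0,1)$ and integers $d\ge 2$ there is $\zeta_0>0$ such that for all $0<\zeta\le\zeta_0$ there is $C_0$ such that for all $C\ge C_0$ the following holds. For every $n$ such that $\zeta n/24$ is an integer, let $T$ be a tree on $n$ vertices with maximum degree at most $d$ containing at least $\zeta n/24$ vertex-disjoint bare paths, each of length $6/\zeta$, let $G_0$ be a graph on vertex set $[n]$ with minimum degree at least $\delta n$, and suppose $G\sim G_0\cup\mathbf{G}(n,C/n)$ is uniformly edge-coloured in $[n-1]$. Then, with probability tending to $1$ as $n\to\infty$, $G$ contains a rainbow copy of $T$.
   Context: A bare path in a graph is a path whose interior vertices all have degree exactly $2$ in the graph. $\mathbf{G}(n,p)$ is the binomial random graph on $[n]$ with edge probability $p$; $G_0\cup\mathbf{G}(n,p)$ has as edge set the union of both edge sets. Uniformly edge-coloured in $\mathcal{C}$: each edge independently gets a uniformly random colour from $\mathcal{C}$. Rainbow: all edges have distinct colours. *)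

(* Defs.v *)
From HB Require Import structures.
From mathcomp Require Import all_boot all_order all_algebra.
From mathcomp Require Import reals.

Set Implicit Arguments.
Unset Strict Implicit.
Unset Printing Implicit Defensive.

Import Order.TTheory GRing.Theory Num.Theory.
Local Open Scope ring_scope.

Definition pairs (V : finType) : {set {set V}} := [set e : {set V} | #|e| == 2].

(* A finite simple graph is its set of edges, each a 2-element vertex set. *)
Record sgraph (V : finType) := SGraph {
  edges : {set {set V}};
  edges_pairs : edges \subset pairs V
}.

HB.instance Definition _ (V : finType) := [isSub for @edges V].
HB.instance Definition _ (V : finType) := [Finite of sgraph V by <:].

Section Graphs.
Variable V : finType.
Implicit Types (G H T : sgraph V) (s : seq V).

Definition adj G : rel V := [rel x y | [set x; y] \in edges G].

Definition deg G (x : V) : nat := #|[set y | adj G x y]|.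

Lemma gunion_subproof G H : edges G :|: edges H \subset pairs V.
Proof. by rewrite subUset !edges_pairs. Qed.

Definition gunion G H : sgraph V := SGraph (gunion_subproof G H).

Definition is_tree T : Prop :=
  [/\ (0 < #|V|)%N,
      forall x y, connect (adj T) x y
    & forall s, (2 < size s)%N -> ~ ucycle (adj T) s].

(* A path is given by the sequence of its vertices; its interior vertices are
   all of them but the first and the last. *)
Definition bare_path G s : bool :=
  if s is x :: p then
    [&& path (adj G) x p, uniq (x :: p)
      & all (fun v => deg G v == 2) (behead (belast x p))]
  else false.

Definition path_length s : nat := (size s).-1.

Definition vertex_disjoint (P : seq (seq V)) : bool :=
  pairwise [rel s t : seq V | [disjoint s & t]] P.

Definition edge G := {e : {set V} | e \in edges G}.

Definition rainbow (K : finType) G (c : {ffun edge G -> K}) (F : {set {set V}}) :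
    bool :=
  dinjectiveb c [pred e : edge G | val e \in F].

End Graphs.

Definition rainbow_copy (V W K : finType) (T : sgraph V) (G : sgraph W)
    (c : {ffun edge G -> K}) : bool :=
  [exists f : {ffun V -> W},
    let F := [set f @: e | e : {set V} in edges T] in
    [&& injectiveb f, F \subset edges G & rainbow c F]].

Section Probability.
Variable R : realType.

(* The law of G(n, p) when 0 <= p <= 1; for p = C / n with C > 0 this
   holds for all large n. *)
Definition gnp (n : nat) (p : R) (H : sgraph 'I_n) : R :=
  \prod_(e in pairs 'I_n) (if e \in edges H then p else 1 - p).

Definition unif_colouring (V K : finType) (G : sgraph V)
    (c : {ffun edge G -> K}) : R :=
  \prod_(e : edge G) (#|K|%:R)^-1.

(* The probability that G0 \cup G(n, p), each of whose edges receives an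
   independent uniform colour in K, satisfies the event A. *)
Definition perturbed_coloured_prob (n : nat) (G0 : sgraph 'I_n) (p : R)
    (K : finType) (A : forall G : sgraph 'I_n, pred {ffun edge G -> K}) : R :=
  \sum_(H : sgraph 'I_n) gnp p H *
    \sum_(c : {ffun edge (gunion G0 H) -> K} | A (gunion G0 H) c)
      unif_colouring c.

End Probability.

(* Main.v *)
(** All random properties are union bounds in the product space that gives every
    pair of vertices an independent presence bit and an independent colour.  With
    high probability: any linear-sized sets of vertices and colours are joined by a
    random edge of such a colour; every vertex has, outside any small forbidden
    sets, a [G0]-neighbour along a fresh colour, also inside a small reserve [V']
    with reserve colours [C']; every colour occurs on a [G0]-edge inside [V']; and
    for any two colours [p], [q] there are "switches" [u x y u'] with [ux] of colour
    [p], [uy] of colour [q] and [u'x], [u'y] of one common colour.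

    Switches give gadgets: paths with fixed ends that can swallow exactly one pair
    (vertex, colour) from a prescribed list of bounded length.  A bounded-degree
    bipartite template, robust under deletion of any subset of the reserve of the
    right size, tells which lists to use, so that the gadgets together absorb any
    leftover of [V'] and [C'] of the correct cardinality.

    Each of the bare paths is cut as hole -- gadget -- hole.  The gadgets are fixed
    first.  The rest of the tree is embedded greedily along random edges, the few
    vertices that get stuck being placed in the reserve.  Each hole is then filled
    by two connections through the reserve around a middle edge which uses up one
    leftover vertex or colour outside the reserve.  Counting vertices and edges of
    the tree, what remains of the reserve is exactly what the gadgets absorb. *)

Require Import Defs.
From HB Require Import structures.
From mathcomp Require Import all_boot all_order all_fingroup all_algebra.
From mathcomp Require Import boolp reals.
From mathcomp Require Import zify ring lra.

Set Implicit Arguments.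
Unset Strict Implicit.
Unset Printing Implicit Defensive.

Import Order.TTheory GRing.Theory Num.Theory.

(** * Product measures and resampling *)

Local Open Scope ring_scope.

(** Concentration inequalities are avoided. Most random properties hold for every forbidden set of
    at most [n / M] vertices or colours; these sets number at most [b ^ n] with [b] close to [1],
    while each failure has probability at most [beta ^ n]. Such robustness also gives lower bounds
    on cardinalities: a set found to be small could be forbidden as well. Once the outcome is
    typical the embedding is deterministic. Only the sparse random edges face arbitrary linear-sized
    sets, and there a large [C] beats [8 ^ n].

    The obstacle is the switches: the edges tried and the colours wanted depend on colours already
    seen. They are exposed in stages, each resampling a set of pairs that may itself depend on the
    outcome.

    The constants come in the order: robustness [Me] for gadgets, smallness of the reserve in terms
    of [Me], robustness [Ml] inside the reserve, path length [k = 6 / zeta], and finally [C]. The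
    last count is exact because vertices and edges of the tree number [n] and [n - 1], as do the
    available vertices and colours. *)

Section ProductSpace.
Variables (R : realType) (I X : finType) (w : X -> R).
Hypothesis w_ge0 : forall x, 0 <= w x.
Hypothesis w_sum : \sum_x w x = 1.
Local Notation Om := {ffun I -> X}.

Definition wt (o : Om) : R := \prod_i w (o i).
Definition Pr (A : pred Om) : R := \sum_(o | A o) wt o.

Lemma wt_ge0 o : 0 <= wt o.
Proof. exact: prodr_ge0. Qed.

Lemma Pr_family (S : I -> pred X) :
  Pr (fun o => [forall i, S i (o i)]) = \prod_i \sum_(x | S i x) w x.
Proof.
rewrite bigA_distr_big_dep /=; apply: eq_bigl => o.
by apply/forallP/familyP => h i; have := h i; rewrite ?inE.
Qed.

Lemma Pr_total : Pr xpredT = 1.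
Proof.
rewrite -[RHS](_ : \prod_(i : I) \sum_(x | xpredT x) w x = 1).
  by rewrite -(Pr_family (fun=> xpredT)); apply: eq_bigl => o; apply/esym/forallP.
by rewrite big1 // => i _; apply: w_sum.
Qed.

Lemma Pr_le (A B : pred Om) : (forall o, A o -> B o) -> Pr A <= Pr B.
Proof.
move=> AB; rewrite /Pr [leRHS](bigID A) /=.
rewrite [X in _ <= X + _](eq_bigl A).
  by rewrite lerDl; apply: sumr_ge0 => o _; apply: wt_ge0.
by move=> o; apply/andP/idP => [[]//|/[dup] /AB -> ->].
Qed.

Lemma Pr_split (A B : pred Om) :
  Pr A = Pr (fun o => A o && B o) + Pr (fun o => A o && ~~ B o).
Proof. exact: bigID. Qed.

Lemma Pr_union2 (A B : pred Om) : Pr (fun o => A o || B o) <= Pr A + Pr B.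
Proof.
rewrite (Pr_split _ A); apply: lerD; apply: Pr_le => o.
  by case/andP.
by case/andP=> /orP[->|].
Qed.

Lemma Pr_union (J : finType) (A : J -> pred Om) :
  Pr (fun o => [exists j, A j o]) <= \sum_j Pr (A j).
Proof.
suff H (s : seq J) : Pr (fun o => has (fun j => A j o) s) <= \sum_(j <- s) Pr (A j).
  apply: le_trans (H (index_enum J)); apply: Pr_le => o /existsP[j Aj].
  by apply/hasP; exists j; rewrite ?mem_index_enum.
elim: s => [|j s IHs] /=; first by rewrite big_nil /Pr big_pred0.
by rewrite big_cons; apply: le_trans (Pr_union2 _ _) _; rewrite lerD2l.
Qed.

Lemma Pr_union_le (J : finType) (A : J -> pred Om) (b : R) :
  (forall j, Pr (A j) <= b) -> Pr (fun o => [exists j, A j o]) <= #|J|%:R * b.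
Proof.
move=> h; apply: le_trans (Pr_union A) _.
by rewrite mulr_natl -sumr_const; apply: ler_sum.
Qed.

Lemma Pr_compl (A : pred Om) : Pr A = 1 - Pr (fun o => ~~ A o).
Proof. by rewrite -Pr_total (Pr_split xpredT A) /= addrK. Qed.

Definition resamp (E : {set I}) (o o' : Om) : Om :=
  [ffun i => if i \in E then o' i else o i].

Lemma resampE_in (E : {set I}) o o' i : i \in E -> resamp E o o' i = o' i.
Proof. by rewrite ffunE => ->. Qed.

Lemma resampE_out (E : {set I}) o o' i : i \notin E -> resamp E o o' i = o i.
Proof. by rewrite ffunE => /negbTE->. Qed.

(* Exchanging the coordinates in [E o] of two independent samples is a
   weight-preserving involution of pairs of samples. *)
Lemma Pr_resample (E : Om -> {set I}) (A : pred Om) :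
  (forall o o', E (resamp (E o) o o') = E o) ->
  Pr A = \sum_o wt o * Pr (fun o' => A (resamp (E o) o o')).
Proof.
move=> EE; pose sw (oo : Om * Om) := (resamp (E oo.1) oo.1 oo.2, resamp (E oo.1) oo.2 oo.1).
have swK : involutive sw.
  case=> o o'; rewrite /sw /= EE; congr pair; apply/ffunP => i.
    by rewrite /resamp !ffunE; case: (i \in _).
  by rewrite /resamp !ffunE; case: (i \in _).
have -> : \sum_o wt o * Pr (fun o' => A (resamp (E o) o o')) =
          \sum_(oo : Om * Om | A (sw oo).1) wt oo.1 * wt oo.2.
  rewrite (eq_bigr (fun o => \sum_(o' | A (resamp (E o) o o')) wt o * wt o')).
    by rewrite pair_big_dep.
  by move=> o _; rewrite /Pr mulr_sumr.
rewrite (reindex_inj (inv_inj swK)) /=.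
rewrite (eq_bigl (fun oo : Om * Om => A oo.1 && true)); last first.
  by move=> oo; rewrite [resamp _ _ _](_ : _ = (sw (sw oo)).1) // swK andbT.
rewrite (eq_bigr (fun oo : Om * Om => wt oo.1 * wt oo.2)).
  rewrite -(pair_big_dep A (fun _ _ => true) (fun o o' => wt o * wt o')) /=.
  by apply: eq_bigr => o _; rewrite -mulr_sumr -/(Pr xpredT) Pr_total mulr1.
case=> o o' _; rewrite /wt /= -!big_split /=; apply: eq_bigr => i _.
by rewrite !ffunE; case: ifP; rewrite // mulrC.
Qed.

(** Distinct coordinates are independent, so the misses multiply; [m] of the factors suffice because
    [rho <= 1]. *)
Lemma Pr_avoid (Pi : {set I}) (t : I -> pred X) (rho : R) (m : nat) :
  0 <= rho <= 1 -> (m <= #|Pi|)%N ->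
  (forall i, i \in Pi -> \sum_(x | ~~ t i x) w x <= rho) ->
  Pr (fun o => [forall i in Pi, ~~ t i (o i)]) <= rho ^+ m.
Proof.
move=> /andP[r0 r1] mP ht.
apply: (@le_trans _ _ (Pr (fun o => [forall i, (i \in Pi) ==> ~~ t i (o i)]))).
  by apply: Pr_le.
rewrite (Pr_family (fun i x => (i \in Pi) ==> ~~ t i x)).
rewrite (bigID (mem Pi)) /= [X in _ * X]big1 ?mulr1; last first.
  by move=> i /negbTE->; rewrite /= w_sum.
apply: (@le_trans _ _ (\prod_(i in Pi) rho)).
  apply: ler_prod => i iP; rewrite iP /= ht // andbT.
  by apply: sumr_ge0.
by rewrite prodr_const; apply: ler_wiXn2l.
Qed.

(** Adaptive form: candidates [Pi o], tests [t o] and coordinates [E o] may depend on the outcome,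
    but not on its values in [E o]. Resampling these values leaves the candidates fixed and makes
    their coordinates fresh, so the independent bound applies conditionally. *)
Lemma Pr_hit (J : finType) (idx : J -> I) (E : Om -> {set I})
    (Pi : Om -> {set J}) (t : Om -> J -> pred X) (rho : R) (m : nat) :
  0 <= rho <= 1 ->
  (forall o o', E (resamp (E o) o o') = E o) ->
  (forall o o', Pi (resamp (E o) o o') = Pi o) ->
  (forall o o' j, j \in Pi o -> t (resamp (E o) o o') j =1 t o j) ->
  (forall o, {in Pi o &, injective idx}) ->
  (forall o j, j \in Pi o -> idx j \in E o) ->
  (forall o j, j \in Pi o -> \sum_(x | ~~ t o j x) w x <= rho) ->
  Pr (fun o => (m <= #|Pi o|)%N && [forall j in Pi o, ~~ t o j (o (idx j))])
    <= rho ^+ m.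
Proof.
move=> r01 EE PiE tE inj PE ht; rewrite (Pr_resample _ EE).
rewrite -[leRHS]mul1r -Pr_total /Pr mulr_suml; apply: ler_sum => o _.
apply: ler_wpM2l; first exact: wt_ge0.
have r0 : 0 <= rho by case/andP: r01.
case: (leqP m #|Pi o|) => [mP|]; last first.
  move=> mP; rewrite (_ : \sum_(_ | _) _ = 0) ?exprn_ge0 //.
  by rewrite big1 // => o'; rewrite PiE leqNgt mP.
(* The tests are reindexed by coordinates. Injectivity of [idx] on [Pi o] gives each coordinate of
   the image exactly one test; the default [false] is not reached there. *)
pose t' i : pred X := fun x =>
  if [pick j in Pi o | idx j == i] is Some j then t o j x else false.
apply: le_trans (@Pr_avoid (idx @: Pi o) t' rho m r01 _ _).
- apply: Pr_le => o' /andP[_ /forall_inP h].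
  apply/forall_inP => i /imsetP[j jP ->]; rewrite /t'.
  case: pickP => [j' /andP[j'P /eqP e]|//].
  have := h j'; rewrite PiE => /(_ j'P); rewrite tE // resampE_in ?PE //.
  by rewrite e.
- by rewrite card_in_imset.
- move=> i /imsetP[j jP ->]; apply: le_trans (ht o j jP).
  rewrite le_eqVlt; apply/orP; left; apply/eqP; apply: eq_bigl => x; rewrite /t'.
  case: pickP => [j' /andP[j'P /eqP e]|/(_ j)]; last by rewrite jP eqxx.
  by rewrite (inj o j' j).
Qed.

Lemma Pr_hit_const (J : finType) (idx : J -> I) (Pi : {set J})
    (t : J -> pred X) (rho : R) (m : nat) :
  0 <= rho <= 1 -> (m <= #|Pi|)%N -> {in Pi &, injective idx} ->
  (forall j, j \in Pi -> \sum_(x | ~~ t j x) w x <= rho) ->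
  Pr (fun o => [forall j in Pi, ~~ t j (o (idx j))]) <= rho ^+ m.
Proof.
move=> r01 mP inj ht.
apply: le_trans (@Pr_hit J idx (fun=> setT) (fun=> Pi) (fun=> t) rho m _ _ _ _ _ _ _) => //.
by apply: Pr_le => o h; rewrite mP.
Qed.

End ProductSpace.

(** * Transfer of the random model to the product space *)

Section Transfer.
Variables (R : realType) (n : nat) (K : finType) (p : R).
Hypothesis p01 : 0 <= p <= 1.
Hypothesis K_gt0 : (0 < #|K|)%N.
Local Notation Om := {ffun {set 'I_n} -> bool * K}.

Definition ew (x : bool * K) : R := (if x.1 then p else 1 - p) / #|K|%:R.

Lemma ew_ge0 x : 0 <= ew x.
Proof.
rewrite divr_ge0 ?ler0n //; case: ifP => _; first by case/andP: p01.
by rewrite subr_ge0; case/andP: p01.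
Qed.

Let kneq0 : #|K|%:R != 0 :> R.
Proof. by rewrite pnatr_eq0 -lt0n. Qed.

Lemma ew_sum_pred (P : pred bool) (Q : pred K) :
  \sum_(x | P x.1 && Q x.2) ew x =
  (\sum_(b | P b) if b then p else 1 - p) * (#|Q|%:R / #|K|%:R).
Proof.
rewrite -(pair_big P Q (fun b k => (if b then p else 1 - p) / #|K|%:R)) /=.
rewrite mulr_suml; apply: eq_bigr => b _.
by rewrite (eq_bigl (mem Q)) // sumr_const -[_ *+ _]mulr_natl mulrCA.
Qed.

Lemma ew_sum : \sum_x ew x = 1.
Proof.
have := ew_sum_pred xpredT xpredT; rewrite /= big_bool /= => ->.
by rewrite divff // mulr1 addrC subrK.
Qed.

Lemma ew_sum_col (Q : pred K) :
  \sum_(x | Q x.2) ew x = #|Q|%:R / #|K|%:R.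
Proof.
have := ew_sum_pred xpredT Q; rewrite /= big_bool /= => ->.
by rewrite [p + _]addrC subrK mul1r.
Qed.

Lemma ew_avoid (Q : pred K) :
  \sum_(x | ~~ (x.1 && Q x.2)) ew x = 1 - p * (#|Q|%:R / #|K|%:R).
Proof.
have /eqP := ew_sum; rewrite (bigID (fun x : bool * K => x.1 && Q x.2)) /=.
have -> : \sum_(x | x.1 && Q x.2) ew x = p * (#|Q|%:R / #|K|%:R).
  by rewrite (ew_sum_pred id Q) big_mkcond big_bool /= addr0.
by rewrite addrC eq_sym -subr_eq => /eqP.
Qed.

Lemma Hgraph_subproof (o : Om) : [set e in pairs 'I_n | (o e).1] \subset pairs 'I_n.
Proof. by apply/subsetP => e; rewrite inE => /andP[]. Qed.

Definition Hgraph (o : Om) : sgraph 'I_n := SGraph (Hgraph_subproof o).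

Definition colouring_of (G : sgraph 'I_n) (o : Om) : {ffun edge G -> K} :=
  [ffun e => (o (val e)).2].

(** The outcomes inducing a given [H] and a given colouring form a cylinder. Bits of sets that are
    not pairs, and colours of sets that are not edges of the union, are unconstrained and their
    weights sum to [1]. *)
Lemma perturbed_prob_product (G0 : sgraph 'I_n)
    (A : forall G : sgraph 'I_n, pred {ffun edge G -> K}) :
  perturbed_coloured_prob G0 p A =
  Pr ew (fun o => A (gunion G0 (Hgraph o)) (colouring_of (gunion G0 (Hgraph o)) o)).
Proof.
rewrite /perturbed_coloured_prob /Pr (partition_big Hgraph xpredT) //=.
apply: eq_bigr => H _; set G := gunion G0 H; rewrite mulr_sumr.
rewrite (eq_bigl (fun o => A G (colouring_of G o) && (Hgraph o == H))); last first.
  by move=> o; case: eqP => [e|]; rewrite ?andbT ?andbF // /G -e.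
rewrite (partition_big (colouring_of G) (fun c => A G c)) /=; last first.
  by move=> o /andP[].
apply: eq_bigr => c Ac.
pose S e (x : bool * K) := ((e \in pairs 'I_n) ==> (x.1 == (e \in edges H))) &&
  (if insub e : option (edge G) is Some e' then x.2 == c e' else true).
rewrite (eq_bigl (fun o : Om => [forall e, S e (o e)])); last first.
  move=> o; apply/idP/forallP => [|h].
    case/andP=> /andP[_ /eqP HH] /eqP cc e; rewrite /S; apply/andP; split.
      by apply/implyP => ep; rewrite -HH /= inE ep.
    by case: insubP => [e' _ ve|//]; rewrite -cc ffunE ve.
  have cG : colouring_of G o = c.
    apply/ffunP => e; rewrite ffunE; have /andP[_] := h (val e).
    by rewrite valK => /eqP.
  have HH : Hgraph o = H.
    apply: val_inj; apply/setP => e /=; rewrite inE.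
    case ep: (e \in pairs 'I_n) => /=.
      by have /andP[/implyP/(_ ep)/eqP] := h e.
    by apply/esym/negbTE; apply: contraFN ep; apply/subsetP; apply: edges_pairs.
  by rewrite cG HH Ac !eqxx.
rewrite -/(Pr _ _) (Pr_family ew S).
rewrite /gnp /unif_colouring [X in X * _]big_mkcond /=.
have -> : \prod_(e : edge G) (#|K|%:R^-1 : R) =
          \prod_(e : {set 'I_n}) (if e \in edges G then #|K|%:R^-1 else 1).
  rewrite -big_mkcond /= prodr_const (eq_card (_ : _ =i {: edge G})) //.
  by rewrite card_sig -prodr_const; apply: eq_bigl => e; rewrite inE.
rewrite -big_split /=; apply: eq_bigr => e _; rewrite /S.
case: (boolP (e \in pairs 'I_n)) => ep /=; last first.
  have eG : e \notin edges G by apply: contra ep; apply/subsetP; apply: edges_pairs.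
  by rewrite insubN // (negbTE eG) mulr1 -ew_sum; apply: eq_bigl => x.
case: (boolP (e \in edges G)) => eG.
  rewrite (insubT (fun e => e \in edges G) eG) /=.
  rewrite (ew_sum_pred (fun b => b == (e \in edges H)) (pred1 (c (Sub e eG)))).
  by rewrite big_pred1_eq card1 mul1r.
rewrite insubN // mulr1.
rewrite (ew_sum_pred (fun b => b == (e \in edges H)) xpredT).
by rewrite big_pred1_eq divff ?mulr1.
Qed.

End Transfer.

(** * Numerical estimates for union bounds *)

Section Estimates.
Variable R : realType.
Implicit Types (x b rho beta eps : R).

Lemma bernoulli_ge x n : 0 <= x -> 1 + n%:R * x <= (1 + x) ^+ n.
Proof.
move=> x0; elim: n => [|n IHn]; first by rewrite mul0r addr0 expr0.
rewrite exprS; apply: le_trans (ler_wpM2l _ IHn); last lra.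
have : 0 <= n%:R * (x * x) by rewrite !mulr_ge0 ?ler0n.
by rewrite -natr1 !(mulrDl, mulrDr, mul1r, mulr1) mulrCA; lra.
Qed.

Lemma bernoulli_le x n : 0 <= x <= 1 -> 1 - n%:R * x <= (1 - x) ^+ n.
Proof.
move=> /andP[x0 x1]; elim: n => [|n IHn]; first by rewrite mul0r subr0 expr0.
rewrite exprS; apply: le_trans (ler_wpM2l _ IHn); last lra.
have : 0 <= n%:R * (x * x) by rewrite !mulr_ge0 ?ler0n.
by rewrite -natr1; nra.
Qed.

(** Bernoulli gives [rho <= beta ^ M] for [beta = 1 - (1 - rho) / M], so [n / M] independent trials
    already fail with probability exponentially small in [n]. *)
Lemma expr_root_le rho (M : nat) : 0 <= rho < 1 -> (0 < M)%N ->
  exists beta, 0 <= beta < 1 /\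
    forall s n : nat, (n <= s * M)%N -> rho ^+ s <= beta ^+ n.
Proof.
move=> /andP[r0 r1] M0; have M0' : 0 < M%:R :> R by rewrite ltr0n.
have M1 : 1 <= M%:R :> R by rewrite ler1n.
set t := (1 - rho) / M%:R; have t0 : 0 < t by rewrite divr_gt0 // subr_gt0.
have t1 : t <= 1 by rewrite ler_pdivrMr // mul1r; lra.
exists (1 - t); split; first lra.
move=> s n ns; apply: (@le_trans _ _ ((1 - t) ^+ M ^+ s)).
  apply: lerXn2r; rewrite ?nnegrE ?exprn_ge0 //; first lra.
  apply: le_trans (bernoulli_le M _); last lra.
  by rewrite /t mulrCA divff ?lt0r_neq0 // mulr1; lra.
rewrite -exprM; apply: ler_wiXn2l; [lra|lra|by rewrite mulnC].
Qed.

(** Room for a union bound: the decay [beta ^ n] survives [j] factors [b ^ n]. Here [sigma] is the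
    midpoint of [beta] and [1], and [b = 1 / (1 - t)] with [t] so small that
    [(1 - t) ^ j >= beta / sigma]. *)
Lemma expr_room beta (j : nat) : 0 <= beta < 1 ->
  exists b sigma, [/\ 1 < b, 0 <= sigma < 1 & b ^+ j * beta <= sigma].
Proof.
move=> /andP[b0 b1]; pose s := (1 + beta) / 2.
have s1 : s < 1 by rewrite /s; lra.
have s0 : 0 < s by rewrite /s; lra.
pose q := beta / s; have q0 : 0 <= q by rewrite divr_ge0 // ltW.
have q1 : q < 1 by rewrite ltr_pdivrMr // mul1r /s; lra.
pose t := (1 - q) / j.+2%:R.
have j0 : 0 < j.+2%:R :> R by rewrite ltr0n.
have j2 : 2 <= j.+2%:R :> R by rewrite ler_nat.
have t0 : 0 < t by rewrite divr_gt0 // subr_gt0.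
have t1 : t < 1 by rewrite ltr_pdivrMr // mul1r; lra.
exists (1 - t)^-1, s; split; [|lra|].
  by rewrite invf_gt1; lra.
rewrite exprVn mulrC ler_pdivrMr ?exprn_gt0 ?subr_gt0 //.
rewrite mulrC -ler_pdivrMr // -/q.
apply: le_trans (bernoulli_le j _); last lra.
have : j%:R * t <= j.+2%:R * t by rewrite ler_pM2r // ler_nat; lia.
have -> : j.+2%:R * t = 1 - q by rewrite /t mulrCA divff ?lt0r_neq0 // mulr1.
lra.
Qed.

Lemma expr_small rho eps : 0 <= rho < 1 -> 0 < eps ->
  exists N : nat, forall n, (N <= n)%N -> rho ^+ n <= eps.
Proof.
move=> /andP[r0 r1] e0.
pose r := (1 + rho) / 2; have rr : 0 < r < 1 by rewrite /r; lra.
have [r'0 r'1] := andP rr.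
pose x := r^-1 - 1; have x0 : 0 < x by rewrite subr_gt0 invf_gt1.
exists (Num.truncn (eps^-1 / x)).+1 => n Nn.
apply: (@le_trans _ _ (r ^+ n)).
  by apply: lerXn2r; rewrite ?nnegrE /r; lra.
have -> : r = (1 + x)^-1 by rewrite /x addrC subrK invrK.
rewrite exprVn invf_ple ?posrE ?exprn_gt0 //; last lra.
apply: le_trans (bernoulli_ge n (ltW x0)).
have : eps^-1 / x < n%:R.
  by apply: lt_le_trans (truncnS_gt _) _; rewrite ler_nat.
by rewrite ltr_pdivrMr // => ?; apply: ltW; lra.
Qed.

Lemma natr_le_expr b : 1 < b ->
  exists c, 0 < c /\ forall n : nat, n%:R <= c * b ^+ n.
Proof.
move=> b1; have x0 : 0 < b - 1 by rewrite subr_gt0.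
exists (b - 1)^-1; split; first by rewrite invr_gt0.
move=> n; rewrite mulrC ler_pdivlMr //.
have := bernoulli_ge n (ltW x0); rewrite [1 + (b - 1)]addrC subrK; lra.
Qed.

Lemma sum_expr_card (T : finType) (x : R) :
  \sum_(Q : {set T}) x ^+ #|Q| = (1 + x) ^+ #|T|.
Proof.
have -> : (1 + x) ^+ #|T| = \prod_(i : T) (x + 1).
  by rewrite prodr_const addrC; congr (_ ^+ _); apply: eq_card.
rewrite bigA_distr; apply: eq_bigr => Q _.
rewrite -big_mkcond /= prodr_const.
by congr (_ ^+ _); apply: eq_card => i.
Qed.

Definition small_sets (T : finType) (M n : nat) := [set Q : {set T} | #|Q| * M <= n]%N.

(** A weighted count in place of entropy. Once [(1 + x) ^ M * x >= 1], each small set has weight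
    [(1 + x) ^ n * x ^ #|Q|] at least [1], while all subsets together weigh at most
    [(1 + x) ^ (2 * n) <= b ^ n]. *)
Lemma card_small_sets b : 1 < b ->
  exists2 M0 : nat, (0 < M0)%N & forall M n (T : finType), (M0 <= M)%N ->
    (#|T| <= n)%N -> #|small_sets T M n|%:R <= b ^+ n.
Proof.
move=> b1; pose x := Num.min 1 ((b - 1) / 3).
have x0 : 0 < x by rewrite lt_min ltr01 /= divr_gt0 ?subr_gt0.
have x1 : x <= 1 by rewrite ge_min lexx.
have xb : (1 + x) * (1 + x) <= b.
  have xb' : x <= (b - 1) / 3 by rewrite ge_min lexx orbT.
  have : x * x <= x by rewrite ger_pMr.
  rewrite !(mulrDl, mulrDr, mul1r, mulr1) => ?; lra.

have [M0 hM0] : exists N : nat, forall n, (N <= n)%N -> (1 + x)^-1 ^+ n <= x.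
  apply: expr_small => //; rewrite invr_ge0 addr_ge0 ?ltW //=.
  by rewrite invf_lt1; lra.
exists M0.+1 => // M n T MM Tn.
have h1 : 0 < 1 + x by lra.
have hM : 1 <= (1 + x) ^+ M * x.
  have := hM0 M (ltnW MM); rewrite exprVn => h.
  have p0 : 0 < (1 + x) ^+ M by rewrite exprn_gt0.
  by rewrite -[leLHS](@mulfV _ ((1 + x) ^+ M)) ?lt0r_neq0 // ler_pM2l.
apply: (@le_trans _ _ (\sum_(Q in small_sets T M n) (1 + x) ^+ n * x ^+ #|Q|)).
  rewrite -sum1_card natr_sum; apply: ler_sum => Q; rewrite inE => QM.
  apply: (@le_trans _ _ (((1 + x) ^+ M * x) ^+ #|Q|)); first exact: exprn_ege1.
  rewrite exprMn -exprM; apply: ler_wpM2r; first by rewrite exprn_ge0 // ltW.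
  by apply: ler_weXn2l; [lra | rewrite mulnC].
rewrite -mulr_sumr.
apply: (@le_trans _ _ ((1 + x) ^+ n * (1 + x) ^+ n)); last first.
  by rewrite -exprMn; apply: lerXn2r; rewrite ?nnegrE ?mulr_ge0 //; lra.
apply: ler_wpM2l; first by rewrite exprn_ge0 // ltW.
apply: (@le_trans _ _ ((1 + x) ^+ #|T|)); last by apply: ler_weXn2l => //; lra.
rewrite -sum_expr_card [leRHS](bigID (mem (small_sets T M n))) /= lerDl.
by apply: sumr_ge0 => Q _; rewrite exprn_ge0 // ltW.
Qed.

(** The factor [n ^ 4] costs four powers of [b ^ n] and the two families of small sets one each,
    whence the [6] passed to [expr_room]. *)
Lemma union_bound_small beta : 0 <= beta < 1 ->
  exists2 M0 : nat, (0 < M0)%N & forall M, (M0 <= M)%N -> forall eps, 0 < eps ->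
  exists N : nat, forall n (T1 T2 : finType), (N <= n)%N ->
    (#|T1| <= n)%N -> (#|T2| <= n)%N ->
    n%:R ^+ 4 * #|small_sets T1 M n|%:R * #|small_sets T2 M n|%:R * beta ^+ n <= eps.
Proof.
move=> hb; have [b [s [b1 hs bs]]] := expr_room 6 hb.
have [M0 M00 hM0] := card_small_sets b1.
have [c [c0 hc]] := natr_le_expr b1.
exists M0 => // M MM eps e0.
have c40 : 0 < c ^+ 4 by rewrite exprn_gt0.
have [N hN] := expr_small hs (divr_gt0 e0 c40).
exists N => n T1 T2 Nn h1 h2.
have bn0 : 0 <= b ^+ n by rewrite exprn_ge0 //; lra.
have be0 : 0 <= beta ^+ n by rewrite exprn_ge0 //; case/andP: hb.
apply: (@le_trans _ _ ((c * b ^+ n) ^+ 4 * b ^+ n * b ^+ n * beta ^+ n)).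
  apply: ler_wpM2r => //; apply: ler_pM; rewrite ?mulr_ge0 ?exprn_ge0 ?ler0n //; last exact: hM0.
  apply: ler_pM; rewrite ?exprn_ge0 ?ler0n //; last exact: hM0.
  by apply: lerXn2r; rewrite ?nnegrE ?ler0n ?mulr_ge0 // ltW.
have -> : (c * b ^+ n) ^+ 4 * b ^+ n * b ^+ n * beta ^+ n = c ^+ 4 * (b ^+ 6 * beta) ^+ n.
  rewrite (exprMn n (b ^+ 6) beta) (exprAC b 6 n); ring.
apply: (@le_trans _ _ (c ^+ 4 * s ^+ n)); last by rewrite mulrC -ler_pdivlMr // hN.
apply: ler_wpM2l; first exact: ltW.
apply: lerXn2r; rewrite ?nnegrE //; last by case/andP: hs.
by rewrite mulr_ge0 ?exprn_ge0 //; [lra|case/andP: hb].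
Qed.

(** Replaces the exponential function: with [y = x / n], [(1 - y) ^ n * (1 + y) ^ n <= 1] and
    [(1 + y) ^ n >= 1 + x]. *)
Lemma one_minus_div_expr x n : (0 < n)%N -> 0 <= x <= n%:R ->
  (1 - x / n%:R) ^+ n <= (1 + x)^-1.
Proof.
move=> n0 /andP[x0 xn]; have n0' : 0 < n%:R :> R by rewrite ltr0n.
have y0 : 0 <= x / n%:R by rewrite divr_ge0 // ltW.
have y1 : x / n%:R <= 1 by rewrite ler_pdivrMr // mul1r.
rewrite -[leRHS]mul1r ler_pdivlMr; last lra.
apply: (@le_trans _ _ ((1 - x / n%:R) ^+ n * (1 + x / n%:R) ^+ n)).
  apply: ler_wpM2l; first by rewrite exprn_ge0; lra.
  apply: le_trans (bernoulli_ge n y0).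
  by rewrite mulrCA divff ?lt0r_neq0 // mulr1.
rewrite -exprMn exprn_ile1 //; nra.
Qed.

(** For quadratically many pairs, each of a prescribed colour with chance [1 / n]: [n] of them all
    miss with probability at most [1 / 2], and there are at least [n / M] such batches. *)
Lemma hit_square_bound (M : nat) : (0 < M)%N ->
  exists2 beta, 0 <= beta < 1 &
  forall n m : nat, (0 < n)%N -> (n * n <= m * M)%N ->
    (1 - n%:R^-1) ^+ m <= beta ^+ n :> R.
Proof.
move=> M0; have h2 : (0 <= (2^-1 : R)) && ((2^-1 : R) < 1) by lra.
have [beta [hb H]] := expr_root_le h2 M0; have [b0 b1] := andP hb.
exists beta => // n m n0 nm.
have n1 : 1 <= n%:R :> R by rewrite ler1n.
have n0' : 0 < n%:R :> R by rewrite ltr0n.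
have i0 : 0 < n%:R^-1 :> R by rewrite invr_gt0.
have i1 : n%:R^-1 <= 1 :> R by rewrite invf_le1.
rewrite -(@ler_pXn2r _ M) // ?nnegrE ?exprn_ge0 //; last lra.
rewrite -exprM.
apply: (@le_trans _ _ ((1 - n%:R^-1) ^+ (n * n))).
  by apply: ler_wiXn2l => //; lra.
rewrite exprM; apply: (@le_trans _ _ (2^-1 ^+ n)).
  apply: lerXn2r; rewrite ?nnegrE ?exprn_ge0 //; try lra.
  have := @one_minus_div_expr 1 n n0; rewrite mul1r ler01 n1 => /(_ isT).
  by rewrite (_ : 1 + 1 = 2 :> R) //; lra.
by rewrite -exprM; apply: H.
Qed.

End Estimates.

(** * Typical properties of the coloured graph *)

Lemma robust_card (T : finType) (S Q : {set T}) (M M' n : nat) :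
  (n <= #|S| * M' -> 2 * M' <= M -> #|Q| * M <= n -> n <= #|S :\: Q| * (2 * M'))%N.
Proof.
move=> h1 h2 h3; have h4 : (#|Q| * (2 * M') <= n)%N.
  by apply: leq_trans h3; rewrite leq_mul2l h2 orbT.
have h5 : (#|S| - #|Q| <= #|S :\: Q|)%N.
  by rewrite cardsD leq_sub2l // subset_leq_card // subsetIr.
apply: (@leq_trans ((#|S| - #|Q|) * (2 * M'))); last by rewrite leq_mul2r h5 orbT.
rewrite mulnBl; lia.
Qed.

Lemma set2_inj_l (T : finType) (y : T) (A : {set T}) : y \notin A ->
  {in A &, injective (fun r => [set y; r])}.
Proof.
move=> yA r r' rA r'A /setP /(_ r); rewrite !inE eqxx orbT.
by case: eqP => [e|_ /esym /eqP //]; rewrite -e rA in yA.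
Qed.

Section RandomProperties.
Variable R : realType.

Lemma col_avoid_le (K : finType) (p : R) (Q : pred K) (k : R) :
  0 <= p <= 1 -> (0 < #|K|)%N -> k * #|K|%:R <= #|Q|%:R ->
  \sum_(x : bool * K | ~~ Q x.2) ew p x <= 1 - k.
Proof.
move=> p01 K0 hk; rewrite (ew_sum_col p (predC Q)).
have K0' : 0 < #|K|%:R :> R by rewrite ltr0n.
rewrite ler_pdivrMr // mulrBl mul1r.
have : (#|Q| + #|predC Q|)%:R = #|K|%:R :> R by rewrite cardC.
by rewrite natrD; lra.
Qed.

Definition ocol (n : nat) (K : finType) (o : {ffun {set 'I_n} -> bool * K})
  (x y : 'I_n) : K := (o [set x; y]).2.

Definition ohit (n : nat) (K : finType) (o : {ffun {set 'I_n} -> bool * K})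
  (x y : 'I_n) : bool := (o [set x; y]).1.

(** [J] indexes centres [y j] with candidate sets [S j]: all vertices, or all pairs with many common
    neighbours, whence the allowance [n ^ 4]. The edges from one centre are distinct coordinates,
    and each has a colour in [Kc :\: G] with chance at least [1 / (2 * Mk)]. *)
Lemma local_whp (Ms Mk : nat) : (0 < Ms)%N -> (0 < Mk)%N ->
  exists2 M0 : nat, (0 < M0)%N & forall M, (M0 <= M)%N ->
  forall eps : R, 0 < eps -> exists N : nat,
  forall n (K J : finType) (p : R) (y : J -> 'I_n) (S : J -> {set 'I_n}) (Kc : {set K}),
  (N <= n)%N -> 0 <= p <= 1 -> (0 < #|K| <= n)%N -> (#|J| <= n ^ 4)%N ->
  (forall j, y j \notin S j) ->
  (forall j, n <= #|S j| * Ms)%N -> (n <= #|Kc| * Mk)%N ->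
  Pr (ew p) (fun o => `[< ~ forall j (Q : {set 'I_n}) (G : {set K}),
     (#|Q| * M <= n)%N -> (#|G| * M <= n)%N ->
     exists2 r, r \in S j :\: Q & ocol o (y j) r \in Kc :\: G >]) <= eps.
Proof.
move=> Ms0 Mk0; pose rho : R := 1 - (2 * Mk)%:R^-1.
have k2 : 0 < (2 * Mk)%:R^-1 :> R by rewrite invr_gt0 ltr0n; lia.
have k1 : (2 * Mk)%:R^-1 <= 1 :> R by rewrite invf_le1 ?ltr0n ?ler1n; lia.
have hrho : 0 <= rho < 1 by rewrite /rho; lra.
have [||beta [hb Hb]] := @expr_root_le R rho (2 * Ms) => //; first lia.
have [M0 M00 HM0] := union_bound_small hb.
exists (M0 + 2 * Ms + 2 * Mk)%N; first lia.
have Mh M : (M0 + 2 * Ms + 2 * Mk <= M)%N -> [/\ M0 <= M, 2 * Ms <= M & 2 * Mk <= M]%N.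
  by clear => h; split; lia.
move=> M /Mh[MM0 MMs MMk] eps e0; have [N HN] := HM0 M MM0 eps e0.
exists N => n K J p y S Kc Nn p01 /andP[K0 Kn] Jn yS Sn Kcn.
pose SQ := {: {Q : {set 'I_n} | Q \in small_sets 'I_n M n}}.
pose SG := {: {G : {set K} | G \in small_sets K M n}}.
pose A (z : J * ({Q : {set 'I_n} | Q \in small_sets 'I_n M n} *
    {G : {set K} | G \in small_sets K M n})) (o : {ffun {set 'I_n} -> bool * K}) :=
  [forall r in S z.1 :\: val z.2.1, ~~ (ocol o (y z.1) r \in Kc :\: val z.2.2)].
apply: (@le_trans _ _ (Pr (ew p) (fun o => [exists z, A z o]))).
  apply: Pr_le; first exact: ew_ge0.
  move=> o /asboolP h; apply: contrapT => /negP/existsPn h'; apply: h => j Q G hQ hG.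
  have hQ' : Q \in small_sets 'I_n M n by rewrite inE.
  have hG' : G \in small_sets K M n by rewrite inE.
  have := h' (j, (Sub Q hQ', Sub G hG')); rewrite /A /=.
  by case/forall_inPn => r rS; rewrite negbK => hr; exists r.
apply: le_trans (Pr_union_le (ew_ge0 p01) (b := beta ^+ n) _) _; last first.
  apply: le_trans (HN n 'I_n K Nn _ Kn); last by rewrite card_ord.
  rewrite !card_prod !card_sig.
  apply: ler_wpM2r; first by rewrite exprn_ge0 //; case/andP: hb.
  rewrite !natrM mulrA; apply: ler_wpM2r; first exact: ler0n.
  rewrite (eq_card (_ : [pred x | x \in small_sets 'I_n M n] =i small_sets 'I_n M n)) //.
  by apply: ler_wpM2r; rewrite ?ler0n // -natrX ler_nat.
case=> j [[Q hQ] [G hG]]; rewrite /A /=.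
move: (hQ) (hG); rewrite !inE => hQ1 hG1.
have c1 := robust_card (Sn j) (_ : 2 * Ms <= M)%N hQ1.
have c2 := robust_card Kcn (_ : 2 * Mk <= M)%N hG1.
apply: (@le_trans _ _ (rho ^+ #|S j :\: Q|)); last by apply: Hb; apply: c1.
apply: (@Pr_hit_const R _ _ _ (ew_ge0 p01) (ew_sum p K0) 'I_n (fun r => [set y j; r]) (S j :\: Q) (fun r x => x.2 \in Kc :\: G)) => //.
- by rewrite /rho; lra.
- by apply: set2_inj_l; rewrite !inE negb_and yS orbT.
move=> r rS; apply: (@col_avoid_le K p (mem (Kc :\: G))) => //.
rewrite mulrC ler_pdivrMr ?ltr0n ?muln_gt0 ?Mk0 //.
by rewrite -natrM ler_nat; apply: leq_trans Kn _; apply: c2.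
Qed.

(** At most [2 * #|Q| * n <= n * n / (2 * M')] pairs meet [Q], half of the guaranteed size of
    [P]. *)
Lemma pairs_touching (n : nat) (P : {set 'I_n * 'I_n}) (Q : {set 'I_n}) (M M' : nat) :
  (n * n <= #|P| * M' -> 4 * M' <= M -> #|Q| * M <= n ->
   n * n <= #|[set z in P | (z.1 \notin Q) && (z.2 \notin Q)]| * (2 * M'))%N.
Proof.
move=> h1 h2 h3; set P' := [set z in P | _].
have : (#|P| <= #|P'| + 2 * (#|Q| * n))%N.
  have sub : P \subset P' :|: (setX Q setT :|: setX setT Q).
    by apply/subsetP => -[a b] zP; rewrite !inE zP /= andbT; do 2 case: (_ \in Q).
  apply: leq_trans (subset_leq_card sub) _.
  apply: leq_trans (leq_card_setU _ _) _; rewrite leq_add2l.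
  by apply: leq_trans (leq_card_setU _ _) _; rewrite !cardsX !cardsT !card_ord (mulnC n) mul2n addnn leqnn.
have : (#|Q| * (4 * M') <= n)%N.
  by apply: leq_trans h3; rewrite leq_mul2l h2 orbT.
move: (#|P|) (#|P'|) (#|Q|) h1; clear => a b c h1 h2 h3.
have : (c * n * (4 * M') <= n * n)%N by rewrite mulnAC leq_mul2r h2 orbT.
have := leq_mul h3 (leqnn (2 * M')); rewrite mulnDl; move: h1; clear; nia.
Qed.

(** Serves twice: for the hub edges that start a switch, and for the edges of [G0] inside the
    reserve that take up leftover colours. *)
Lemma pairs_hit_whp (M' : nat) : (0 < M')%N ->
  exists2 M0 : nat, (0 < M0)%N & forall M, (M0 <= M)%N ->
  forall eps : R, 0 < eps -> exists N : nat,
  forall n (K : finType) (p : R) (P : {set 'I_n * 'I_n}),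
  (N <= n)%N -> 0 <= p <= 1 -> (0 < #|K| <= n)%N ->
  {in P &, injective (fun z => [set z.1; z.2])} -> (n * n <= #|P| * M')%N ->
  Pr (ew p) (fun o => `[< ~ forall (c : K) (Q : {set 'I_n}), (#|Q| * M <= n)%N ->
     exists x y, [/\ (x, y) \in P, x \notin Q, y \notin Q & ocol o x y = c] >]) <= eps.
Proof.
move=> M'0; have [|beta hb Hb] := @hit_square_bound R (2 * M'); first lia.
have [M0 M00 HM0] := union_bound_small hb.
exists (M0 + 4 * M')%N; first lia.
have Mh M : (M0 + 4 * M' <= M)%N -> [/\ M0 <= M & 4 * M' <= M]%N by clear => h; split; lia.
move=> M /Mh[MM0 MM'] eps e0; have [N HN] := HM0 M MM0 eps e0.
exists N.+1 => n K p P Nn p01 /andP[K0 Kn] inj Pn.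
have n0 : (0 < n)%N by apply: leq_trans Nn.
pose P' (Q : {set 'I_n}) := [set z in P | (z.1 \notin Q) && (z.2 \notin Q)].
pose A (z : K * {Q : {set 'I_n} | Q \in small_sets 'I_n M n})
    (o : {ffun {set 'I_n} -> bool * K}) :=
  [forall z' in P' (val z.2), ~~ (ocol o z'.1 z'.2 == z.1)].
apply: (@le_trans _ _ (Pr (ew p) (fun o => [exists z, A z o]))).
  apply: Pr_le; first exact: ew_ge0.
  move=> o /asboolP h; apply: contrapT => /negP/existsPn h'; apply: h => c Q hQ.
  have hQ' : Q \in small_sets 'I_n M n by rewrite inE.
  have := h' (c, Sub Q hQ'); rewrite /A /=.
  case/forall_inPn => -[x y]; rewrite !inE /= => /and3P[xyP xQ yQ].
  by rewrite negbK => /eqP hr; exists x, y.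
apply: le_trans (Pr_union_le (ew_ge0 p01) (b := beta ^+ n) _) _; last first.
  apply: le_trans (HN n 'I_n K _ _ Kn); [|exact: ltnW|by rewrite card_ord].
  rewrite !card_prod !card_sig natrM.
  apply: ler_wpM2r; first by rewrite exprn_ge0 //; case/andP: hb.
  rewrite (eq_card (_ : [pred x | x \in small_sets 'I_n M n] =i small_sets 'I_n M n)) //.
  rewrite -!natrM -natrX -natrM -natrM ler_nat mulnAC leq_mul2r; apply/orP; right.
  apply: leq_trans (_ : n ^ 4 <= _)%N; last first.
    rewrite leq_pmulr //; apply/card_gt0P; by exists set0; rewrite inE cards0 mul0n.
  by apply: leq_trans Kn _; rewrite -[X in (X <= _)%N]expn1 leq_pexp2l.
case=> c [Q hQ]; rewrite /A /=; move: (hQ); rewrite inE => hQ1.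
have c1 := pairs_touching Pn (_ : 4 * M' <= M)%N hQ1.
have n1 : 1 <= n%:R :> R by rewrite ler1n.
have i0 : 0 < n%:R^-1 :> R by rewrite invr_gt0 ltr0n.
have i1 : n%:R^-1 <= 1 :> R by rewrite invf_le1 ?ltr0n.
apply: (@le_trans _ _ ((1 - n%:R^-1) ^+ #|P' Q|)); last by apply: Hb => //; apply: c1.
apply: (@Pr_hit_const R _ _ _ (ew_ge0 p01) (ew_sum p K0) _ (fun z : 'I_n * 'I_n => [set z.1; z.2]) (P' Q) (fun r x => x.2 == c)) => //.
- lra.
- by move=> z z'; rewrite !inE => /andP[zP _] /andP[z'P _]; apply: inj.
move=> r rS; apply: (@col_avoid_le K p (pred1 c)) => //.
by rewrite card1 mulrC ler_pdivrMr ?ltr0n // mul1r ler_nat.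
Qed.

End RandomProperties.

Lemma subset_of_card (T : finType) (A : {set T}) (q : nat) :
  (q <= #|A|)%N -> exists2 B : {set T}, B \subset A & #|B| = q.
Proof.
move=> qA; exists [set x in take q (enum A)].
  by apply/subsetP => x; rewrite inE => /mem_take; rewrite mem_enum.
rewrite cardsE; have /card_uniqP -> : uniq (take q (enum A)) by rewrite take_uniq ?enum_uniq.
by rewrite size_take -cardE; case: ltngtP qA.
Qed.

Lemma half_quotient (n M : nat) : (0 < M)%N -> (4 * M <= n)%N ->
  exists q, (q * (2 * M) <= n)%N /\ (n <= q * (4 * M))%N.
Proof.
move=> M0 Mn; have M20 : (0 < 2 * M)%N by rewrite muln_gt0.
have d1 := leq_divM n (2 * M); have d2 := ltn_ceil n M20.
have d3 : (1 <= n %/ (2 * M))%N by rewrite leq_divRL // mul1n (leq_trans _ Mn) // leq_mul2r orbT.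
exists (n %/ (2 * M))%N; split=> //; move: (n %/ _)%N d1 d2 d3 => q _ d2 d3.
by move: d2 d3; clear; nia.
Qed.

Lemma set2_inj_disjoint (T : finType) (A B : {set T}) : [disjoint A & B] ->
  {in setX A B &, injective (fun z : T * T => [set z.1; z.2])}.
Proof.
move=> dAB [a b] [a' b']; rewrite !inE /= => /andP[aA bB] /andP[a'A b'B] /setP h.
have ne x y : x \in A -> y \in B -> x == y = false.
  by move=> xA yB; apply: contraTF xA => /eqP->; rewrite (disjointFl dAB yB).
have := h a; have := h b; rewrite !inE !eqxx !orbT /= (ne a b') // orbF.
by rewrite [b == a']eq_sym (ne a' b) //= => /esym /eqP-> /esym /eqP->.
Qed.

Section JointAndClasses.
Variable R : realType.

(** There are at most [8 ^ n] triples [(A, B, G)], so each failure is pushed down to [16 ^- n]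
    through [C]: some [n * n / M2] pairs are available, each of them a random edge with colour in
    [G] with chance at least [C / (M * n)]. *)
Lemma joint_whp (M : nat) : (0 < M)%N -> exists C0 : R, forall C : R, C0 <= C ->
  forall eps : R, 0 < eps -> exists N : nat, forall n (K : finType),
  (N <= n)%N -> (0 < #|K| <= n)%N -> 0 <= C / n%:R <= 1 /\
  Pr (ew (C / n%:R)) (fun o => `[< ~ forall (A B : {set 'I_n}) (G : {set K}),
     (n <= #|A| * M)%N -> (n <= #|B| * M)%N -> (n <= #|G| * M)%N ->
     exists a b, [/\ a \in A, b \in B, a != b, ohit o a b & ocol o a b \in G] >]) <= eps.
Proof.
move=> M0; pose M2 := (16 * (M * M))%N; exists (M%:R * 16 ^+ M2) => C hC eps e0.
have M0' : 0 < M%:R :> R by rewrite ltr0n.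
have C0 : 0 < C by apply: lt_le_trans hC; rewrite mulr_gt0 // exprn_gt0.
have h2 : (0 <= (2^-1 : R)) && ((2^-1 : R) < 1) by lra.
have [N HN] := expr_small h2 e0.
exists (N + (Num.truncn C).+1 + 4 * M)%N => n K Nn /andP[K0 Kn].
have n0 : (0 < n)%N by lia.
have n0' : 0 < n%:R :> R by rewrite ltr0n.
have Cn : C <= n%:R.
  by apply/ltW; apply: lt_le_trans (truncnS_gt C) _; rewrite ler_nat (leq_trans _ Nn) // addnAC leq_addl.
have p01 : 0 <= C / n%:R <= 1.
  apply/andP; split; last by rewrite ler_pdivrMr // mul1r.
  by rewrite divr_ge0 // ltW.
split=> //.
pose A (z : {set 'I_n} * ({set 'I_n} * {set K})) (o : {ffun {set 'I_n} -> bool * K}) :=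
  [&& [disjoint z.1 & z.2.1], (n <= #|z.1| * (4 * M))%N, (n <= #|z.2.1| * (4 * M))%N,
  (n <= #|z.2.2| * M)%N &
  [forall ab in setX z.1 z.2.1, ~~ (ohit o ab.1 ab.2 && (ocol o ab.1 ab.2 \in z.2.2))]].
apply: (@le_trans _ _ (Pr (ew (C / n%:R)) (fun o => [exists z, A z o]))).
  apply: Pr_le; first exact: ew_ge0.
  move=> o /asboolP h; apply: contrapT => /negP/existsPn h'; apply: h => A1 B G hA hB hG.
  (* Disjoint sides turn the pairs into distinct coordinates. As [q] lies between [n / (4 * M)] and
     [n / (2 * M)], removing [q] vertices costs [B] at most half of its guaranteed size. *)
  have [|q [q1 q2]] := @half_quotient n M M0; first by rewrite (leq_trans _ Nn) ?leq_addl.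
  have [|A0 sA cA] := @subset_of_card _ A1 q.
    rewrite -(leq_pmul2r M0); apply: leq_trans hA; apply: leq_trans q1.
    by rewrite leq_mul2l leq_pmull ?orbT.
  have B0 : (n <= #|B :\: A0| * (4 * M))%N.
    have : (#|B| - #|A0| <= #|B :\: A0|)%N.
      by rewrite cardsD leq_sub2l // subset_leq_card // subsetIr.
    rewrite cA; move: (#|B :\: A0|) => b' hb'.
    apply: (@leq_trans ((#|B| - q) * (4 * M))); last by rewrite leq_mul2r hb' orbT.
    move: (#|B|) hB q1; clear => b hB q1; nia.
  have := h' (A0, (B :\: A0, G)); rewrite /A /= B0 hG.
  rewrite (_ : [disjoint A0 & B :\: A0]) /=; last first.
    by rewrite disjoint_sym disjoints_subset setDE subsetIr.
  rewrite (_ : (n <= #|A0| * (4 * M))%N) /=; last by rewrite cA.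
  case/forall_inPn => -[a b]; rewrite !inE /= negbK => /and3P[aA bA bB] /andP[hab cab].
  have ab : a != b by apply: contraNneq bA => <-.
  by exists a, b; split=> //; apply: (subsetP sA).
have bound z : Pr (ew (C / n%:R)) (A z) <= 16^-1 ^+ n.
  case: z => A1 [B G].
  have z16 : 0 <= (16^-1 : R) ^+ n by rewrite exprn_ge0 // invr_ge0 ler0n.
  case: (boolP [&& [disjoint A1 & B], (n <= #|A1| * (4 * M))%N, (n <= #|B| * (4 * M))%N
            & (n <= #|G| * M)%N]); last first.
    move=> h; rewrite /Pr big_pred0 // => o; apply/negbTE; apply: contra h.
    by rewrite /A /= => /and5P[-> -> -> ->].
  case/and4P=> dAB hA hB hG; pose x := C / M%:R.
  have x0 : 0 < x by rewrite divr_gt0.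
  have xC : x <= C by rewrite ler_pdivrMr // ler_peMr ?ler1n // ltW.
  have x16 : 16 ^+ M2 <= 1 + x.
    apply: (@le_trans _ _ x); last by rewrite lerDr.
    by rewrite ler_pdivlMr // mulrC.
  have y0 : 0 <= x / n%:R by rewrite divr_ge0 ?ltW.
  have y1 : x / n%:R <= 1 by rewrite ler_pdivrMr // mul1r; lra.
  apply: (@le_trans _ _ ((1 - x / n%:R) ^+ #|setX A1 B|)).
    apply: (@le_trans _ _ (Pr (ew (C / n%:R)) (fun o => [forall ab in setX A1 B,
       ~~ (ohit o ab.1 ab.2 && (ocol o ab.1 ab.2 \in G))]))).
      apply: Pr_le; first exact: ew_ge0.
      by move=> o /and5P[].
    apply: (@Pr_hit_const R _ _ _ (ew_ge0 p01) (ew_sum _ K0) _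
      (fun z : 'I_n * 'I_n => [set z.1; z.2]) (setX A1 B) (fun r x => x.1 && (x.2 \in G))) => //.
    - lra.
    - exact: set2_inj_disjoint.
    move=> ab _; rewrite ew_avoid // lerD2l lerN2 /x mulrAC.
    apply: ler_wpM2l; first by case/andP: p01.
    rewrite ler_pdivlMr ?ltr0n // mulrC ler_pdivrMr // -natrM ler_nat.
    exact: leq_trans Kn hG.
  have M20 : (0 < M2)%N by rewrite /M2 !muln_gt0 M0.
  rewrite -(@ler_pXn2r _ M2) // ?nnegrE ?exprn_ge0 //; last lra.
  rewrite -!exprM; apply: (@le_trans _ _ ((1 - x / n%:R) ^+ (n * n))).
    apply: ler_wiXn2l; [lra|lra|].
    by rewrite cardsX /M2; move: hA hB; clear; nia.
  rewrite exprM; apply: (@le_trans _ _ ((1 + x)^-1 ^+ n)).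
    apply: lerXn2r; rewrite ?nnegrE ?invr_ge0 ?exprn_ge0 //; try lra.
    by apply: one_minus_div_expr => //; apply/andP; split; lra.
  rewrite mulnC exprM; apply: lerXn2r; rewrite ?nnegrE ?invr_ge0 ?exprn_ge0 //; try lra.
  rewrite exprVn lef_pV2 // posrE ?exprn_gt0 //; lra.
apply: le_trans (Pr_union_le (ew_ge0 p01) bound) _.
have cs (T : finType) : #|{set T}| = (2 ^ #|T|)%N.
  rewrite -[in RHS]cardsT -card_powerset -cardsT; apply: eq_card => A1.
  by rewrite !inE subsetT.
rewrite !card_prod !cs card_ord.
apply: (@le_trans _ _ ((8%:R ^+ n) * 16^-1 ^+ n)).
  apply: ler_wpM2r; first by rewrite exprn_ge0 // invr_ge0 ler0n.
  rewrite -natrX ler_nat (_ : 8 = 2 * (2 * 2))%N // !expnMn.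
  by rewrite !leq_mul2l !orbA leq_pexp2l ?orbT.
rewrite -exprMn (_ : 8%:R * 16^-1 = 2^-1 :> R); last lra.
by apply: HN; lia.
Qed.

(** A random [r]-colouring of the vertices works. That every class keeps a linear part of [S j]
    follows from small sets alone: a part that was small could serve as [Q], and then [S j :\: Q]
    would miss the class altogether. *)
Lemma classes_exist (r M' : nat) : (0 < r)%N -> (0 < M')%N ->
  exists2 M1 : nat, (0 < M1)%N & exists N : nat, forall n (J : finType) (S : J -> {set 'I_n}),
  (N <= n)%N -> (#|J| <= n)%N -> (forall j, n <= #|S j| * M')%N ->
  exists f : {ffun 'I_n -> 'I_r}, forall j i, (n <= #|[set x in S j | f x == i]| * M1)%N.
Proof.
move=> r0 M'0; have r0' : 0 < r%:R :> R by rewrite ltr0n.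
have i0 : 0 < r%:R^-1 :> R by rewrite invr_gt0.
have i1 : r%:R^-1 <= 1 :> R by rewrite invf_le1 // ler1n.
have hrho : 0 <= 1 - (r%:R : R)^-1 < 1 by lra.
have [|beta [hb Hb]] := @expr_root_le R _ (2 * M') hrho; first lia.
have [M0 M00 HM0] := union_bound_small hb.
have [M [M_gt0 MM0 MM']] : exists M, [/\ 0 < M, M0 <= M & 2 * M' <= M]%N.
  by exists (M0 + 2 * M')%N; split; lia.
exists M => //.
have half_gt0 : 0 < 2^-1 :> R by lra.
have [N HN] := HM0 M MM0 _ half_gt0.
exists (N + r + 1)%N => n J S Nn Jn Sn.
pose w (i : 'I_r) : R := r%:R^-1.
have w0 i : 0 <= w i by rewrite ltW.
have w1 : \sum_i w i = 1.
  by rewrite sumr_const card_ord -[_ *+ _]mulr_natl divff // lt0r_neq0.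
pose A (z : J * ('I_r * {Q : {set 'I_n} | Q \in small_sets 'I_n M n}))
    (o : {ffun 'I_n -> 'I_r}) := [forall x in S z.1 :\: val z.2.2, ~~ (o x == z.2.1)].
have bound z : Pr w (A z) <= beta ^+ n.
  case: z => j [i [Q hQ]]; rewrite /A /=; move: (hQ); rewrite inE => hQ1.
  have c1 := robust_card (Sn j) (_ : 2 * M' <= M)%N hQ1.
  apply: (@le_trans _ _ ((1 - r%:R^-1) ^+ #|S j :\: Q|)); last by apply: Hb; apply: c1; lia.
  apply: (@Pr_hit_const R _ _ _ w0 w1 _ (fun z : 'I_n => z) (S j :\: Q) (fun r x => x == i)) => //.
  - lra.
  move=> x _; have := w1; rewrite (bigD1 i) //= {1}/w => e; lra.
have : Pr w (fun o => [exists z, A z o]) < 1.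
  apply: (@le_lt_trans _ _ 2^-1); last lra.
  apply: le_trans (Pr_union_le w0 bound) _.
  apply: le_trans (HN n 'I_n 'I_n _ _ _); rewrite ?card_ord //; last lia.
  apply: ler_wpM2r; first by rewrite exprn_ge0 //; case/andP: hb.
  rewrite !card_prod !card_sig card_ord.
  rewrite (eq_card (_ : [pred x | x \in small_sets 'I_n M n] =i small_sets 'I_n M n)) //.
  rewrite -!natrX -!natrM ler_nat mulnA leq_mul2r; apply/orP; right.
  apply: (@leq_trans (n * n)); first by rewrite leq_mul //; lia.
  apply: leq_trans (_ : n ^ 4 <= _)%N; last first.
    by rewrite leq_pmulr //; apply/card_gt0P; exists set0; rewrite inE cards0; lia.
  by rewrite mulnn leq_pexp2l //; lia.
move=> lt1; have /existsP[f hf] : [exists f, ~~ [exists z, A z f]].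
  apply: contraLR lt1; rewrite negb_exists => /forallP h.
  rewrite -leNgt -(@Pr_total R 'I_n 'I_r w w1); apply: Pr_le => // o _.
  by have := h o; rewrite negbK.
exists f => j i; rewrite leqNgt; apply/negP => h.
move/existsPn: hf => hf.
have hQ : [set x in S j | f x == i] \in small_sets 'I_n M n by rewrite inE ltnW.
have /forall_inPn[x] := hf (j, (i, Sub [set x in S j | f x == i] hQ)).
by rewrite !inE /= negbK => /andP[]; rewrite negb_and => /orP[/negPf->|/negPf->].
Qed.

End JointAndClasses.

Lemma square_quotient (n M : nat) : (0 < M)%N -> (M <= n)%N ->
  exists2 m, (n * n <= m * (2 * M))%N & forall s, (n * n <= s * M)%N -> (m <= s)%N.
Proof.
move=> M0 Mn; exists (n * n %/ M)%N.
  have := ltn_ceil (n * n) M0.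
  have : (1 <= n * n %/ M)%N by rewrite leq_divRL // mul1n; nia.
  move: (_ %/ _)%N => q; nia.
by move=> s h; rewrite -(mulnK s M0) leq_div2r.
Qed.

Lemma linear_quotient (n M : nat) : (0 < M)%N -> (M <= n)%N ->
  exists2 m, (m * M <= n)%N & (n <= m * (2 * M))%N.
Proof.
move=> M0 Mn; exists (n %/ M)%N; first exact: leq_divM.
have := ltn_ceil n M0.
have : (1 <= n %/ M)%N by rewrite leq_divRL // mul1n.
move: (_ %/ _)%N => q; nia.
Qed.

Lemma leq_sum_subset (T : finType) (A B : {set T}) (F : T -> nat) : A \subset B ->
  (\sum_(i in A) F i <= \sum_(i in B) F i)%N.
Proof. by move=> sAB; rewrite [leqRHS](big_setID A) /= (setIidPr sAB) leq_addr. Qed.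

(** * Switches: counting in the dense graph *)

Section Switch.
Variables (n : nat) (nb : rel 'I_n) (P1 P2 P3 : {set 'I_n}) (M1 : nat).
Hypothesis nbC : symmetric nb.
Hypotheses (d12 : [disjoint P1 & P2]) (d13 : [disjoint P1 & P3]) (d23 : [disjoint P2 & P3]).
Local Notation N v := [set x | nb v x].
Hypothesis deg1 : forall v, (n <= #|N v :&: P1| * M1)%N.
Hypothesis deg2 : forall v, (n <= #|N v :&: P2| * M1)%N.
Hypothesis deg3 : forall v, (n <= #|N v :&: P3| * M1)%N.
Hypothesis n_gt0 : (0 < n)%N.
Let M0 := (4 * (M1 * M1 * M1))%N.

(** With linearly many common neighbours in [P3], the pair can still be closed to a switch by a
    fresh vertex [u']. *)
Definition linked (x y : 'I_n) := (n <= #|N x :&: N y :&: P3| * M0)%N.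
Let X u := N u :&: P1.
Let Y u := N u :&: P2.
Definition unlinked_pairs u := [set z in setX (X u) (Y u) | ~~ linked z.1 z.2].
Definition good_hubs := [set u in P3 | 2 * #|unlinked_pairs u| <= #|X u| * #|Y u|]%N.
Definition linked_in u y := [set x in X u | linked x y].
Definition good_ends u := [set y in Y u | #|X u| <= 4 * #|linked_in u y|]%N.
Definition hub_edges := [set z : 'I_n * 'I_n | (z.1 \in good_hubs) && (z.2 \in good_ends z.1)].

Lemma M1_gt0 : (0 < M1)%N.
Proof. by have := deg1 (Ordinal n_gt0); case: M1 => //; rewrite muln0; lia. Qed.

(** Double counting of triples [u, x, y] with [x, y] unlinked: there are at most [n ^ 3 / M0] of
    them, and a bad hub lies in at least [n ^ 2 / (2 * M1 ^ 2)]. The value of [M0] bounds the bad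
    hubs by [n / (2 * M1)], half of the guaranteed size of [P3]. *)
Lemma card_good_hubs : (n <= #|good_hubs| * (2 * M1))%N.
Proof.
pose bad := P3 :\: good_hubs.
have tot : ((\sum_(u in P3) #|unlinked_pairs u|) * M0 <= n * n * n)%N.
  have -> : (\sum_(u in P3) #|unlinked_pairs u| =
    \sum_(z in [set z in setX P1 P2 | ~~ linked z.1 z.2]) #|N z.1 :&: N z.2 :&: P3|)%N.
    rewrite (eq_bigr (fun u => \sum_(z in [set z in setX P1 P2 | ~~ linked z.1 z.2])
       ((nb u z.1) && (nb u z.2)))%N).
        rewrite exchange_big; apply: eq_bigr => z _; rewrite -sum1_card big_mkcond.
      rewrite [RHS]big_mkcond; apply: eq_bigr => u _; rewrite !inE !(nbC u).
      by case: (u \in P3); case: (nb _ u); case: (nb _ u).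
    move=> u _; rewrite -sum1_card big_mkcond [RHS]big_mkcond; apply: eq_bigr => z _.
    rewrite !inE; case: (nb u z.1); case: (nb u z.2);
    by case: (_ \in P1); case: (_ \in P2); case: (linked _ _).
  rewrite big_distrl /=.
  apply: leq_trans (_ : \sum_(z in [set z in setX P1 P2 | ~~ linked z.1 z.2]) n <= _)%N.
    by apply: leq_sum => z; rewrite inE => /andP[_]; rewrite /linked -ltnNge => /ltnW.
  rewrite sum_nat_const leq_mul2r; apply/orP; right.
  apply: leq_trans (max_card _) _; by rewrite card_prod !card_ord.
have bu u : u \in bad -> (n * n <= #|unlinked_pairs u| * (2 * (M1 * M1)))%N.
  rewrite !inE => /andP[+ uP]; rewrite uP /= -ltnNge => h.
  apply: leq_trans (leq_mul (deg1 u) (deg2 u)) _; rewrite -/(X u) -/(Y u).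
  by rewrite mulnACA [leqRHS]mulnA leq_mul2r; apply/orP; right; rewrite [leqRHS]mulnC ltnW.
have : (#|bad| * (n * n) * M0 <= 2 * (M1 * M1) * (n * n * n))%N.
  have le1 : (\sum_(u in bad) #|unlinked_pairs u| <= \sum_(u in P3) #|unlinked_pairs u|)%N.
    by apply: leq_sum_subset; apply: subsetDl.
  have le2 : (#|bad| * (n * n) <= (\sum_(u in bad) #|unlinked_pairs u|) * (2 * (M1 * M1)))%N.
    by rewrite -sum_nat_const big_distrl /=; apply: leq_sum => u /bu.
  move: (\sum_(u in bad) _)%N (\sum_(u in P3) _)%N le1 le2 tot => a b le1 le2 tot.
  apply: leq_trans (leq_mul le2 (leqnn M0)) _.
  rewrite -mulnA mulnCA leq_mul2l; apply/orP; right; apply: leq_trans tot.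
  by rewrite leq_mul2r le1 orbT.
have := M1_gt0 => M1g; have n2 : (0 < n * n)%N by rewrite muln_gt0 n_gt0.
have -> : (#|bad| * (n * n) * M0 = (n * n * (2 * (M1 * M1))) * (#|bad| * (2 * M1)))%N.
  by rewrite /M0; ring.
have -> : (2 * (M1 * M1) * (n * n * n) = (n * n * (2 * (M1 * M1))) * n)%N by ring.
rewrite leq_pmul2l; last by rewrite !muln_gt0 M1g n_gt0.
have : (n <= #|P3| * M1)%N.
  apply: leq_trans (deg3 (Ordinal n_gt0)) _; rewrite leq_mul2r.
  by rewrite subset_leq_card ?orbT // subsetIr.
have : (#|P3| = #|good_hubs| + #|bad|)%N.
  rewrite -(cardsID good_hubs P3); congr addn; apply: eq_card => u.
  by rewrite !inE; case: (u \in P3); rewrite ?andbF.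
by move=> ->; rewrite mulnDl; clear; lia.
Qed.

(** Averaging: at least half of the pairs between [X u] and [Y u] are linked, and an end that is not
    good is linked to less than a quarter of [X u]; so at least a quarter of [Y u] is good. *)
Lemma card_good_ends u : u \in good_hubs -> (n <= #|good_ends u| * (4 * M1))%N.
Proof.
rewrite inE => /andP[_ gu].
have Xg : (0 < #|X u|)%N by have := deg1 u; rewrite -/(X u); case: #|X u|; rewrite ?mul0n; lia.
suff : (#|Y u| <= 4 * #|good_ends u|)%N by have := deg2 u; rewrite -/(Y u); clear; nia.
have tot : (\sum_(y in Y u) #|linked_in u y| + #|unlinked_pairs u| = #|X u| * #|Y u|)%N.
  rewrite -cardsX -(cardsID [set z | linked z.1 z.2] (setX (X u) (Y u))); congr addn.
    rewrite -sum1_card (eq_bigl (fun z : 'I_n * 'I_n => (z.2 \in Y u) && (z.1 \in linked_in u z.2))).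
      rewrite (reindex_inj (inv_inj (@swap_pairK _ _) : injective (fun z : 'I_n * 'I_n => (z.2, z.1)))) /=.
      rewrite -(pair_big_dep (fun y => y \in Y u) (fun y x => x \in linked_in u y) (fun _ _ => 1%N)) /=.
      by apply: eq_bigr => y _; rewrite sum1_card.
    by move=> z; rewrite !inE; case: (nb u _); case: (nb u _); case: (_ \in P1); case: (_ \in P2).
  by apply: eq_card => z; rewrite !inE andbC.
have : (4 * \sum_(y in Y u) #|linked_in u y| <= 4 * (#|good_ends u| * #|X u|) + #|Y u| * #|X u|)%N.
  rewrite (big_setID (good_ends u)) /= mulnDr; apply: leq_add.
    rewrite leq_mul2l /=; apply: (@leq_trans (#|Y u :&: good_ends u| * #|X u|)).
      rewrite -sum_nat_const; apply: leq_sum => y _; apply: subset_leq_card.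
      by apply/subsetP => x; rewrite inE => /andP[].
    by rewrite leq_mul2r subset_leq_card ?orbT // subsetIr.
  rewrite big_distrr /=; apply: (@leq_trans (#|Y u :\: good_ends u| * #|X u|)).
    rewrite -sum_nat_const; apply: leq_sum => y; rewrite in_setD => /andP[yg yY].
    by apply: contraNT yg; rewrite -ltnNge => /ltnW h; rewrite inE yY.
  by rewrite leq_mul2r subset_leq_card ?orbT // subsetDl.
move: (\sum_(y in Y u) _)%N tot gu Xg => s tot gu Xg.
rewrite [X in (_ <= _ + X)%N]mulnC => h.
have : (#|X u| * #|Y u| <= #|X u| * (4 * #|good_ends u|))%N by nia.
by rewrite leq_pmul2l.
Qed.

Lemma card_hub_edges : (n * n <= #|hub_edges| * (8 * (M1 * M1)))%N.
Proof.
have -> : (#|hub_edges| = \sum_(u in good_hubs) #|good_ends u|)%N.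
  rewrite -sum1_card (eq_bigl (fun z : 'I_n * 'I_n => (z.1 \in good_hubs) && (z.2 \in good_ends z.1))).
    rewrite -(pair_big_dep (fun u => u \in good_hubs) (fun u y => y \in good_ends u) (fun _ _ => 1%N)) /=.
    by apply: eq_bigr => u _; rewrite sum1_card.
  by move=> z; rewrite inE.
have : (#|good_hubs| * n <= (\sum_(u in good_hubs) #|good_ends u|) * (4 * M1))%N.
  rewrite -sum_nat_const big_distrl /=; apply: leq_sum => u; exact: card_good_ends.
have := card_good_hubs; move: (\sum_(_ in _) _)%N; clear; nia.
Qed.

Lemma hub_edges_inj : {in hub_edges &, injective (fun z => [set z.1; z.2])}.
Proof.
have sub z : z \in hub_edges -> z \in setX P3 P2.
  by rewrite !inE => /andP[/andP[-> _] /andP[/andP[_ ->] _]].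
move=> z z' /sub zP /sub z'P; apply: (@set2_inj_disjoint _ P3 P2) => //.
by rewrite disjoint_sym.
Qed.

End Switch.

(** A four-cycle [u x u' y]. Once [x] and [y] are connected, the path from [u] to [u'] that visits
    [x] before [y] uses [p], the one that visits [y] before [x] uses [q], and all other colours
    agree. *)
Definition switch_at (n : nat) (K : finType) (nb : rel 'I_n) (col : 'I_n -> 'I_n -> K)
    (p q : K) (Q : {set 'I_n}) (G : {set K}) :=
  exists u x y u', [/\ [&& u \notin Q, x \notin Q, y \notin Q & u' \notin Q],
    uniq [:: u; x; y; u'], [&& nb u x, nb u y, nb u' x & nb u' y],
    col u x = p /\ col u y = q & col u' x = col u' y /\ col u' x \notin G].

Lemma card_setU_small (T : finType) (A B : {set T}) (M n : nat) :
  (#|A| * (2 * M) <= n -> #|B| * (2 * M) <= n -> #|A :|: B| * M <= n)%N.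
Proof.
move=> hA hB; have [+ _] := leq_card_setU A B; move: (#|_ :|: _|) => c hc.
apply: leq_trans (leq_mul hc (leqnn M)) _; move: hA hB; rewrite mulnDl !(mulnCA _ 2); clear; lia.
Qed.

Lemma card_setU3_small (T : finType) (A B C : {set T}) (M n : nat) :
  (#|A| * (3 * M) <= n -> #|B| * (3 * M) <= n -> #|C| * (3 * M) <= n ->
  #|A :|: B :|: C| * M <= n)%N.
Proof.
move=> hA hB hC; have [h2 _] := leq_card_setU (A :|: B) C; have [h1 _] := leq_card_setU A B.
have he' : (#|A :|: B :|: C| <= #|A| + #|B| + #|C|)%N by move: h1 h2; clear; lia.
apply: leq_trans (leq_mul he' (leqnn M)) _.
move: hA hB hC; rewrite !mulnDl !(mulnCA _ 3); clear; lia.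
Qed.

Lemma ocolC n (K : finType) (o : {ffun {set 'I_n} -> bool * K}) x y : ocol o x y = ocol o y x.
Proof. by rewrite /ocol setUC. Qed.

(** * Switches: exposure of the colours in three stages *)

Section SquareHit.
Variable R : realType.

(** Adaptive form of the quadratic bound: the wanted colour [t o z] may be read from edges outside
    [E o]. *)
Lemma square_hit (M : nat) : (0 < M)%N -> exists2 beta : R, 0 <= beta < 1 &
  forall n (K : finType) (p : R) (E : {ffun {set 'I_n} -> bool * K} -> {set {set 'I_n}})
    (Pi : {ffun {set 'I_n} -> bool * K} -> {set 'I_n * 'I_n})
    (t : {ffun {set 'I_n} -> bool * K} -> 'I_n * 'I_n -> K),
  (M <= n)%N -> 0 <= p <= 1 -> (0 < #|K| <= n)%N ->
  (forall o o', E (resamp (E o) o o') = E o) ->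
  (forall o o', Pi (resamp (E o) o o') = Pi o) ->
  (forall o o' z, z \in Pi o -> t (resamp (E o) o o') z = t o z) ->
  (forall o, {in Pi o &, injective (fun z => [set z.1; z.2])}) ->
  (forall o z, z \in Pi o -> [set z.1; z.2] \in E o) ->
  Pr (ew p) (fun o => (n * n <= #|Pi o| * M)%N && [forall z in Pi o, ocol o z.1 z.2 != t o z])
    <= beta ^+ n.
Proof.
move=> M0; have [|beta hb Hb] := @hit_square_bound R (2 * M); first lia.
exists beta => // n K p E Pi t Mn p01 /andP[K0 Kn] EE PE tE inj PiE.
have n0 : (0 < n)%N by apply: leq_trans Mn.
have [m nm hm] := square_quotient M0 Mn.
have n1 : 1 <= n%:R :> R by rewrite ler1n.
have i0 : 0 < n%:R^-1 :> R by rewrite invr_gt0 ltr0n.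
have i1 : n%:R^-1 <= 1 :> R by rewrite invf_le1 ?ltr0n.
apply: le_trans (Hb n m n0 nm).
apply: le_trans (@Pr_hit R _ _ _ (ew_ge0 p01) (ew_sum p K0) _ (fun z : 'I_n * 'I_n => [set z.1; z.2])
  E Pi (fun o z x => x.2 == t o z) (1 - n%:R^-1) m _ EE PE _ inj PiE _).
- apply: Pr_le; first exact: ew_ge0.
  by move=> o /andP[h1 h2]; rewrite hm.
- by apply/andP; split; lra.
- by move=> o o' z zP x; rewrite tE.
move=> o z _; apply: (@col_avoid_le R K p (pred1 (t o z))) => //.
by rewrite card1 mulrC ler_pdivrMr ?ltr0n // mul1r ler_nat.
Qed.

End SquareHit.

Section SwitchStages.
Variables (n : nat) (nb : rel 'I_n) (P1 P2 P3 : {set 'I_n}) (M1 : nat) (K : finType).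
Hypotheses (d12 : [disjoint P1 & P2]) (d13 : [disjoint P1 & P3]) (d23 : [disjoint P2 & P3]).
Local Notation Om := {ffun {set 'I_n} -> bool * K}.
Local Notation lnk := (linked nb P3 M1).
Local Notation GH := (good_hubs nb P1 P2 P3 M1).
Local Notation GE := (good_ends nb P1 P2 P3 M1).
Implicit Types (o : Om) (p q : K) (Q : {set 'I_n}) (m : nat).

(** Stage one reads the edges between [P3] and [P2]. The default in [qend] does not occur on
    [qhubs]. *)
Definition qhubs o q Q := [set u in GH :\: Q | [exists y in GE u :\: Q, ocol o u y == q]].
Definition qend o q Q u := odflt u [pick y in GE u :\: Q | ocol o u y == q].
(** Only [m] hubs are kept, so that enough of [P3] stays unexposed towards [P1] for the last
    stage. *)
Definition thubs m o q Q := [set u in take m (enum (qhubs o q Q))].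
(** Stage two: candidates [(x, u)] for an edge of colour [p], with [x] linked to the end already
    chosen for [u]. *)
Definition pairs2 m o q Q0 Q1 :=
  [set z in setX (P1 :\: Q1) (thubs m o q Q0) | nb z.1 z.2 && lnk z.1 (qend o q Q0 z.2)].
Definition ptest o p q Q x u := [&& nb x u, lnk x (qend o q Q u) & ocol o x u == p].
Definition pends m o p q Q := [set x in P1 :\: Q | [exists u in thubs m o q Q, ptest o p q Q x u]].
Definition phub m o p q Q x := odflt x [pick u in thubs m o q Q | ptest o p q Q x u].
Definition twin_end m o p q Q x := qend o q Q (phub m o p q Q x).
(** Stage three: candidates [(x, u')]. The colour wanted on [x u'] is that of the edge from [u'] to
    the end chosen for the hub of [x]; that edge joins [P3] to [P2] and was read in stage one. *)
Definition pairs3 m o p q Q (G : {set K}) :=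
  [set z in setX (pends m o p q Q) (P3 :\: thubs m o q Q :\: Q) |
    [&& nb z.1 z.2, nb (twin_end m o p q Q z.1) z.2 & ocol o (twin_end m o p q Q z.1) z.2 \notin G]].

Lemma pairs2E m o q Q0 Q1 a b : ((a, b) \in pairs2 m o q Q0 Q1) =
  [&& a \in P1 :\: Q1, b \in thubs m o q Q0, nb a b & lnk a (qend o q Q0 b)].
Proof. by rewrite [LHS]in_set in_setX -andbA. Qed.

Lemma pairs3E m o p q Q G a b : ((a, b) \in pairs3 m o p q Q G) =
  [&& a \in pends m o p q Q, b \in P3 :\: thubs m o q Q :\: Q, nb a b,
      nb (twin_end m o p q Q a) b & ocol o (twin_end m o p q Q a) b \notin G].
Proof. by rewrite [LHS]in_set in_setX -andbA. Qed.

Lemma GH_sub u : u \in GH -> u \in P3.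
Proof. by rewrite inE => /andP[]. Qed.
Lemma GE_sub u y : y \in GE u -> (y \in P2) && nb u y.
Proof. by rewrite !inE => /andP[/andP[-> ->]]. Qed.
Lemma thubs_sub m o q Q u : u \in thubs m o q Q -> u \in qhubs o q Q.
Proof. by rewrite inE => /mem_take; rewrite mem_enum. Qed.
Lemma qhubs_P3 o q Q u : u \in qhubs o q Q -> u \in P3.
Proof. by rewrite !in_set => /andP[/andP[_ /andP[]]]. Qed.

Lemma qendP o q Q u : u \in qhubs o q Q ->
  (qend o q Q u \in GE u :\: Q) /\ ocol o u (qend o q Q u) = q.
Proof.
rewrite in_set => /andP[_ /exists_inP[y yG /eqP yq]]; rewrite /qend.
case: pickP => [y' /andP[h /eqP] //|/(_ y)]; by rewrite yG yq eqxx.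
Qed.

Lemma phubP m o p q Q x : x \in pends m o p q Q ->
  (phub m o p q Q x \in thubs m o q Q) /\ ptest o p q Q x (phub m o p q Q x).
Proof.
rewrite in_set => /andP[_ /exists_inP[u uG hu]]; rewrite /phub.
case: pickP => [u' /andP[h] //|/(_ u)]; by rewrite uG hu.
Qed.

Section Ext.
Variables (o o' : Om).
Hypothesis oo' : forall u y, u \in P3 -> y \in P2 -> o [set u; y] = o' [set u; y].

(** The [_ext] lemmas record what each stage reads. Agreement of [o] and [o'] on edges between [P3]
    and [P2] fixes the data of stage one; agreement also between [P1] and the kept hubs fixes those
    of stage two and the candidates of stage three. *)
Lemma qtest_ext q Q u y : u \in P3 -> (y \in GE u :\: Q) && (ocol o u y == q) =
   (y \in GE u :\: Q) && (ocol o' u y == q).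
Proof.
move=> uP; case: (boolP (y \in GE u :\: Q)) => //= /setDP[/GE_sub /andP[yP _] _].
by rewrite /ocol oo'.
Qed.

Lemma qhubs_ext q Q : qhubs o q Q = qhubs o' q Q.
Proof.
apply/setP => u; rewrite !in_set; case uG: (u \notin Q) => //=.
case: (boolP (u \in GH)) => [/GH_sub uP|]; last by rewrite in_set => /negbTE->.
by congr andb; apply: eq_existsb => y; apply: qtest_ext.
Qed.

Lemma qend_ext q Q u : u \in P3 -> qend o q Q u = qend o' q Q u.
Proof. by move=> uP; congr odflt; apply: eq_pick => y; apply: qtest_ext. Qed.

Lemma thubs_ext m q Q : thubs m o q Q = thubs m o' q Q.
Proof. by rewrite /thubs qhubs_ext. Qed.

Lemma pairs2_ext m q Q0 Q1 : pairs2 m o q Q0 Q1 = pairs2 m o' q Q0 Q1.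
Proof.
apply/setP => -[a b]; rewrite !pairs2E thubs_ext.
case: (boolP (b \in thubs m o' q Q0)) => [/thubs_sub/qhubs_P3 h|]; rewrite ?andbF //.
by rewrite qend_ext.
Qed.

Variables (m : nat) (q : K) (Q : {set 'I_n}).
Hypothesis oo'' : forall x u, x \in P1 -> u \in thubs m o q Q -> o [set x; u] = o' [set x; u].

Lemma ptest_ext p x u : x \in P1 ->
  (u \in thubs m o q Q) && ptest o p q Q x u = (u \in thubs m o' q Q) && ptest o' p q Q x u.
Proof.
move=> xP; rewrite -thubs_ext; case: (boolP (u \in thubs m o q Q)) => //= uT.
by rewrite /ptest qend_ext ?(qhubs_P3 (thubs_sub uT)) // /ocol oo''.
Qed.

Lemma pends_ext p : pends m o p q Q = pends m o' p q Q.
Proof.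
apply/setP => x; rewrite !in_set; case: (boolP (x \in P1)) => xP; rewrite ?andbF //.
by congr andb; apply: eq_existsb => u; have := ptest_ext p u xP.
Qed.

Lemma phub_ext p x : x \in P1 -> phub m o p q Q x = phub m o' p q Q x.
Proof. by move=> xP; congr odflt; apply: eq_pick => u; apply: ptest_ext. Qed.

Lemma twin_end_ext p x : x \in pends m o p q Q -> twin_end m o p q Q x = twin_end m o' p q Q x.
Proof.
move=> xp; have xP : x \in P1 by move: xp; rewrite !in_set => /andP[/andP[]].
rewrite /twin_end -phub_ext // qend_ext //.
by have [/thubs_sub/qhubs_P3 ] := phubP xp.
Qed.

Lemma twin_end_P2 p x : x \in pends m o p q Q -> twin_end m o p q Q x \in P2.
Proof.
move=> /phubP[/thubs_sub/qendP[/setDP[/GE_sub/andP[]]]] //.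
Qed.

Lemma pairs3_ext p G : pairs3 m o p q Q G = pairs3 m o' p q Q G.
Proof.
apply/setP => -[a b]; rewrite !pairs3E -pends_ext -thubs_ext.
case: (boolP (a \in pends m o p q Q)) => //= zp.
case: (boolP (b \in P3 :\: thubs m o q Q :\: Q)) => //= z2.
rewrite -twin_end_ext // ![ocol _ _ b]ocolC /ocol oo' ?twin_end_P2 //.
by move: z2; rewrite !in_setD => /and3P[].
Qed.

End Ext.

Lemma set2_sub_notin (A B C : {set 'I_n}) (x y : 'I_n) : y \notin A -> y \notin B ->
  [set x; y] \notin [set [set z.1; z.2] | z in setX A B].
Proof.
move=> yA yB; apply/imsetP => -[[a b]]; rewrite in_setX /= => /andP[aA bB] /setP /(_ y).
rewrite !inE eqxx orbT => /esym/orP[]/eqP e; first by rewrite e aA in yA.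
by rewrite e bB in yB.
Qed.

End SwitchStages.

Section StageCounts.
Variables (n : nat) (nb : rel 'I_n) (P1 P2 P3 : {set 'I_n}) (M1 : nat) (K : finType).
Hypothesis nbC : symmetric nb.
Hypothesis deg1 : forall v, (n <= #|[set x | nb v x] :&: P1| * M1)%N.
Local Notation Om := {ffun {set 'I_n} -> bool * K}.
Implicit Types (o : Om) (p q : K) (Q : {set 'I_n}) (m : nat).

(** A kept hub has a good end, which is linked to at least a quarter of the neighbours of the hub in
    [P1]; forbidding [Q1] costs at most half of the bound [n / (4 * M1)]. *)
Lemma card_pairs2 m o q Q0 Q1 : (#|Q1| * (8 * M1) <= n)%N ->
  (#|thubs nb P1 P2 P3 M1 m o q Q0| * n <= #|pairs2 nb P1 P2 P3 M1 m o q Q0 Q1| * (8 * M1))%N.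
Proof.
move=> hQ; set T := thubs _ _ _ _ _ _ _ _ _.
have -> : #|pairs2 nb P1 P2 P3 M1 m o q Q0 Q1| = (\sum_(u in T)
   #|linked_in nb P1 P3 M1 u (qend nb P1 P2 P3 M1 o q Q0 u) :\: Q1|)%N.
  rewrite -sum1_card.
  rewrite (reindex_inj (inv_inj (fun z : 'I_n * 'I_n => let: (a, b) as z := z return ((z.2, z.1).2, (z.2, z.1).1) = z in erefl) : injective (fun z : 'I_n * 'I_n => (z.2, z.1)))) /=.
  rewrite (eq_bigl (fun z : 'I_n * 'I_n => (z.1 \in T) && (z.2 \in linked_in nb P1 P3 M1 z.1 (qend nb P1 P2 P3 M1 o q Q0 z.1) :\: Q1))).
    rewrite -(pair_big_dep (fun u => u \in T) (fun u x => x \in linked_in nb P1 P3 M1 u (qend nb P1 P2 P3 M1 o q Q0 u) :\: Q1) (fun _ _ => 1%N)) /=.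
    by apply: eq_bigr => u _; rewrite sum1_card.
  case=> u x /=; rewrite pairs2E !in_setD !inE (nbC x u) -/T.
  by case: (u \in T); case: (x \in Q1); case: (x \in P1); case: (nb u x); rewrite ?andbF.
rewrite big_distrl /= -sum_nat_const; apply: leq_sum => u uT.
have [/setDP[]] := qendP (thubs_sub uT); rewrite [_ \in good_ends _ _ _ _ _ _]in_set => /andP[_ h] _ _.
have e8 : (8 * M1 = 2 * (4 * M1))%N by rewrite mulnA.
rewrite e8; apply: (@robust_card _ _ _ (8 * M1)) => //; last by rewrite e8.
by apply: leq_trans (deg1 u) _; rewrite mulnCA mulnA leq_mul2r h orbT.
Qed.

Lemma card_pairs3 m o p q Q (G : {set K}) (s t : nat) :
  (forall x, x \in pends nb P1 P2 P3 M1 m o p q Q ->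
    s <= #|[set b in P3 :\: thubs nb P1 P2 P3 M1 m o q Q :\: Q | [&& nb x b,
      nb (twin_end nb P1 P2 P3 M1 m o p q Q x) b & ocol o (twin_end nb P1 P2 P3 M1 m o p q Q x) b \notin G]]| * t)%N ->
  (#|pends nb P1 P2 P3 M1 m o p q Q| * s <= #|pairs3 nb P1 P2 P3 M1 m o p q Q G| * t)%N.
Proof.
move=> h; set S := pends _ _ _ _ _ _ _ _ _ _ in h *.
have -> : #|pairs3 nb P1 P2 P3 M1 m o p q Q G| = (\sum_(x in S) #|[set b in P3 :\: thubs nb P1 P2 P3 M1 m o q Q :\: Q | [&& nb x b,
      nb (twin_end nb P1 P2 P3 M1 m o p q Q x) b & ocol o (twin_end nb P1 P2 P3 M1 m o p q Q x) b \notin G]]|)%N.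
  rewrite -sum1_card.
  rewrite (eq_bigl (fun z : 'I_n * 'I_n => (z.1 \in S) && (z.2 \in [set b in P3 :\: thubs nb P1 P2 P3 M1 m o q Q :\: Q | [&& nb z.1 b,
      nb (twin_end nb P1 P2 P3 M1 m o p q Q z.1) b & ocol o (twin_end nb P1 P2 P3 M1 m o p q Q z.1) b \notin G]]))).
    rewrite -(pair_big_dep (fun x => x \in S) (fun x b => b \in [set b in P3 :\: thubs nb P1 P2 P3 M1 m o q Q :\: Q | [&& nb x b,
      nb (twin_end nb P1 P2 P3 M1 m o p q Q x) b & ocol o (twin_end nb P1 P2 P3 M1 m o p q Q x) b \notin G]]) (fun _ _ => 1%N)) /=.
    by apply: eq_bigr => u _; rewrite sum1_card.
  by case=> x b /=; rewrite pairs3E -/S; congr andb; rewrite [RHS]in_set.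
by rewrite big_distrl /= -sum_nat_const; apply: leq_sum => x /h.
Qed.

Lemma card_thubs m o q Q : (m <= #|qhubs nb P1 P2 P3 M1 o q Q|)%N ->
  #|thubs nb P1 P2 P3 M1 m o q Q| = m.
Proof.
move=> h; rewrite cardsE; have /card_uniqP -> : uniq (take m (enum (qhubs nb P1 P2 P3 M1 o q Q))).
  by rewrite take_uniq ?enum_uniq.
by rewrite size_take -cardE; case: ltngtP h.
Qed.

End StageCounts.

Section SwitchDet.
Variables (n : nat) (nb : rel 'I_n) (P1 P2 P3 : {set 'I_n}) (M1 : nat) (K : finType).
Hypothesis nbC : symmetric nb.
Hypotheses (d12 : [disjoint P1 & P2]) (d13 : [disjoint P1 & P3]) (d23 : [disjoint P2 & P3]).
Hypothesis deg1 : forall v, (n <= #|[set x | nb v x] :&: P1| * M1)%N.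
Variables (o : {ffun {set 'I_n} -> bool * K}) (Ma Ml Mb Mc m M : nat).
Let Mt := (2 * Ma + 3 * Ml)%N.
Hypothesis m1 : (m * Mt <= n)%N.
Hypothesis m2 : (n <= m * (2 * Mt))%N.
Hypotheses (MMa : (2 * Ma <= M)%N) (MMl : (3 * Ml <= M)%N) (MMb : (2 * Mb <= M)%N)
  (MMc : (Mc <= M)%N) (Mb8 : (8 * M1 <= Mb)%N).
Hypothesis g1 : forall (c : K) (Q : {set 'I_n}), (#|Q| * Ma <= n)%N ->
  exists x y, [/\ (x, y) \in hub_edges nb P1 P2 P3 M1, x \notin Q, y \notin Q & ocol o x y = c].
Hypothesis g2 : forall x y (Q : {set 'I_n}) (G : {set K}), linked nb P3 M1 x y ->
  (#|Q| * Ml <= n)%N -> (#|G| * Ml <= n)%N ->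
  exists2 r, r \in ([set z | nb x z] :&: [set z | nb y z] :&: P3) :\: Q & ocol o y r \notin G.
Hypothesis g3 : forall (p q : K) (Q0 Q1 : {set 'I_n}), (#|Q0| * Mb <= n)%N -> (#|Q1| * Mb <= n)%N ->
  (n * n <= #|pairs2 nb P1 P2 P3 M1 m o q Q0 Q1| * (16 * (M1 * Mt)))%N ->
  exists2 z, z \in pairs2 nb P1 P2 P3 M1 m o q Q0 Q1 & ocol o z.1 z.2 = p.
Hypothesis g4 : forall (p q : K) (Q : {set 'I_n}) (G : {set K}), (#|Q| * Mc <= n)%N -> (#|G| * Mc <= n)%N ->
  (n * n <= #|pairs3 nb P1 P2 P3 M1 m o p q Q G| * (2 * Mb * (3 * Ml)))%N ->
  exists2 z, z \in pairs3 nb P1 P2 P3 M1 m o p q Q G &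
    ocol o z.1 z.2 = ocol o (twin_end nb P1 P2 P3 M1 m o p q Q z.1) z.2.

(** Every stage yields a linear set by contradiction: a small outcome could be added to the
    forbidden set, and the property of that stage would produce one more element. *)
Lemma switch_exists (p q : K) (Q : {set 'I_n}) (G : {set K}) : (#|Q| * M <= n)%N -> (#|G| * M <= n)%N ->
  switch_at nb (ocol o) p q Q G.
Proof.
move=> hQ hG.
have le_Q (a : nat) : (a <= M)%N -> (#|Q| * a <= n)%N.
  by move=> aM; apply: leq_trans hQ; rewrite leq_mul2l aM orbT.
have le_G (a : nat) : (a <= M)%N -> (#|G| * a <= n)%N.
  by move=> aM; apply: leq_trans hG; rewrite leq_mul2l aM orbT.
have c1 : (n < #|qhubs nb P1 P2 P3 M1 o q Q| * (2 * Ma))%N.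
  rewrite ltnNge; apply/negP => h.
  have [u [y [huy]]] := g1 q (card_setU_small (le_Q _ MMa) h).
  rewrite !in_setU !negb_or => /andP[uQ uh] /andP[yQ _] e.
  move: huy; rewrite in_set /= => /andP[uG yG].
  case/negP: uh; rewrite in_set in_setD uQ uG; apply/exists_inP; exists y; last exact/eqP.
  by rewrite in_setD yQ.
(* The summand [2 * Ma] of [Mt] keeps [m] below the number of hubs found; the summand [3 * Ml] makes
   the [m] kept hubs few enough to be forbidden in the choice of [u']. *)
have mq : (m <= #|qhubs nb P1 P2 P3 M1 o q Q|)%N.
  case: (leqP m _) => // lt; move: m1 c1 lt; rewrite /Mt; clear.
  move: (#|_|) => a m1 c1 lt; have := leq_mul (ltnW lt) (leqnn (2 * Ma)).
  have : (m * (2 * Ma) <= m * (2 * Ma + 3 * Ml))%N by rewrite leq_mul2l leq_addr orbT.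
  lia.
have cT := card_thubs mq.
have c2 (Q1 : {set 'I_n}) : (#|Q1| * Mb <= n)%N ->
    exists2 z, z \in pairs2 nb P1 P2 P3 M1 m o q Q Q1 & ocol o z.1 z.2 = p.
  move=> hQ1; apply: g3 => //; first by apply: le_Q; apply: leq_trans MMb; rewrite leq_pmull.
  have hQ8 : (#|Q1| * (8 * M1) <= n)%N by apply: leq_trans hQ1; rewrite leq_mul2l Mb8 orbT.
  have := card_pairs2 P2 P3 nbC deg1 m o q Q hQ8; rewrite cT => h.
  have h2 := leq_mul h (leqnn (2 * Mt)); have h3 := leq_mul m2 (leqnn n).
  apply: leq_trans h3 _; apply: leq_trans (_ : m * n * (2 * Mt) <= _)%N; first by rewrite mulnAC.
  apply: leq_trans h2 _; rewrite -mulnA leq_mul2l; apply/orP; right.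
  by rewrite mulnACA.
have c3 : (n < #|pends nb P1 P2 P3 M1 m o p q Q| * (2 * Mb))%N.
  rewrite ltnNge; apply/negP => h.
  have [[x u]] := c2 _ (card_setU_small (le_Q _ MMb) h).
  rewrite pairs2E in_setD in_setU negb_or => /and4P[/andP[/andP[xQ xp] xP] uT xu lk] /= e.
  case/negP: xp; rewrite [_ \in pends _ _ _ _ _ _ _ _ _ _]in_set in_setD xQ xP.
  by apply/exists_inP; exists u => //; rewrite /ptest xu lk e eqxx.
have c4 x : x \in pends nb P1 P2 P3 M1 m o p q Q -> (n <= #|[set b in P3 :\: thubs nb P1 P2 P3 M1 m o q Q :\: Q | [&& nb x b,
      nb (twin_end nb P1 P2 P3 M1 m o p q Q x) b & ocol o (twin_end nb P1 P2 P3 M1 m o p q Q x) b \notin G]]| * (3 * Ml))%N.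
  move=> xp; rewrite leqNgt; apply/negP => /ltnW h; set Rx := [set b in _ | _] in h.
  have [_ /and3P[_ lk _]] := phubP xp.
  have hT : (#|thubs nb P1 P2 P3 M1 m o q Q| * (3 * Ml) <= n)%N.
    by rewrite cT; apply: leq_trans m1; rewrite leq_mul2l leq_addl orbT.
  have hG' : (#|G| * Ml <= n)%N by apply: le_G; apply: leq_trans MMl; rewrite leq_pmull.
  have [r] := g2 lk (card_setU3_small (le_Q _ MMl) hT h) hG'.
  rewrite in_setD !in_setU !negb_or !in_setI 2!in_set.
  case/andP=> /andP[/andP[rQ rT] rR] /andP[/andP[xr yr] rP] rG.
  by case/negP: rR; rewrite in_set !in_setD rQ rT rP xr yr rG.
have c5 : (n * n <= #|pairs3 nb P1 P2 P3 M1 m o p q Q G| * (2 * Mb * (3 * Ml)))%N.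
  have h := card_pairs3 c4; have h1 := leq_mul h (leqnn (2 * Mb)).
  have h2 := leq_mul (ltnW c3) (leqnn n).
  apply: leq_trans h2 _; rewrite mulnAC; apply: leq_trans h1 _.
  by rewrite -mulnA [(3 * Ml * _)%N]mulnC.
have [[x u'] hz e] := @g4 p q Q G (le_Q _ MMc) (le_G _ MMc) c5; rewrite /= in e.
move: hz; rewrite pairs3E => /and5P[xp u'P xu' yu' cG].
have [uT /and3P[xu lk /eqP cxu]] := phubP xp; rewrite /twin_end in yu' cG e.
set u := phub _ _ _ _ _ _ _ _ _ _ _ in uT xu lk cxu yu' cG e.
set y := qend _ _ _ _ _ _ _ _ _ in yu' cG e lk.
have uq := thubs_sub uT; have [yG cuy] := qendP uq; rewrite -/y in yG cuy.
have uP3 := qhubs_P3 uq; have uQ : u \notin Q by move: uq; rewrite in_set in_setD => /andP[/andP[]].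
move: yG; rewrite in_setD => /andP[yQ /GE_sub /andP[yP2 uy]].
move: u'P; rewrite !in_setD => /and3P[u'Q u'T u'P3].
have [xQ xP1] : x \notin Q /\ x \in P1 by move: xp; rewrite in_set in_setD => /andP[/andP[]].
have ne a b (A B : {set 'I_n}) : [disjoint A & B] -> a \in A -> b \in B -> a != b.
  by move=> dAB aA bB; apply: contraTneq aA => ->; rewrite (disjointFl dAB bB).
exists u, x, y, u'; split.
- by rewrite uQ xQ yQ u'Q.
- rewrite /= !inE !negb_or andbT [u == x]eq_sym (ne x u _ _ d13) // [u == y]eq_sym (ne y u _ _ d23) //.
  rewrite (ne x y _ _ d12) // (ne x u' _ _ d13) // (ne y u' _ _ d23) // !andbT /=.
  by apply: contraNneq u'T => <-.
- by rewrite nbC xu uy nbC xu' nbC yu'.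
- by split=> //; rewrite ocolC.
by rewrite ![ocol o u' _]ocolC e.
Qed.

End SwitchDet.

Section SwitchEvents.
Variables (R : realType) (n : nat) (nb : rel 'I_n) (P1 P2 P3 : {set 'I_n}) (M1 : nat) (K : finType) (pr : R).
Hypotheses (d12 : [disjoint P1 & P2]) (d13 : [disjoint P1 & P3]) (d23 : [disjoint P2 & P3]).
Hypothesis p01 : 0 <= pr <= 1.
Hypothesis Kn : (0 < #|K| <= n)%N.
Local Notation Om := {ffun {set 'I_n} -> bool * K}.
Variables (m M : nat).

Let notP y (A B : {set 'I_n}) : [disjoint A & B] -> y \in B -> y \notin A.
Proof. by move=> dAB yB; rewrite (disjointFl dAB yB). Qed.

(** All pairs between [P1] and [P3] are resampled; stage one reads none of them. The premise is the
    conclusion of [square_hit]. *)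
Lemma stage2_prob (beta : R) (p q : K) (Q0 Q1 : {set 'I_n}) :
  (forall (E : Om -> {set {set 'I_n}}) (Pi : Om -> {set 'I_n * 'I_n}) (t : Om -> 'I_n * 'I_n -> K),
  (forall o o', E (resamp (E o) o o') = E o) ->
  (forall o o', Pi (resamp (E o) o o') = Pi o) ->
  (forall o o' z, z \in Pi o -> t (resamp (E o) o o') z = t o z) ->
  (forall o, {in Pi o &, injective (fun z => [set z.1; z.2])}) ->
  (forall o z, z \in Pi o -> [set z.1; z.2] \in E o) ->
  Pr (ew pr) (fun o => (n * n <= #|Pi o| * M)%N && [forall z in Pi o, ocol o z.1 z.2 != t o z])
    <= beta ^+ n) ->
  Pr (ew pr) (fun o : Om => (n * n <= #|pairs2 nb P1 P2 P3 M1 m o q Q0 Q1| * M)%N &&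
    [forall z in pairs2 nb P1 P2 P3 M1 m o q Q0 Q1, ocol o z.1 z.2 != p]) <= beta ^+ n.
Proof.
move=> H; apply: (H (fun=> [set [set z.1; z.2] | z in setX P1 P3])
   (fun o => pairs2 nb P1 P2 P3 M1 m o q Q0 Q1) (fun _ _ => p)) => //.
- move=> o o'; apply: pairs2_ext => u y uP yP; rewrite resampE_out //.
  by apply: (@set2_sub_notin _ P1 P3 P1); [apply: notP d12 yP | apply: notP yP; rewrite disjoint_sym].
- have sub o z : z \in pairs2 nb P1 P2 P3 M1 m o q Q0 Q1 -> z \in setX P1 P3.
    case: z => a b; rewrite pairs2E in_setX in_setD => /and4P[/andP[_ ->] /thubs_sub/qhubs_P3 ->] //.
  by move=> o z z' /sub zP /sub z'P; apply: (set2_inj_disjoint d13).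
- move=> o [a b]; rewrite pairs2E in_setD => /and4P[/andP[_ aP] /thubs_sub/qhubs_P3 bP _ _].
  by apply/imsetP; exists (a, b) => //; rewrite in_setX aP.
Qed.

(** The resampled pairs join [P1] to the part of [P3] outside the kept hubs. This set depends on the
    outcome only through [thubs], hence through edges between [P3] and [P2], which it does not
    contain; the wanted colours lie on such edges too. *)
Lemma stage3_prob (beta : R) (p q : K) (Q : {set 'I_n}) (G : {set K}) :
  (forall (E : Om -> {set {set 'I_n}}) (Pi : Om -> {set 'I_n * 'I_n}) (t : Om -> 'I_n * 'I_n -> K),
  (forall o o', E (resamp (E o) o o') = E o) ->
  (forall o o', Pi (resamp (E o) o o') = Pi o) ->
  (forall o o' z, z \in Pi o -> t (resamp (E o) o o') z = t o z) ->
  (forall o, {in Pi o &, injective (fun z => [set z.1; z.2])}) ->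
  (forall o z, z \in Pi o -> [set z.1; z.2] \in E o) ->
  Pr (ew pr) (fun o => (n * n <= #|Pi o| * M)%N && [forall z in Pi o, ocol o z.1 z.2 != t o z])
    <= beta ^+ n) ->
  Pr (ew pr) (fun o : Om => (n * n <= #|pairs3 nb P1 P2 P3 M1 m o p q Q G| * M)%N &&
    [forall z in pairs3 nb P1 P2 P3 M1 m o p q Q G,
       ocol o z.1 z.2 != ocol o (twin_end nb P1 P2 P3 M1 m o p q Q z.1) z.2]) <= beta ^+ n.
Proof.
move=> H; pose E (o : Om) := [set [set z.1; z.2] | z in setX P1 (P3 :\: thubs nb P1 P2 P3 M1 m o q Q)].
have oo (o o' : Om) u y : u \in P3 -> y \in P2 -> o [set u; y] = resamp (E o) o o' [set u; y].
  move=> uP yP; rewrite resampE_out //; apply: (@set2_sub_notin _ P1 _ P1); first exact: notP d12 yP.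
  by rewrite in_setD negb_and; apply/orP; right; apply: notP yP; rewrite disjoint_sym.
have oo2 (o o' : Om) x u : x \in P1 -> u \in thubs nb P1 P2 P3 M1 m o q Q ->
    o [set x; u] = resamp (E o) o o' [set x; u].
  move=> xP uT; rewrite resampE_out //; apply/imsetP => -[[a b]]; rewrite in_setX in_setD /=.
  case/and3P=> aP bT bP e; have uP := qhubs_P3 (thubs_sub uT).
  have h1 : (x, u) \in setX P1 P3 by rewrite in_setX xP uP.
  have h2 : (a, b) \in setX P1 P3 by rewrite in_setX aP bP.
  by case: (set2_inj_disjoint d13 h1 h2 e) => _ eub; rewrite -eub uT in bT.
have sub o z : z \in pairs3 nb P1 P2 P3 M1 m o p q Q G -> z \in setX P1 (P3 :\: thubs nb P1 P2 P3 M1 m o q Q).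
  case: z => a b; rewrite pairs3E in_setX => /and5P[+ + _ _ _].
  rewrite [a \in pends _ _ _ _ _ _ _ _ _ _]in_set => /andP[/setDP[-> _] _].
  by rewrite !in_setD => /andP[_ ->].
apply: (H E (fun o => pairs3 nb P1 P2 P3 M1 m o p q Q G)
   (fun o z => ocol o (twin_end nb P1 P2 P3 M1 m o p q Q z.1) z.2)).
- move=> o o'; rewrite {1}/E; have -> // : thubs nb P1 P2 P3 M1 m (resamp (E o) o o') q Q = thubs nb P1 P2 P3 M1 m o q Q.
  by apply/esym; apply: thubs_ext => u y uP yP; apply: oo.
- move=> o o'; apply/esym; apply: pairs3_ext => [u y uP yP|x u xP uT]; [exact: oo|exact: oo2].
- move=> o o' [a b] zP /=.
  have ap : a \in pends nb P1 P2 P3 M1 m o p q Q by move: zP; rewrite pairs3E => /andP[].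
  have bP : b \in P3 by have := sub _ _ zP; rewrite in_setX in_setD => /andP[_ /andP[]].
  have -> : twin_end nb P1 P2 P3 M1 m (resamp (E o) o o') p q Q a = twin_end nb P1 P2 P3 M1 m o p q Q a.
    by apply/esym; apply: twin_end_ext ap => [u y uP yP|x u xP uT]; [exact: oo|exact: oo2].
  by rewrite ![ocol _ _ b]ocolC /ocol -(oo _ o') //; apply: twin_end_P2 ap.
- move=> o z z' /sub zP /sub z'P; apply: (set2_inj_disjoint d13).
    by case: z zP => a b; rewrite !in_setX in_setD => /and3P[-> _ ->].
  by case: z' z'P => a b; rewrite !in_setX in_setD => /and3P[-> _ ->].
by move=> o z /sub zP; apply/imsetP; exists z.
Qed.

End SwitchEvents.

Section SwitchWhp.
Variable R : realType.

(** The density left by one stage determines the failure rate of the next, hence its robustness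
    constant: [Ma] and [Ml] give [Mt], this gives [Mb], and this gives [Mc]. The three stages and
    the common neighbourhoods of linked pairs may each fail with probability [eps / 4]. *)
Lemma switch_whp (M1 : nat) : (0 < M1)%N ->
  exists2 M0 : nat, (0 < M0)%N & forall M, (M0 <= M)%N ->
  forall eps : R, 0 < eps -> exists N : nat,
  forall n (K : finType) (p : R) (nb : rel 'I_n) (P1 P2 P3 : {set 'I_n}),
  (N <= n)%N -> 0 <= p <= 1 -> (0 < #|K| <= n)%N -> (n <= #|K| * 2)%N ->
  symmetric nb -> irreflexive nb ->
  [disjoint P1 & P2] -> [disjoint P1 & P3] -> [disjoint P2 & P3] ->
  (forall v, n <= #|[set x | nb v x] :&: P1| * M1)%N ->
  (forall v, n <= #|[set x | nb v x] :&: P2| * M1)%N ->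
  (forall v, n <= #|[set x | nb v x] :&: P3| * M1)%N ->
  Pr (ew p) (fun o => `[< ~ forall (pp qq : K) (Q : {set 'I_n}) (G : {set K}),
     (#|Q| * M <= n)%N -> (#|G| * M <= n)%N -> switch_at nb (ocol o) pp qq Q G >]) <= eps.
Proof.
move=> M10; have M11 : (0 < M1 * M1)%N by rewrite muln_gt0 M10.
have M111 : (0 < 4 * (M1 * M1 * M1))%N by rewrite !muln_gt0 M10.
have M81 : (0 < 8 * (M1 * M1))%N by rewrite !muln_gt0 M10.
have [Ma Ma0 HMa] := @pairs_hit_whp R _ M81.
have [Ml Ml0 HMl] := @local_whp R _ 2 M111 isT.
set Mt := (2 * Ma + 3 * Ml)%N.
have Mt0 : (0 < Mt)%N by rewrite addn_gt0 muln_gt0 Ma0.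
have X20 : (0 < 16 * (M1 * Mt))%N by rewrite !muln_gt0 M10.
have [b2 hb2 H2] := @square_hit R _ X20.
have [Mb0 Mb00 HMb] := union_bound_small hb2.
set Mb := (Mb0 + 8 * M1)%N.
have X30 : (0 < 2 * Mb * (3 * Ml))%N by rewrite !muln_gt0 addn_gt0 Mb00 Ml0.
have [b3 hb3 H3] := @square_hit R _ X30.
have [Mc Mc0 HMc] := union_bound_small hb3.
exists (2 * Ma + 3 * Ml + 2 * Mb + Mc)%N; first by rewrite !addn_gt0 Mc0 orbT.
have Mh M : (2 * Ma + 3 * Ml + 2 * Mb + Mc <= M)%N ->
    [/\ 2 * Ma <= M, 3 * Ml <= M, 2 * Mb <= M & Mc <= M]%N.
  by clear => h; split; lia.
move=> M /Mh[MMa MMl MMb MMc] eps e0.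
have e4 : 0 < eps / 4 by rewrite divr_gt0.
have [N1 HN1] := HMa Ma (leqnn _) _ e4.
have [N2 HN2] := HMl Ml (leqnn _) _ e4.
have [N3 HN3] := HMb Mb (leq_addr _ _) _ e4.
have [N4 HN4] := HMc Mc (leqnn _) _ e4.
exists (N1 + N2 + N3 + N4 + Mt + 16 * (M1 * Mt) + 2 * Mb * (3 * Ml) + 1)%N.
move=> n K p nb P1 P2 P3 Nn p01 Kn Kn2 nbC nbI d12 d13 d23 g1 g2 g3.
have [n1 n2 n3 n4 [nt nx2 nx3 n0]] : [/\ N1 <= n, N2 <= n, N3 <= n, N4 <= n &
   [/\ Mt <= n, 16 * (M1 * Mt) <= n, 2 * Mb * (3 * Ml) <= n & 0 < n]]%N.
  have Nh (a b c d e f g h : nat) : (a + b + c + d + e + f + g + 1 <= h)%N ->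
    [/\ a <= h, b <= h, c <= h, d <= h & [/\ e <= h, f <= h, g <= h & 0 < h]]%N.
    by clear => hh; split; [lia|lia|lia|lia|split; lia].
  exact: Nh Nn.
have [m m1 m2] := linear_quotient Mt0 nt.
pose A1 (o : {ffun {set 'I_n} -> bool * K}) := `[< ~ forall (c : K) (Q : {set 'I_n}), (#|Q| * Ma <= n)%N ->
     exists x y, [/\ (x, y) \in hub_edges nb P1 P2 P3 M1, x \notin Q, y \notin Q & ocol o x y = c] >].
pose A2 (o : {ffun {set 'I_n} -> bool * K}) := `[< ~ forall (j : {z : 'I_n * 'I_n | linked nb P3 M1 z.1 z.2}) (Q : {set 'I_n}) (G : {set K}),
     (#|Q| * Ml <= n)%N -> (#|G| * Ml <= n)%N ->
     exists2 r, r \in ([set x | nb (val j).1 x] :&: [set x | nb (val j).2 x] :&: P3) :\: Q &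
       ocol o (val j).2 r \in setT :\: G >].
pose B3 (z : (K * K) * ({Q : {set 'I_n} | Q \in small_sets 'I_n Mb n} * {Q : {set 'I_n} | Q \in small_sets 'I_n Mb n})) (o : {ffun {set 'I_n} -> bool * K}) :=
  (n * n <= #|pairs2 nb P1 P2 P3 M1 m o z.1.2 (val z.2.1) (val z.2.2)| * (16 * (M1 * Mt)))%N &&
  [forall x in pairs2 nb P1 P2 P3 M1 m o z.1.2 (val z.2.1) (val z.2.2), ocol o x.1 x.2 != z.1.1].
pose B4 (z : (K * K) * ({Q : {set 'I_n} | Q \in small_sets 'I_n Mc n} * {G : {set K} | G \in small_sets K Mc n})) (o : {ffun {set 'I_n} -> bool * K}) :=
  (n * n <= #|pairs3 nb P1 P2 P3 M1 m o z.1.1 z.1.2 (val z.2.1) (val z.2.2)| * (2 * Mb * (3 * Ml)))%N &&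
  [forall x in pairs3 nb P1 P2 P3 M1 m o z.1.1 z.1.2 (val z.2.1) (val z.2.2),
     ocol o x.1 x.2 != ocol o (twin_end nb P1 P2 P3 M1 m o z.1.1 z.1.2 (val z.2.1) x.1) x.2].
have ew0 : forall x : bool * K, 0 <= ew p x := ew_ge0 p01.
have P_A1 : Pr (ew p) A1 <= eps / 4.
  apply: HN1 => //; first exact: hub_edges_inj.
  exact: card_hub_edges.
have P_A2 : Pr (ew p) A2 <= eps / 4.
  apply: (HN2 n K {: {z : 'I_n * 'I_n | linked nb P3 M1 z.1 z.2}} p (fun j => (val j).2)
    (fun j => [set x | nb (val j).1 x] :&: [set x | nb (val j).2 x] :&: P3) setT) => //.
  - apply: leq_trans (_ : #|{: 'I_n * 'I_n}| <= _)%N; first by rewrite card_sig max_card.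
    by rewrite card_prod card_ord mulnn leq_pexp2l.
  - by move=> j; rewrite !inE nbI andbF.
  - by case=> j /= lj.
  - by rewrite cardsT.
have KK : (#|K| * #|K| <= n ^ 4)%N.
  case/andP: Kn => _ Kn; apply: leq_trans (leq_mul Kn Kn) _; by rewrite mulnn leq_pexp2l.
have P_B3 : Pr (ew p) (fun o => [exists z, B3 z o]) <= eps / 4.
  have hB z : Pr (ew p) (B3 z) <= b2 ^+ n.
    by case: z => [[pp qq] [Q0 Q1]]; apply: stage2_prob => // E Pi t; apply: H2.
  apply: le_trans (Pr_union_le ew0 hB) _.
  apply: le_trans (HN3 n 'I_n 'I_n n3 _ _); rewrite ?card_ord //.
  apply: ler_wpM2r; first by rewrite exprn_ge0 //; case/andP: hb2.
  rewrite !card_prod !card_sig !natrM mulrA.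
  rewrite (eq_card (_ : [pred x | x \in small_sets 'I_n Mb n] =i small_sets 'I_n Mb n)) //.
  do 2 (apply: ler_wpM2r; first exact: ler0n).
  by rewrite -natrM -natrX ler_nat.
have P_B4 : Pr (ew p) (fun o => [exists z, B4 z o]) <= eps / 4.
  have hB z : Pr (ew p) (B4 z) <= b3 ^+ n.
    by case: z => [[pp qq] [Q0 Q1]]; apply: stage3_prob => // E Pi t; apply: H3.
  apply: le_trans (Pr_union_le ew0 hB) _.
  apply: le_trans (HN4 n 'I_n K n4 _ _); rewrite ?card_ord //; last by case/andP: Kn.
  apply: ler_wpM2r; first by rewrite exprn_ge0 //; case/andP: hb3.
  rewrite !card_prod !card_sig !natrM mulrA.
  rewrite (eq_card (_ : [pred x | x \in small_sets 'I_n Mc n] =i small_sets 'I_n Mc n)) //.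
  rewrite (eq_card (_ : [pred x | x \in small_sets K Mc n] =i small_sets K Mc n)) //.
  do 2 (apply: ler_wpM2r; first exact: ler0n).
  by rewrite -natrM -natrX ler_nat.
apply: (@le_trans _ _ (Pr (ew p) (fun o => (A1 o || A2 o) || ([exists z, B3 z o] || [exists z, B4 z o])))).
  apply: Pr_le => // o /asboolP bad; apply: contrapT => /negP.
  case/norP=> /norP[n1' n2'] /norP[/existsPn h3 /existsPn h4].
  have h1 := contrapT (elimN (asboolP _) n1'); have h2 := contrapT (elimN (asboolP _) n2').
  apply: bad => pp qq Q G hQ hG.
  have Mb8 : (8 * M1 <= Mb)%N by rewrite /Mb leq_addl.
  have sw := @switch_exists n nb P1 P2 P3 M1 K nbC d12 d13 d23 g1 o Ma Ml Mb Mc m M m1 m2 MMa MMl MMb MMc Mb8 h1.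
  apply: sw hQ hG.
  - move=> x y Q' G' lk hQ' hG'; have [r rS] := h2 (Sub (x, y) lk) Q' G' hQ' hG'.
    by rewrite !inE andbT => rG; exists r.
  - move=> p' q' Q0 Q1 hQ0 hQ1 big.
    have i0 : Q0 \in small_sets 'I_n Mb n by rewrite inE.
    have i1 : Q1 \in small_sets 'I_n Mb n by rewrite inE.
    have := h3 ((p', q'), (Sub Q0 i0, Sub Q1 i1)); rewrite /B3 /= big /=.
    by case/forall_inPn => z zP; rewrite negbK => /eqP e; exists z.
  move=> p' q' Q0 G0 hQ0 hG0 big.
  have i0 : Q0 \in small_sets 'I_n Mc n by rewrite inE.
  have i1 : G0 \in small_sets K Mc n by rewrite inE.
  have := h4 ((p', q'), (Sub Q0 i0, Sub G0 i1)); rewrite /B4 /= big /=.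
  by case/forall_inPn => z zP; rewrite negbK => /eqP e; exists z.
apply: le_trans (Pr_union2 ew0 _ _) _.
have l1 : Pr (ew p) (fun o => A1 o || A2 o) <= eps / 4 + eps / 4.
  by apply: le_trans (Pr_union2 ew0 _ _) _; apply: lerD.
have l2 : Pr (ew p) (fun o => [exists z, B3 z o] || [exists z, B4 z o]) <= eps / 4 + eps / 4.
  by apply: le_trans (Pr_union2 ew0 _ _) _; apply: lerD.
by apply: le_trans (lerD l1 l2) _; lra.
Qed.

End SwitchWhp.

(** * The absorbing template *)

Local Close Scope ring_scope.

Lemma leq_cast (a b c d : nat) : a = c -> b = d -> a <= b -> c <= d.
Proof. by move=> -> ->. Qed.

(** * Hall's theorem *)

Section Hall.
Variables (A B : finType) (E : A -> B -> bool) (b0 : B).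
Implicit Types (S D : {set A}) (T : {set B}).

Definition nbhd S := [set b | [exists a in S, E a b]].

Lemma nbhdU S S' : nbhd (S :|: S') = nbhd S :|: nbhd S'.
Proof.
apply/setP => b; rewrite !inE; apply/exists_inP/orP.
  by case=> a; rewrite inE => /orP[] aS eab; [left|right]; apply/exists_inP; exists a.
by case=> /exists_inP[a aS eab]; exists a => //; rewrite inE aS ?orbT.
Qed.

(** Halmos-Vaughan induction. A nonempty proper tight set is matched into its neighbourhood and the
    rest outside it; without tight sets any edge [a b] can be used, since losing [b] costs each set
    at most one neighbour. *)
Lemma hall_sets (m : nat) (D : {set A}) (T : {set B}) : #|D| <= m ->
  (forall S, S \subset D -> #|S| <= #|nbhd S :&: T|) ->
  exists2 f : A -> B, {in D &, injective f} & forall a, a \in D -> E a (f a) && (f a \in T).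
Proof.
elim: m => [|m IHm] in D T *.
  rewrite leqn0 cards_eq0 => /eqP-> hall.
  by exists (fun=> b0) => a; rewrite inE.
move=> Dm hall.
case: (boolP [exists S : {set A}, [&& S \proper D, S != set0 & #|nbhd S :&: T| == #|S|]]).
  case/existsP=> S /and3P[SD S0 /eqP tight].
  have sSD := proper_sub SD.
  have Sm : #|S| <= m by have := proper_card SD; lia.
  have S1 : 0 < #|S| by rewrite card_gt0.
  have DSm : #|D :\: S| <= m by have := cardsID S D; rewrite (setIidPr sSD); lia.
  have [f1 inj1 h1] : exists2 f : A -> B, {in S &, injective f} &
      forall a, a \in S -> E a (f a) && (f a \in nbhd S :&: T).
    apply: IHm => // S' S'S; apply: leq_trans (hall S' (subset_trans S'S sSD)) _.
    apply: subset_leq_card; apply/subsetP => b; rewrite !inE => /andP[nb bT].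
    rewrite nb bT andbT /=; case/exists_inP: nb => a aS' eab.
    by apply/exists_inP; exists a => //; apply: (subsetP S'S).
  have [f2 inj2 h2] : exists2 f : A -> B, {in D :\: S &, injective f} &
      forall a, a \in D :\: S -> E a (f a) && (f a \in T :\: nbhd S).
    apply: IHm => // S' S'D.
    have dSS : [disjoint S & S'].
      rewrite disjoint_sym disjoints_subset; apply: subset_trans S'D _.
      by rewrite setDE subsetIr.
    have sub : S :|: S' \subset D.
      by rewrite subUset sSD (subset_trans S'D) // subsetDl.
    have := hall _ sub; rewrite nbhdU setIUl.
    have [+ _] := leq_card_setU (nbhd S :&: T) ((nbhd S' :&: T) :\: (nbhd S :&: T)).
    have -> : nbhd S :&: T :|: ((nbhd S' :&: T) :\: (nbhd S :&: T)) = nbhd S :&: T :|: nbhd S' :&: T.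
      apply/setP => b; rewrite !(in_setU, in_setI, in_setD).
      by case: (b \in nbhd S); case: (b \in nbhd S'); case: (b \in T).
    have -> : (nbhd S' :&: T) :\: (nbhd S :&: T) = nbhd S' :&: (T :\: nbhd S).
      apply/setP => b; rewrite !(in_setU, in_setI, in_setD).
      by case: (b \in nbhd S); case: (b \in nbhd S'); case: (b \in T).
    rewrite tight; have : #|S :|: S'| = #|S| + #|S'|.
      by apply/eqP; rewrite (leq_card_setU S S').2.
    by move=> -> ? ?; lia.
  exists (fun a => if a \in S then f1 a else f2 a).
    move=> a a' aD a'D; case: ifP => aS; case: ifP => a'S.
    - exact: inj1.
    - have /andP[_] := h1 a aS; rewrite !inE => /andP[n1 _].
      have aDS : a' \in D :\: S by rewrite inE a'S a'D.
      have /andP[_] := h2 a' aDS; rewrite !inE.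
      by case/andP=> n2 _ e; rewrite -e n1 in n2.
    - have /andP[_] := h1 a' a'S; rewrite !inE => /andP[n1 _].
      have aDS : a \in D :\: S by rewrite inE aS aD.
      have /andP[_] := h2 a aDS; rewrite !inE.
      by case/andP=> n2 _ e; rewrite e n1 in n2.
    - by apply: inj2; rewrite inE ?aS ?a'S ?aD ?a'D.
  move=> a aD; case: ifP => aS.
    by have /andP[-> /=] := h1 a aS; rewrite inE => /andP[].
  have aDS : a \in D :\: S by rewrite inE aS aD.
  by have /andP[-> /=] := h2 a aDS; rewrite !inE => /andP[].
move=> notight.
case: (set_0Vmem D) => [D0|[a aD]].
  by exists (fun=> b0) => a; rewrite D0 inE.
have hs S : S \proper D -> S != set0 -> #|S| < #|nbhd S :&: T|.
  move=> SD S0; have := hall S (proper_sub SD); rewrite leq_eqVlt => /orP[/eqP e|//].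
  by case/negP: notight; apply/existsP; exists S; rewrite SD S0 -e eqxx.
have [b] : exists b, b \in nbhd [set a] :&: T.
  apply/card_gt0P; apply: leq_trans (hall [set a] _); rewrite ?cards1 //.
  by rewrite sub1set.
rewrite !inE => /andP[/exists_inP[a' /set1P->] eab bT].
have [f inj h] : exists2 f : A -> B, {in D :\ a &, injective f} &
    forall x, x \in D :\ a -> E x (f x) && (f x \in T :\ b).
  apply: IHm => [|S SD]; first by move: Dm; rewrite (cardsD1 a) aD.
  case: (eqVneq S set0) => [->|S0]; first by rewrite cards0.
  have SpD : S \proper D.
    by apply: sub_proper_trans SD _; rewrite properD1.
  have := hs S SpD S0; rewrite (cardsD1 b) setIDA.
  by case: (b \in _) => //=; rewrite ?add1n ?ltnS // add0n => /ltnW.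
exists (fun x => if x == a then b else f x).
  have fb x : x \in D -> x != a -> f x != b.
    move=> xD xa; have xDa : x \in D :\ a by rewrite !inE xa.
    by have /andP[_] := h x xDa; rewrite !inE => /andP[].
  move=> x y xD yD; case: eqP => [->|/eqP xa]; case: eqP => [->|/eqP ya] // e.
  - by have := fb y yD ya; rewrite -e eqxx.
  - by have := fb x xD xa; rewrite e eqxx.
  - by apply: inj => //; rewrite !inE ?xa ?ya.
move=> x xD; case: eqP => [->|/eqP xa]; first by rewrite eab.
have xDa : x \in D :\ a by rewrite !inE xa.
by have /andP[-> /=] := h x xDa; rewrite !inE => /andP[].
Qed.

End Hall.

(** * Random permutations *)

Section RandomPerm.
Variable B : finType.
Implicit Types (S T : {set B}).

Lemma perm_mapping S S' : #|S| = #|S'| -> exists s : {perm B}, s @: S = S'.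
Proof.
move: {2}#|S :\: S'| (leqnn #|S :\: S'|) => m; elim: m => [|m IHm] in S *.
  rewrite leqn0 cards_eq0 setD_eq0 => SS' e; exists 1%g.
  rewrite (eq_imset _ (fun x => perm1 x)) imset_id.
  by apply/eqP; rewrite eqEcard SS' e leqnn.
move=> Sm e; case: (set_0Vmem (S :\: S')) => [S0|[x xS]].
  by apply: IHm => //; rewrite S0 cards0.
have [y yS] : exists y, y \in S' :\: S.
  apply/card_gt0P; have := cardsID S S'; have := cardsID S' S.
  have : 0 < #|S :\: S'| by apply/card_gt0P; exists x.
  by rewrite setIC e /=; lia.
move: xS yS; rewrite !inE => /andP[xS' xS] /andP[yS yS'].
have xy : x != y by apply: contraNneq yS => <-.
have e1 : tperm x y @: S = y |: (S :\ x).
  apply/setP => z; apply/imsetP/idP => [[t tS ->]|].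
    rewrite !inE; case: tpermP => [_|ty|tx ty]; rewrite ?eqxx //.
      by rewrite -ty tS in yS.
    by rewrite tS; move/eqP: tx => ->; rewrite orbT.
  rewrite !inE => /orP[/eqP->|/andP[zx zS]]; first by exists x; rewrite ?tpermL.
  exists z => //; rewrite tpermD // eq_sym //.
  by apply: contraNneq yS => <-.
have [||s hs] := IHm (tperm x y @: S).
- rewrite e1; move: Sm; rewrite (cardsD1 x) !inE xS' xS add1n ltnS.
  apply: leq_trans; apply: subset_leq_card; apply/subsetP => z.
  rewrite !inE => /andP[zS' /orP[/eqP zy|/andP[-> ->]]]; last by rewrite zS'.
  by rewrite zy yS' in zS'.
- by rewrite card_imset //; apply: perm_inj.
exists (tperm x y * s)%g; rewrite -hs -imset_comp; apply: eq_imset => z.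
by rewrite permM.
Qed.

Lemma card_perm_to S T : #|S| = #|T| ->
  #|[set s : {perm B} | s @: S == T]| * 'C(#|B|, #|S|) = #|{perm B}|.
Proof.
move=> eST.
pose X := [set U : {set B} | #|U| == #|S|].
have cX : #|X| = 'C(#|B|, #|S|).
  rewrite -card_draws; apply: eq_card => U; by rewrite !inE.
rewrite -cX mulnC -sum_nat_const -[RHS]sum1_card.
rewrite [RHS](partition_big (fun s : {perm B} => s @: S) (fun U => U \in X)); last first.
  by move=> s _; rewrite inE card_imset //; apply: perm_inj.
apply: eq_bigr => U; rewrite inE => /eqP cU.
have [r hr] := perm_mapping (etrans (esym eST) (esym cU)).
rewrite sum1_card -[LHS](card_imset _ (mulIg r)).
apply: eq_card => s; apply: (@etrans _ _ (s @: S == U)); last by [].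
apply/imsetP/eqP.
  case=> t; rewrite inE => /eqP ht ->; rewrite -hr -ht -imset_comp.
  by apply: eq_imset => x; rewrite permM.
move=> hs; exists (s * r^-1)%g; last by rewrite mulgKV.
rewrite inE; apply/eqP; apply: (imset_inj (@perm_inj _ r)).
rewrite hr -hs -imset_comp; apply: eq_imset => x /=.
by rewrite permM permKV.
Qed.

(** A random permutation sends [S] to each set of its size equally often; the probability of landing
    inside [T] is a ratio of binomials, stated here cross-multiplied. *)
Lemma card_perm_into S T :
  #|[set s : {perm B} | s @: S \subset T]| * 'C(#|B|, #|S|) = 'C(#|T|, #|S|) * #|{perm B}|.
Proof.
rewrite -[in LHS]sum1_card.
rewrite (partition_big (fun s : {perm B} => s @: S) (fun U => (U \subset T) && (#|U| == #|S|))) /=; last first.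
  by move=> s; rewrite inE => ->; rewrite card_imset //=; apply: perm_inj.
rewrite (eq_bigr (fun U => #|[set s : {perm B} | s @: S == U]|)); last first.
  move=> U /andP[UT _]; rewrite sum1_card; apply: eq_card => s; rewrite [RHS]inE.
  apply: (@etrans _ _ ((s @: S \subset T) && (s @: S == U))); first by rewrite unfold_in inE.
  by case: eqP => [->|]; rewrite ?UT ?andbF ?andbT.
rewrite big_distrl /= (eq_bigr (fun=> #|{perm B}|)); last first.
  by move=> U /andP[_ /eqP cU]; apply: card_perm_to.
rewrite sum_nat_const -cards_draws; congr (_ * _).
by apply: eq_card => U; rewrite !inE.
Qed.

(** Factor by factor, [(t - i) / (b - i) <= t / b]. *)
Lemma ffact_ratio t b s : t <= b -> t ^_ s * b ^ s <= b ^_ s * t ^ s.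
Proof.
move=> tb; elim: s => [|s IHs]; first by rewrite !ffactn0.
rewrite !ffactnSr !expnSr.
have h : (t - s) * b <= (b - s) * t.
  case: (leqP s t) => st; last by rewrite (_ : t - s = 0) ?mul0n //; lia.
  nia.
rewrite -!mulnA (mulnCA (t - s)) (mulnCA (b - s)) !mulnA -!mulnA.
by rewrite mulnA [leqRHS]mulnA; apply: leq_mul.
Qed.

Lemma card_perm_into_le S T :
  #|[set s : {perm B} | s @: S \subset T]| * #|B| ^ #|S| <= #|T| ^ #|S| * #|{perm B}|.
Proof.
have cSB : 0 < 'C(#|B|, #|S|) by rewrite bin_gt0 max_card.
rewrite -(leq_pmul2r cSB) mulnAC card_perm_into.
rewrite -(leq_pmul2r (fact_gt0 #|S|)).
have TB : #|T| <= #|B| := max_card _.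
have := ffact_ratio #|S| TB; rewrite -!bin_ffact => h.
by apply: (leq_cast _ _ (leq_mul h (leqnn #|{perm B}|))); ring.
Qed.

End RandomPerm.

(** From [C(n, s) * s! <= n ^ s] and [s ^ s <= 4 ^ s * s!]. The latter holds since [s ^ s] is at
    most the falling factorial [C(2 s, s) * s!]. *)
Lemma bin_pow_le n s : 'C(n, s) * s ^ s <= (4 * n) ^ s.
Proof.
have h1 : s ^ s <= 4 ^ s * s`!.
  have h2 : s ^ s <= (s + s) ^_ s.
    have H m : m <= s -> s ^ m <= (s + s) ^_ m.
      elim: m => [|m IHm] ms; first by rewrite ffactn0.
      rewrite ffactnSr expnSr; apply: leq_mul; [apply: IHm; lia | lia].
    exact: H.
  apply: leq_trans h2 _; rewrite -bin_ffact leq_mul2r; apply/orP; right.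
  rewrite (_ : 4 = 2 ^ 2) // -expnM (_ : 2 * s = s + s); last lia.
  rewrite -[2]/(1 + 1) expnDn.
  rewrite (bigD1 (inord s)) //= inordK; last lia.
  by rewrite !exp1n !muln1 leq_addr.
have h3 : 'C(n, s) * s`! <= n ^ s.
  rewrite bin_ffact; elim: (s) => [|m IHm]; first by rewrite ffactn0.
  by rewrite ffactnSr expnSr leq_mul // leq_subr.
rewrite expnMn; apply: leq_trans (leq_mul (leqnn _) h1) _.
by rewrite mulnCA leq_mul2l h3 orbT.
Qed.

(** The union bound at size [s], to be summed as [4 ^- s]. The binomials cost
    [32 ^ s * (r / s) ^ (2 s)], and [s / r <= 5 / 6] gives [128 * (s / r) ^ 28 <= 1] because
    [2 * (5 / 6) ^ 4 <= 1]; the exponent [30] is [2 + 28]. *)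
Lemma expander_term (l r s : nat) : l <= 2 * r -> 6 * s <= 5 * r ->
  'C(l, s) * 'C(r, s) * (s ^ (30 * s)) * 4 ^ s <= r ^ (30 * s).
Proof.
move=> lr sr.
have h1 : 'C(l, s) * s ^ s <= (8 * r) ^ s.
  apply: leq_trans (bin_pow_le l s) _.
  by case: s {sr} => // s; rewrite leq_exp2r //; lia.
have h2 := bin_pow_le r s.
have h4 : 2 * s ^ 4 <= r ^ 4.
  have : (6 * s) ^ 4 <= (5 * r) ^ 4 by rewrite leq_exp2r.
  rewrite !expnMn (_ : 6 ^ 4 = 1296) // (_ : 5 ^ 4 = 625) //.
  by move: (s ^ 4) (r ^ 4) => a b; lia.
have h28 : 128 * s ^ 28 <= r ^ 28.
  have -> : 128 * s ^ 28 = (2 * s ^ 4) ^ 7 by rewrite expnMn -expnM.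
  by rewrite (_ : 28 = 4 * 7) // expnM leq_exp2r.
have -> : r ^ (30 * s) = (r ^ 2) ^ s * (r ^ 28) ^ s by rewrite -!expnM -expnD -mulnDl.
have -> : s ^ (30 * s) = s ^ s * s ^ s * (s ^ 28) ^ s.
  by rewrite -!expnM -!expnD; congr (_ ^ _); lia.
have h28s : (128 * s ^ 28) ^ s <= (r ^ 28) ^ s.
  by case: (posnP s) => [->|s0]; rewrite ?expn0 // leq_exp2r.
apply: leq_trans (leq_mul (leqnn _) h28s).
have -> : (128 * s ^ 28) ^ s = 32 ^ s * 4 ^ s * (s ^ 28) ^ s by rewrite expnMn -(expnMn 32 4).
have h3 : ('C(l, s) * s ^ s) * ('C(r, s) * s ^ s) <= 32 ^ s * (r ^ 2) ^ s.
  apply: leq_trans (leq_mul h1 h2) _.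
  rewrite -!expnMn (_ : 8 * r * (4 * r) = 32 * r ^ 2) //.
  by rewrite mulnACA.
by apply: (leq_cast _ _ (leq_mul h3 (leqnn (4 ^ s * (s ^ 28) ^ s)))); ring.
Qed.

Lemma geometric_quarter (m : nat) : (\sum_(s < m) (4%:R ^- s.+1 : rat) < 1)%R.
Proof.
have -> : (\sum_(s < m) (4%:R ^- s.+1 : rat) = (1 - 4%:R ^- m) / 3%:R)%R.
  elim: m => [|m IHm]; first by rewrite big_ord0 expr0 invr1 subrr mul0r.
  rewrite big_ord_recr /= IHm !exprS !invfM.
  by field; rewrite expf_neq0.
have : (0 < 4%:R ^- m :> rat)%R by rewrite invr_gt0 exprn_gt0.
by rewrite ltr_pdivrMr //; lra.
Qed.

(** * Bounded-degree expanders and the robust template *)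

Section Expander.
Variables (L B : finType).
Hypothesis LB : #|L| <= 2 * #|B|.
Hypothesis B0 : 0 < #|B|.
Let D := 30.
Let Lst := (L * 'I_D)%type.
Let Bst := (B * 'I_(2 * D))%type.

Let stub_inj : exists i : Lst -> Bst, injective i.
Proof.
have le : #|{: Lst}| <= #|{: Bst}|.
  by rewrite !card_prod !card_ord; rewrite mulnA leq_mul2r /= mulnC LB.
by exists (fun a => enum_val (widen_ord le (enum_rank a))) => a b /enum_val_inj /(congr1 val) /= /val_inj /enum_rank_inj.
Qed.

(** Configuration model: [30] stubs at each vertex of [L] are injected among [60] stubs at each
    vertex of [B], then permuted at random. If [S] does not expand, its stubs land on those of some
    [T] of the same size, a fraction [#|S| / #|B|] of all stubs. *)
Lemma expander_exists : exists E : L -> B -> bool,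
  [/\ forall b, #|[set a | E a b]| <= 2 * D, forall a, #|[set b | E a b]| <= D &
      forall S : {set L}, 6 * #|S| <= 5 * #|B| -> #|S| <= #|nbhd E S|].
Proof.
have [i0 i0inj] := stub_inj.
pose st (S : {set L}) : {set Bst} := i0 @: setX S setT.
pose tt (T : {set B}) : {set Bst} := setX T setT.
pose Es (s : {perm Bst}) a b := [exists i : 'I_D, (s (i0 (a, i))).1 == b].
pose bad (s : {perm Bst}) := [exists S : {set L}, [exists T : {set B},
   [&& #|S| == #|T|, 0 < #|S|, 6 * #|S| <= 5 * #|B| & s @: st S \subset tt T]]].
have cst S : #|st S| = #|S| * D by rewrite card_imset // cardsX cardsT card_ord.
have ctt T : #|tt T| = #|T| * (2 * D) by rewrite cardsX cardsT card_ord.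
have badle : ((#|[set s | bad s]|)%:R < (#|{: {perm Bst}}|)%:R :> rat)%R.
  pose Np := #|{: {perm Bst}}|.
  have Np0 : 0 < Np by apply/card_gt0P; exists 1%g.
  pose W (S : {set L}) (T : {set B}) := [set s : {perm Bst} | s @: st S \subset tt T].
  have wle (S : {set L}) (T : {set B}) : #|S| = #|T| -> #|W S T| * #|B| ^ (30 * #|S|) <= #|S| ^ (30 * #|S|) * Np.
    move=> e; have := card_perm_into_le (st S) (tt T).
    rewrite cst ctt card_prod card_ord -e -/Np (mulnC #|S| D).
    rewrite !(expnMn _ (2 * D)) mulnA -[leqRHS]mulnA (mulnC (_ ^ _) Np) mulnA.
    rewrite leq_pmul2r; last by rewrite expn_gt0.
    by [].
  pose m := #|B|.
  have sub : [set s | bad s] \subset \bigcup_(k < m) \bigcup_(S : {set L} | (#|S| == k.+1) && (6 * k.+1 <= 5 * #|B|)) \bigcup_(T : {set B} | #|T| == k.+1) W S T.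
    apply/subsetP => s; rewrite inE => /existsP[S /existsP[T /and4P[/eqP e S0 h w]]].
    have km : #|S|.-1 < m by rewrite prednK //; rewrite /m; lia.
    apply/bigcupP; exists (Ordinal km) => //.
    apply/bigcupP; exists S; rewrite /= prednK // ?eqxx //.
    by apply/bigcupP; exists T; rewrite -?e ?eqxx // inE.
  pose bk (k : nat) := \sum_(S : {set L} | (#|S| == k.+1) && (6 * k.+1 <= 5 * #|B|)) \sum_(T : {set B} | #|T| == k.+1) #|W S T|.
  have card_le : #|[set s | bad s]| <= \sum_(k < m) bk k.
    apply: leq_trans (subset_leq_card sub) _.
    have Ub (I : finType) (P : pred I) (F : I -> {set {perm Bst}}) : #|\bigcup_(i | P i) F i| <= \sum_(i | P i) #|F i|.
      elim/big_rec2: _ => [|i n X _ IH]; first by rewrite cards0.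
      by apply: leq_trans (leq_card_setU _ _) _; rewrite leq_add2l.
    apply: leq_trans (Ub _ _ _) _; apply: leq_sum => k _.
    by apply: leq_trans (Ub _ _ _) _; apply: leq_sum => S _; apply: Ub.
  apply: (@le_lt_trans _ _ (\sum_(k < m) Np%:R * 4%:R ^- k.+1)%R); last first.
    by rewrite -mulr_sumr gtr_pMr ?geometric_quarter // ltr0n.
  apply: (@le_trans _ _ (\sum_(k < m) (bk k)%:R)%R).
    by rewrite -natr_sum ler_nat.
  apply: ler_sum => -[k km] _ /=; rewrite /bk; set s := k.+1.
  case: (leqP (6 * s) (5 * #|B|)) => hs; last first.
    rewrite big_pred0 ?mulr_ge0 ?ler0n ?invr_ge0 ?exprn_ge0 // => S.
    by rewrite andbF.
  rewrite ler_pdivlMr ?exprn_gt0 // -natrX -natrM ler_nat.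
  pose c := 'C(#|L|, s) * 'C(#|B|, s).
  have Bs : 0 < #|B| ^ (30 * s) by rewrite expn_gt0 B0.
  rewrite -(leq_pmul2r Bs).
  apply: (@leq_trans (c * (s ^ (30 * s) * Np) * 4 ^ s)).
    rewrite mulnAC leq_mul2r; apply/orP; right; rewrite big_distrl /=.
    rewrite (eq_bigl (fun S : {set L} => #|S| == s)); last by move=> S; rewrite andbT.
    rewrite /c -mulnA -(card_draws L s) -sum_nat_const.
    rewrite (eq_bigl (fun S : {set L} => S \in [set S0 : {set L} | #|S0| == s])); last by move=> S; rewrite inE.
    apply: leq_sum => S; rewrite inE => /eqP cS; rewrite big_distrl /=.
    rewrite -(card_draws B s) -sum_nat_const.
    rewrite (eq_bigl (fun S : {set B} => S \in [set S0 : {set B} | #|S0| == s])); last by move=> T; rewrite inE.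
    apply: leq_sum => T; rewrite inE => /eqP cT.
    by rewrite -cS; apply: wle; rewrite cS.
  have := expander_term LB hs => h.
  by apply: (leq_cast _ _ (leq_mul h (leqnn Np))); rewrite /c; ring.
have /existsP[s hs] : [exists s, ~~ bad s].
  apply: contraLR badle; rewrite negb_exists => /forallP h.
  rewrite -leNgt ler_nat; apply: subset_leq_card; apply/subsetP => s _.
  by rewrite inE; have := h s; rewrite negbK.
exists (Es s); split.
- move=> b; apply: (@leq_trans #|setX [set b] [set: 'I_(2 * D)]|); last first.
    by rewrite cardsX cards1 cardsT card_ord mul1n.
  pose F := [set ai : Lst | (s (i0 ai)).1 == b].
  apply: (@leq_trans #|[set ai.1 | ai in F]|).
    apply: subset_leq_card; apply/subsetP => a; rewrite inE => /existsP[i hi].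
    by apply/imsetP; exists (a, i); rewrite ?inE.
  apply: leq_trans (leq_imset_card _ _) _.
  rewrite -(card_imset _ (inj_comp (@perm_inj _ s) i0inj)).
  apply: subset_leq_card; apply/subsetP => t /imsetP[ai]; rewrite inE => h ->.
  by rewrite !inE h.
- move=> a; apply: (@leq_trans #|[set (s (i0 (a, i))).1 | i : 'I_D]|).
    apply: subset_leq_card; apply/subsetP => b; rewrite inE => /existsP[i /eqP<-].
    by apply/imsetP; exists i.
  by apply: leq_trans (leq_imset_card _ _) _; rewrite card_ord.
move=> S hS; rewrite leqNgt; apply/negP => lt.
have SB : #|S| <= #|B| by lia.
have [T sT cT] : exists2 T : {set B}, nbhd (Es s) S \subset T & #|T| = #|S|.
  have : #|S| - #|nbhd (Es s) S| <= #|~: nbhd (Es s) S| by have := cardsC (nbhd (Es s) S); lia.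
  case/subset_of_card => U sU cU; exists (nbhd (Es s) S :|: U); first exact: subsetUl.
  rewrite cardsU disjoint_setI0 ?cards0; first lia.
  by rewrite disjoint_sym disjoints_subset.
case/negP: hs; apply/existsP; exists S; apply/existsP; exists T.
rewrite cT eqxx hS (leq_trans _ lt) //=; apply/subsetP => t /imsetP[u /imsetP[[a i]]].
rewrite inE /= => /andP[aS _] -> ->; rewrite !inE andbT; apply: (subsetP sT).
by rewrite inE; apply/exists_inP; exists a => //; apply/existsP; exists i.
Qed.

End Expander.

(** [E1] from [A] to [B] settles Hall's condition up to size [5/6] of [#|B|]. If a larger [S] fails,
    some [T] of [#|B| - #|S| + 1] elements of [B] sees nothing of [S]; but by the expander [E2] from
    [B] to [Y] it sees at least [#|T|] elements of [Y], all in [A' :\: S], which has only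
    [#|T| - 1]. The degrees add up to [60 + 30]. *)
Lemma template (A B : finType) (Y : {set A}) : 2 < #|B| -> #|A| <= 2 * #|B| ->
  6 * #|B| <= 10 * #|Y| ->
  exists E : A -> B -> bool, (forall b, #|[set a | E a b]| <= 90) /\
  forall A' : {set A}, #|A'| = #|B| -> Y \subset A' ->
  exists2 h : B -> A, injective h & forall b, (h b \in A') && E (h b) b.
Proof.
move=> B3 AB BY; have B0 : 0 < #|B| by lia.
have [E1 [E1b E1a E1x]] := expander_exists AB B0.
pose YT := {a : A | a \in Y}.
have cY : #|{: YT}| = #|Y| by rewrite card_sig; apply: eq_card.
have [||E2 [E2b E2a E2x]] := @expander_exists B {: YT}; rewrite ?cY; try lia.
pose E a b := E1 a b || [exists y : YT, (val y == a) && E2 b y].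
exists E; split=> [b|A' cA' YA'].
  apply: (@leq_trans #|[set a | E1 a b] :|: [set val y | y in [set y : YT | E2 b y]]|).
    apply: subset_leq_card; apply/subsetP => a; rewrite !inE => /orP[->//|].
    case/existsP=> y /andP[/eqP<- ey]; apply/orP; right; apply/imsetP.
    by exists y; rewrite ?inE.
  apply: leq_trans (leq_card_setU _ _) _.
  by apply: leq_trans (leq_add (E1b b) (leq_trans (leq_imset_card _ _) (E2a b))) _.
have [b0 _] : exists b : B, b \in B by apply/card_gt0P.
have [|f finj fE] := @hall_sets A B E b0 #|A'| A' setT (leqnn _).
  move=> S SA'; rewrite setIT.
  case: (leqP (6 * #|S|) (5 * #|B|)) => hS.
    apply: leq_trans (E1x S hS) _; apply: subset_leq_card; apply/subsetP => b.
    rewrite !inE => /exists_inP[a aS e]; apply/exists_inP; exists a => //.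
    by rewrite /E e.
  rewrite leqNgt; apply/negP => lt.
  have SB : #|S| <= #|B| by rewrite -cA' subset_leq_card.
  have : #|B| - #|S| + 1 <= #|~: nbhd E S| by have := cardsC (nbhd E S); lia.
  case/subset_of_card => T sT cT.
  (* [#|T|] is below [#|B| / 6 + 1] while [5 * #|Y| >= 3 * #|B|]; the additive [1] is absorbed by
     [2 < #|B|]. *)
  have T6 : 6 * #|T| <= 5 * #|{: YT}| by rewrite cY cT; lia.
  have := E2x T T6; rewrite leqNgt => /negP; apply.
  have sub : [set val y | y in nbhd E2 T] \subset A' :\: S.
    apply/subsetP => a /imsetP[y]; rewrite inE => /exists_inP[b bT eby] ->.
    rewrite inE (subsetP YA') ?(valP y) // andbT.
    apply/negP => yS; have := subsetP sT b bT; rewrite !inE => /exists_inP; apply.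
    by exists (val y) => //; rewrite /E; apply/orP; right; apply/existsP; exists y; rewrite eqxx.
  have := subset_leq_card sub; rewrite card_imset; last exact: val_inj.
  by rewrite cardsD (setIidPr SA') cA' cT addn1 ltnS.
have fim : f @: A' = setT.
  by apply/eqP; rewrite eqEcard subsetT card_in_imset // cardsT cA' leqnn.
have hP b : exists a, (a \in A') && (f a == b).
  have : b \in f @: A' by rewrite fim inE.
  by case/imsetP=> a aA ->; exists a; rewrite aA eqxx.
pose h b := xchoose (hP b).
have hh b : (h b \in A') && (f (h b) == b) := xchooseP (hP b).
exists h => [b b' e|b].
  have /andP[_ /eqP<-] := hh b; have /andP[_ /eqP<-] := hh b'; by rewrite e.
have /andP[hA /eqP e] := hh b; rewrite hA /=.
by have /andP[+ _] := fE _ hA; rewrite e.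
Qed.

Lemma template_set (A B : finType) (S Y : {set A}) : 2 < #|B| -> #|S| <= 2 * #|B| ->
  Y \subset S -> 6 * #|B| <= 10 * #|Y| ->
  exists E : A -> B -> bool, (forall b, #|[set a | E a b]| <= 90) /\
  forall A' : {set A}, A' \subset S -> #|A'| = #|B| -> Y \subset A' ->
  exists2 h : B -> A, injective h & forall b, (h b \in A') && E (h b) b.
Proof.
move=> B3 SB YS BY; pose AT := {a : A | a \in S}.
have cX (X : {set A}) : X \subset S -> #|[set a : AT | val a \in X]| = #|X|.
  move=> XS; rewrite -(card_imset _ val_inj); apply: eq_card => x.
  apply/imsetP/idP => [[y + ->]|xX]; first by rewrite inE.
  by exists (Sub x (subsetP XS _ xX)); rewrite ?inE ?SubK.
have cA : #|{: AT}| = #|S| by rewrite card_sig; apply: eq_card.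
have [||E [E90 HE]] := @template AT B [set a : AT | val a \in Y] B3; rewrite ?cX ?cA //.
exists (fun a b => [exists x : AT, (val x == a) && E x b]); split=> [b|A' A'S cA' YA'].
  apply: leq_trans (E90 b); rewrite -(card_imset _ val_inj); apply: subset_leq_card.
  apply/subsetP => a; rewrite inE => /existsP[x /andP[/eqP<- Ex]].
  by apply/imsetP; exists x; rewrite ?inE.
have [||h hi hE] := HE [set a : AT | val a \in A']; first by rewrite cX.
  by apply/subsetP => x; rewrite !inE; apply: (subsetP YA').
exists (val \o h); first by apply: inj_comp => //; apply: val_inj.
move=> b; have /andP[+ Eb] := hE b; rewrite inE /= => ->.
by apply/existsP; exists (h b); rewrite eqxx.
Qed.

(** * Absorbing gadgets *)

Ltac perm_count := apply/seq.permP => ?; rewrite /= ?count_cat /= ?count_cat /= ?count_cat /= ?count_cat /=; ring.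

Lemma set_in_cat (T : finType) (a b : seq T) : [set x in a ++ b] = [set x in a] :|: [set x in b].
Proof. by apply/setP => x; rewrite !inE mem_cat. Qed.

Section Spans.
Variables (n : nat) (K : finType).
Local Notation W := 'I_n.
Variables (nb hb : rel W) (col : W -> W -> K).
Hypotheses (nbC : symmetric nb) (hbC : symmetric hb) (colC : forall x y, col x y = col y x).

Implicit Types (Q S : {set W}) (G Kc : {set K}) (a : seq W) (b : seq K) (v x y r s t : W) (c : K).

Definition joined : rel W := [rel x y | nb x y || hb x y].

(** Vertices and colours are recorded up to permutation, so that gluing paths becomes concatenation
    of lists; the order survives only in the witness [p]. *)
Definition span (s t : W) (a : seq W) (b : seq K) :=
  exists p, [/\ path joined s p, last s p = t, perm_eq (s :: p) a & perm_eq (pairmap col s p) b].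

Lemma span_perm s t a b a' b' : perm_eq a a' -> perm_eq b b' -> span s t a b -> span s t a' b'.
Proof.
move=> aa bb [p [h1 h2 h3 h4]]; exists p; split=> //.
  exact: perm_trans h3 aa.
exact: perm_trans h4 bb.
Qed.

Lemma span_ends s t a b : span s t a b -> s \in a /\ t \in a.
Proof.
by case=> p [_ <- /perm_mem pa _]; rewrite -!pa mem_head mem_last.
Qed.

Lemma span1 s : span s s [:: s] [::].
Proof. by exists [::]. Qed.

Lemma span_cat s t a b s' t' a' b' : span s t a b -> span s' t' a' b' -> joined t s' ->
  span s t' (a ++ a') (col t s' :: b ++ b').
Proof.
move=> [p [h1 h2 h3 h4]] [p' [k1 k2 k3 k4]] e; exists (p ++ s' :: p'); split.
- by rewrite cat_path h1 h2 /= e.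
- by rewrite last_cat.
- by rewrite -cat_cons; apply: perm_cat.
rewrite pairmap_cat h2 /= perm_catC /= perm_cons perm_catC; exact: perm_cat.
Qed.

Lemma span_link s t a b s' t' a' b' r r' : span s t a b -> span s' t' a' b' ->
  [&& joined t r, joined r r' & joined r' s'] ->
  span s t' ([:: r; r'] ++ a ++ a') ([:: col t r; col r r'; col r' s'] ++ b ++ b').
Proof.
move=> h h' /and3P[e1 e2 e3].
have := span_cat (span_cat (span_cat h (span1 r) e1) (span1 r') e2) h' e3.
apply: span_perm; perm_count.
Qed.

(** [Jprop], [Lprop] and [Sprop] are the typical properties as the deterministic part sees them:
    sparse random edges, robust local edges of [G0], and switches. *)
Definition Jprop (M : nat) := forall (A B : {set W}) (G : {set K}),
  n <= #|A| * M -> n <= #|B| * M -> n <= #|G| * M ->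
  exists a b : W, [/\ a \in A, b \in B, a != b, hb a b & col a b \in G].

Definition Lprop (S : {set W}) (Kc : {set K}) (M : nat) := forall (a : W) (Q : {set W}) (G : {set K}),
  #|Q| * M <= n -> #|G| * M <= n ->
  exists2 r, r \in S :\: Q & nb a r && (col a r \in Kc :\: G).

Definition Sprop (M : nat) := forall p q (Q : {set W}) (G : {set K}),
  #|Q| * M <= n -> #|G| * M <= n -> switch_at nb col p q Q G.

(** If the usable neighbours were few, they could be forbidden together with [Q]. *)
Lemma Lprop_many S Kc M (a : W) Q G : Lprop S Kc M -> #|Q| * (2 * M) <= n -> #|G| * M <= n ->
  n < #|[set r in S :\: Q | nb a r && (col a r \in Kc :\: G)]| * (2 * M).
Proof.
move=> L hQ hG; rewrite ltnNge; apply/negP => h.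
have [r] := L a _ _ (card_setU_small hQ h) hG.
rewrite in_setD in_setU negb_or => /andP[/andP[rQ rR] rS] hr.
by case/negP: rR; rewrite in_set in_setD rQ rS.
Qed.

Definition connects (S : {set W}) (Kc : {set K}) (a b r r' : W) (Q : {set W}) (G : {set K}) :=
  [/\ r \in S :\: Q, r' \in S :\: Q, r != r', [&& nb a r, hb r r' & nb r' b] &
    uniq [:: col a r; col r r'; col r' b] /\
    {subset [:: col a r; col r r'; col r' b] <= Kc :\: G}].

(** The outer edges come from [G0], the middle one from the random graph. Exactly [m] candidates are
    kept on each side, so that all colours on their edges to [a] and to [b] are few and can be
    avoided later; whichever pair [r, r'] is joined, the three colours then differ. *)
Lemma connector S Kc M Mj (a b : W) Q G : 0 < M -> 4 * M <= n -> 8 * M <= Mj ->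
  Lprop S Kc M -> Jprop Mj -> n <= #|Kc| * M ->
  #|Q| * (4 * M) <= n -> #|G| * (4 * M) <= n ->
  exists r r', connects S Kc a b r r' Q G.
Proof.
move=> M0 Mn MMj L J Kn hQ hG.
have M40 : 0 < 4 * M by rewrite muln_gt0.
have [m m1 m2] := linear_quotient M40 Mn.
have hQ2 : #|Q| * (2 * M) <= n by apply: leq_trans hQ; rewrite leq_mul2l leq_mul2r !orbT.
have le24 : forall A : {set K}, #|A| * (4 * M) <= n -> #|A| * M <= n.
  by move=> A; apply: leq_trans; rewrite leq_mul2l leq_pmull ?orbT.
have big (c : nat) : n < c * (2 * M) -> m <= c.
  move=> h; rewrite leqNgt; apply/negP => lt.
  have := leq_mul lt (leqnn (2 * M)); have : m * (2 * M) <= m * (4 * M) by rewrite leq_mul2l leq_mul2r !orbT.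
  have : c * (2 * M) <= c.+1 * (2 * M) by rewrite leq_mul2r leqnSn orbT.
  by move: h m1; clear; lia.
have mMj : n <= m * Mj.
  by apply: leq_trans m2 _; rewrite leq_mul2l; apply/orP; right; rewrite mulnA.
have [A0 sA cA] := subset_of_card (big _ (Lprop_many a L hQ2 (le24 _ hG))).
pose GA := [set col a r | r in A0].
have cGA : #|GA| * (4 * M) <= n.
  by apply: leq_trans m1; rewrite leq_mul2r -cA leq_imset_card orbT.
have e4 : 2 * (2 * M) = 4 * M by rewrite mulnA.
have hG1 : #|G :|: GA| * (2 * M) <= n by apply: card_setU_small; rewrite e4.
have hG1' : #|G :|: GA| * M <= n by apply: leq_trans hG1; rewrite leq_mul2l leq_pmull ?orbT.
have [B0 sB cB] := subset_of_card (big _ (Lprop_many b L hQ2 hG1')).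
pose GB := [set col b r | r in B0].
have cGB : #|GB| * (4 * M) <= n.
  by apply: leq_trans m1; rewrite leq_mul2r -cB leq_imset_card orbT.
have [r [r' [rA r'B rr' hrr' crr']]] : exists r r', [/\ r \in A0, r' \in B0, r != r', hb r r'
   & col r r' \in Kc :\: (G :|: GA :|: GB)].
  apply: J; rewrite ?cA ?cB //.
  have : n <= #|Kc :\: (G :|: GA :|: GB)| * (4 * M).
    have : #|Kc| - (#|G| + #|GA| + #|GB|) <= #|Kc :\: (G :|: GA :|: GB)|.
      rewrite cardsD; apply: leq_sub2l; apply: leq_trans (subset_leq_card (subsetIr _ _)) _.
      have [h1 _] := leq_card_setU (G :|: GA) GB; have [h2 _] := leq_card_setU G GA.
      by move: h1 h2; clear; lia.
    move: (#|Kc :\: _|) => c hc; apply: leq_trans (leq_mul hc (leqnn (4 * M))).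
    by rewrite mulnBl !mulnDl (mulnCA _ 4); move: Kn hG cGA cGB; clear; lia.
  by move=> h; apply: leq_trans h _; rewrite leq_mul2l; apply/orP; right; apply: leq_trans MMj; rewrite leq_mul2r orbT.
have := subsetP sA _ rA; rewrite in_set => /andP[rS /andP[ar car]].
have := subsetP sB _ r'B; rewrite in_set => /andP[r'S /andP[br' cbr']].
move: crr'; rewrite !in_setD !in_setU !negb_or => /andP[/andP[/andP[c1 c2] c3] c4].
move: cbr'; rewrite in_setD in_setU negb_or => /andP[/andP[c5 c6] c7].
move: car; rewrite in_setD => /andP[c8 c9].
exists r, r'; split=> //; first by rewrite ar hrr' nbC br'.
rewrite [col r' b]colC; split.
  rewrite /= !inE negb_or andbT; apply/andP; split; first (apply/andP; split).
  - by apply: contraNneq c2 => <-; apply/imsetP; exists r.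
  - by apply: contraNneq c6 => <-; apply/imsetP; exists r.
  - by apply: contraNneq c3 => ->; apply/imsetP; exists r'.
by move=> c; rewrite !inE => /or3P[] /eqP->; rewrite ?c8 ?c9 ?c1 ?c4 ?c5 ?c7.
Qed.

Definition fresh (a : seq W) (b : seq K) (Q : {set W}) (G : {set K}) :=
  [/\ uniq a, uniq b, {in a, forall x, x \notin Q} & {in b, forall c, c \notin G}].

Lemma fresh_cat a b a' b' Q G : fresh a b Q G ->
  fresh a' b' (Q :|: [set x in a]) (G :|: [set c in b]) -> fresh (a ++ a') (b ++ b') Q G.
Proof.
move=> [ua ub aQ bG] [ua' ub' aQ' bG']; split.
- rewrite cat_uniq ua ua' andbT; apply/hasPn => x /aQ'.
  by rewrite !inE negb_or => /andP[].
- rewrite cat_uniq ub ub' andbT; apply/hasPn => x /bG'.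
  by rewrite !inE negb_or => /andP[].
- by move=> x; rewrite mem_cat => /orP[/aQ //|/aQ']; rewrite inE negb_or => /andP[].
by move=> x; rewrite mem_cat => /orP[/bG //|/bG']; rewrite inE negb_or => /andP[].
Qed.

Lemma fresh_perm a b a' b' Q G : perm_eq a a' -> perm_eq b b' -> fresh a b Q G -> fresh a' b' Q G.
Proof.
move=> pa pb [ua ub aQ bG]; split.
- by rewrite -(perm_uniq pa).
- by rewrite -(perm_uniq pb).
- by move=> x; rewrite -(perm_mem pa); apply: aQ.
by move=> x; rewrite -(perm_mem pb); apply: bG.
Qed.

Section Gadgets.
Variables (M Mj : nat).
Hypotheses (M0 : 0 < M) (nM : 1000 * M <= n) (MMj : 8 * M <= Mj).
Hypotheses (L : Lprop setT setT M) (J : Jprop Mj) (Sw : Sprop M) (Kn : n <= #|K| * M).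

(** A budget: [k] further elements may join [Q] before the bound required by [connector] is
    exceeded. *)
Definition room (T : finType) (Q : {set T}) (k : nat) := (#|Q| + k) * (4 * M) <= n.

Lemma room_add (T : finType) (Q : {set T}) k (a : seq T) : room Q k -> size a <= k ->
  room (Q :|: [set x in a]) (k - size a).
Proof.
rewrite /room => h ak; apply: leq_trans h; rewrite leq_mul2r; apply/orP; right.
have [+ _] := leq_card_setU Q [set x in a].
have : #|[set x in a]| <= size a by rewrite cardsE card_size.
by move: ak; clear; lia.
Qed.

Lemma room_leq (T : finType) (Q : {set T}) k k' : room Q k -> k' <= k -> room Q k'.
Proof. by rewrite /room => h kk; apply: leq_trans h; rewrite leq_mul2r leq_add2l kk orbT. Qed.

Lemma room0 (T : finType) (Q : {set T}) k : room Q k -> #|Q| * (4 * M) <= n.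
Proof. by rewrite /room => h; apply: leq_trans h; rewrite leq_mul2r leq_addr orbT. Qed.

Lemma roomM (T : finType) (Q : {set T}) k : room Q k -> #|Q| * M <= n.
Proof. by move/room0; apply: leq_trans; rewrite leq_mul2l leq_pmull ?orbT. Qed.

Lemma connector_fresh (a b : W) Q G : room Q 0 -> room G 0 ->
  exists r r', [&& joined a r, joined r r' & joined r' b] /\
    fresh [:: r; r'] [:: col a r; col r r'; col r' b] Q G.
Proof.
move=> /room0 hQ /room0 hG.
have Mn4 : 4 * M <= n by apply: leq_trans nM; rewrite leq_mul2r orbT.
have Kn' : n <= #|[set: K]| * M by rewrite cardsT.
have [r [r' [rQ r'Q rr' /and3P[e1 e2 e3] [uc cG]]]] := connector a b M0 Mn4 MMj L J Kn' hQ hG.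
exists r, r'; split; first by rewrite /joined /= e1 e2 e3 orbT.
split=> //; first by rewrite /= inE rr'.
  by move=> x; rewrite !inE => /orP[] /eqP->; [move: rQ|move: r'Q]; rewrite inE => /andP[].
by move=> c /cG; rewrite inE => /andP[].
Qed.

(** A switch whose [x] and [y] are joined by a connector [r r']. Traversing it as [u x r r' y u']
    uses [p], as [u y r' r x u'] uses [q]; the vertices and the other four colours are the same. *)
Lemma swap_gadget (p q : K) Q G : room Q 6 -> room G 6 -> exists s t a b,
  [/\ fresh a b Q (G :|: [set p; q]), size a = 6, size b = 4,
    span s t a (p :: b) & span s t a (q :: b)].
Proof.
move=> rQ rG.
have rG1 : room (G :|: [set c in [:: p; q]]) 4 by apply: (room_add rG).
have [u [x [y [u' [/and4P[uQ xQ yQ u'Q] unq /and4P[ux uy u'x u'y] [cux cuy] [ck kG]]]]]] :=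
  Sw p q (roomM rQ) (roomM rG1).
pose k := col u' x.
have rQ1 : room (Q :|: [set c in [:: u; x; y; u']]) 0.
  by apply: room_leq (room_add rQ _) _.
have rG2 : room (G :|: [set c in [:: p; q]] :|: [set c in [:: k]]) 0.
  by apply: room_leq (room_add rG1 _) _.
have [r [r' [/and3P[e1 e2 e3] fr]]] := connector_fresh x y rQ1 rG2.
have geC : symmetric joined by move=> z z'; rewrite /joined /= nbC hbC.
have nbge z z' : nb z z' -> joined z z' by rewrite /joined /= => ->.
exists u, u', [:: u; x; r; r'; y; u'], [:: col x r; col r r'; col r' y; k].
have f1 : fresh [:: u; x; y; u'] [:: k] Q (G :|: [set p; q]).
  split=> //; first by move=> z; rewrite !inE => /or4P[] /eqP->.
  by move=> c; rewrite inE => /eqP->; move: kG; rewrite !inE.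
have f2 : fresh [:: r; r'] [:: col x r; col r r'; col r' y] (Q :|: [set z in [:: u; x; y; u']])
     (G :|: [set p; q] :|: [set c in [:: k]]).
  by case: fr => h1 h2 h3 h4; split=> // c /h4; rewrite !inE.
split=> //.
- apply: fresh_perm (fresh_cat f1 f2); perm_count.
- exists [:: x; r; r'; y; u']; split=> //=.
    by rewrite nbge // e1 e2 e3 /= geC nbge.
  by rewrite cux [col y u']colC -ck.
exists [:: y; r'; r; x; u']; split=> //=.
- by rewrite nbge //= geC e3 geC e2 geC e1 geC nbge.
- by perm_count.
rewrite cuy [col y r']colC [col r' r]colC [col r x]colC [col x u']colC -/k.
by perm_count.
Qed.

Lemma fresh_sub a b Q G Q' G' : Q \subset Q' -> G \subset G' -> fresh a b Q' G' -> fresh a b Q G.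
Proof.
move=> sQ sG [h1 h2 h3 h4]; split=> // x /=.
  by move=> /h3; apply: contra; apply: (subsetP sQ).
by move=> /h4; apply: contra; apply: (subsetP sG).
Qed.

(** A connector from [v] to itself is a triangle [v y z]: the edge [y z] costs [al], the detour
    through [v] costs [b1] and [b2]. One swap gadget exchanges [b1] and [al], another [b2] and [c].
    Without [v] the colours [al, b1, b2] are used, with [v] the colours [b1, b2, al, c]: exactly [v]
    and [c] are gained. *)
Lemma absorber v c Q G : room Q 18 -> room G 20 -> exists s t a b,
  [/\ fresh a b Q G, size a = 18, size b = 17, span s t a b & span s t (v :: a) (c :: b)].
Proof.
move=> rQ rG; have geC : symmetric joined by move=> z z'; rewrite /joined /= nbC hbC.
have [y [z [/and3P[e1 e2 e3] f0]]] := connector_fresh v v (room_leq (k' := 0) rQ isT) (room_leq (k' := 0) rG isT).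
set b1 := col v y in f0; set al := col y z in f0; set b2 := col z v in f0.
have rQ1 := room_add rQ (isT : size [:: y; z] <= 18).
have rG1 := room_add rG (isT : size [:: b1; al; b2] <= 20).
have [s1 [t1 [a1 [c1 [f1 sa1 sc1 off1 on1]]]]] := swap_gadget b1 al (room_leq (k' := 6) rQ1 isT) (room_leq (k' := 6) rG1 isT).
have {}f1 := fresh_sub (subxx _) (subsetUl _ _) f1.
have rQ2 := room_add rQ1 (_ : size a1 <= _); rewrite sa1 /= in rQ2; have {}rQ2 := rQ2 isT.
have rG2 := room_add rG1 (_ : size c1 <= _); rewrite sc1 /= in rG2; have {}rG2 := rG2 isT.
have [s2 [t2 [a2 [c2 [f2 sa2 sc2 off2 on2]]]]] := swap_gadget b2 c (room_leq (k' := 6) rQ2 isT) (room_leq (k' := 6) rG2 isT).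
have {}f2 := fresh_sub (subxx _) (subsetUl _ _) f2.
have rQ3 := room_add rQ2 (_ : size a2 <= _); rewrite sa2 /= in rQ3; have {}rQ3 := rQ3 isT.
have rG3 := room_add rG2 (_ : size c2 <= _); rewrite sc2 /= in rG3; have {}rG3 := rG3 isT.
have [r1 [r1' [l1 f3]]] := connector_fresh z s1 (room_leq (k' := 0) rQ3 isT) (room_leq (k' := 0) rG3 isT).
have rQ4 := room_add rQ3 (isT : size [:: r1; r1'] <= 18 - 2 - 6 - 6).
have rG4 := room_add rG3 (isT : size [:: col z r1; col r1 r1'; col r1' s1] <= 20 - 3 - 4 - 4).
have [r2 [r2' [l2 f4]]] := connector_fresh t1 s2 (room_leq (k' := 0) rQ4 isT) (room_leq (k' := 0) rG4 isT).
exists y, t2, (((([:: y; z] ++ a1) ++ a2) ++ [:: r1; r1']) ++ [:: r2; r2']),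
  (((([:: b1; al; b2] ++ c1) ++ c2) ++ [:: col z r1; col r1 r1'; col r1' s1]) ++
   [:: col t1 r2; col r2 r2'; col r2' s2]).
have off0 : span y z [:: y; z] [:: al] by exists [:: z]; split=> //=; rewrite e2.
have on0 : span y z [:: y; v; z] [:: b1; b2].
  exists [:: v; z]; split=> //=; first by rewrite geC e1 geC e3.
  by rewrite [col y v]colC [col v z]colC.
split.
- have f01 := fresh_cat f0 f1.
  have f012 : fresh (([:: y; z] ++ a1) ++ a2) (([:: b1; al; b2] ++ c1) ++ c2) Q G.
    by apply: fresh_cat f01 _; rewrite !set_in_cat !setUA.
  have f0123 : fresh ((([:: y; z] ++ a1) ++ a2) ++ [:: r1; r1'])
      ((([:: b1; al; b2] ++ c1) ++ c2) ++ [:: col z r1; col r1 r1'; col r1' s1]) Q G.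
    by apply: fresh_cat f012 _; rewrite !set_in_cat !setUA.
  by apply: fresh_cat f0123 _; rewrite !set_in_cat !setUA.
- by rewrite !size_cat /= sa1 sa2.
- by rewrite !size_cat /= sc1 sc2.
- have := span_link (span_link off0 off1 l1) off2 l2.
  by apply: span_perm; perm_count.
have := span_link (span_link on0 on1 l1) on2 l2.
by apply: span_perm; perm_count.
Qed.

Definition gad s t a b (I : seq (W * K)) :=
  span s t a b /\ forall i, i \in I -> span s t (i.1 :: a) (i.2 :: b).

Lemma gad_exists (I : seq (W * K)) Q G : room Q (20 * size I + 1) -> room G (20 * size I + 3) ->
  exists s t a b, [/\ fresh a b Q G, size a = 20 * size I + 1, size b = 20 * size I & gad s t a b I].
Proof.
elim: I => [|[v c] I IH] rQ rG.
  have /set0Pn[s sQ] : ~: Q != set0.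
    rewrite -card_gt0 cardsCs setCK card_ord subn_gt0.
    move: rQ; rewrite /room /= => h; by apply: leq_trans h; rewrite muln0 add0n addn1 leq_pmulr // muln_gt0.
  exists s, s, [:: s], [::]; split=> //; last by split=> //; exact: span1.
  by split=> // x; rewrite inE => /eqP->; rewrite inE in sQ.
rewrite [size _]/= mulnSr in rQ rG *.
have [||s [t [a [b [f sa sb [off on]]]]]] := IH.
- by apply: room_leq rQ _; clear; lia.
- by apply: room_leq rG _; clear; lia.
have rQ1 : room (Q :|: [set x in a]) 20.
  by apply: room_leq (room_add rQ _) _; rewrite sa; clear; lia.
have rG1 : room (G :|: [set x in b]) 23.
  by apply: room_leq (room_add rG _) _; rewrite sb; clear; lia.
have [s' [t' [a' [b' [f' sa' sb' off' on']]]]] := absorber v c (room_leq (k' := 18) rQ1 isT) (room_leq (k' := 20) rG1 isT).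
have rQ2 : room (Q :|: [set x in a] :|: [set x in a']) 0.
  by apply: room_leq (room_add rQ1 _) _; rewrite sa'.
have rG2 : room (G :|: [set x in b] :|: [set x in b']) 0.
  by apply: room_leq (room_add rG1 _) _; rewrite sb'.
have [r [r' [l f2]]] := connector_fresh t s' rQ2 rG2.
exists s, t', ((a ++ a') ++ [:: r; r']), ((b ++ b') ++ [:: col t r; col r r'; col r' s']).
split.
- by apply: fresh_cat (fresh_cat f f') _; rewrite !set_in_cat !setUA.
- by rewrite !size_cat sa sa' /=; clear; lia.
- by rewrite !size_cat sb sb' /=; clear; lia.
split.
  have := span_link off off' l.
  by apply: span_perm; perm_count.
move=> i; rewrite inE => /orP[/eqP->|iI] /=.
  have := span_link off on' l.
  by apply: span_perm; perm_count.
have := span_link (on i iI) off' l.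
by apply: span_perm; perm_count.
Qed.

Definition mgad s t a b (Is : seq (seq (W * K))) :=
  forall its, all2 (fun i I => i \in I) its Is ->
  span s t (map fst its ++ a) (map snd its ++ b).

(** The [3] accounts for the connector that attaches the gadget of a list: three colours, or two
    vertices and the starting vertex of that gadget. *)
Definition gad_size (Is : seq (seq (W * K))) := sumn [seq 20 * size l + 3 | l <- Is].

Lemma mgad_exists (Is : seq (seq (W * K))) Q G : room Q (gad_size Is + 1) -> room G (gad_size Is + 3) ->
  exists s t a b, [/\ fresh a b Q G, size a = gad_size Is + 1, size b = gad_size Is, mgad s t a b Is &
    [/\ s \in a, t \in a & Is != [::] -> s != t]].
Proof.
elim: Is => [|I Is IH] rQ rG.
  have [s [t [a [b [f sa sb [off _]]]]]] := @gad_exists [::] Q G rQ (room_leq (k' := 3) rG isT).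
  have [si ti] := span_ends off.
  by exists s, t, a, b; split=> //; case=> //= _; exact: off.
rewrite /gad_size /= -/(gad_size Is) in rQ rG *.
have [||s [t [a [b [f sa sb mg [si ti _]]]]]] := IH.
- by apply: room_leq rQ _; clear; lia.
- by apply: room_leq rG _; clear; lia.
have rQ1 : room (Q :|: [set x in a]) (20 * size I + 3).
  by apply: room_leq (room_add rQ _) _; rewrite sa; clear; lia.
have rG1 : room (G :|: [set x in b]) (20 * size I + 6).
  by apply: room_leq (room_add rG _) _; rewrite sb; clear; lia.
have [||s' [t' [a' [b' [f' sa' sb' [off' on']]]]]] := @gad_exists I (Q :|: [set x in a]) (G :|: [set x in b]).
- by apply: room_leq rQ1 _; clear; lia.
- by apply: room_leq rG1 _; clear; lia.
have rQ2 : room (Q :|: [set x in a] :|: [set x in a']) 0.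
  by apply: room_leq (room_add rQ1 _) _; rewrite sa'; clear; lia.
have rG2 : room (G :|: [set x in b] :|: [set x in b']) 0.
  by apply: room_leq (room_add rG1 _) _; rewrite sb'; clear; lia.
have [r [r' [l f2]]] := connector_fresh t s' rQ2 rG2.
exists s, t', ((a ++ a') ++ [:: r; r']), ((b ++ b') ++ [:: col t r; col r r'; col r' s']).
split.
- by apply: fresh_cat (fresh_cat f f') _; rewrite !set_in_cat !setUA.
- by rewrite !size_cat sa sa' /=; clear; lia.
- by rewrite !size_cat sb sb' /=; clear; lia.
  case=> // i its /= /andP[iI h].
  have := span_link (mg its h) (on' i iI) l.
  by apply: span_perm; perm_count.
have [_ t'i] := span_ends off'.
rewrite !mem_cat si t'i orbT; split=> // _.
by case: f' => _ _ /(_ _ t'i) + _; apply: contraNneq => <-; rewrite !inE si orbT.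
Qed.

Lemma mgads_exist (I : eqType) (x0 : W) (Is : I -> seq (seq (W * K))) (l : seq I) m Q G :
  uniq l -> (forall i, gad_size (Is i) + 1 <= m) ->
  room Q (m * size l + 3) -> room G (m * size l + 3) ->
  exists F : I -> (W * W) * (seq W * seq K),
  (forall i, i \in l -> [/\ fresh (F i).2.1 (F i).2.2 Q G, size (F i).2.1 = gad_size (Is i) + 1,
     size (F i).2.2 = gad_size (Is i), mgad (F i).1.1 (F i).1.2 (F i).2.1 (F i).2.2 (Is i) &
     [/\ (F i).1.1 \in (F i).2.1, (F i).1.2 \in (F i).2.1 & Is i != [::] -> (F i).1.1 != (F i).1.2]]) /\
  (forall i j, i \in l -> j \in l -> (forall x, x \in (F i).2.1 -> x \in (F j).2.1 -> i = j) /\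
     (forall c, c \in (F i).2.2 -> c \in (F j).2.2 -> i = j)).
Proof.
move=> ul Im; elim: l Q G ul => [|i l IH] Q G /=; first by exists (fun=> ((x0, x0), ([::], [::]))).
case/andP=> il ul rQ rG; have mi := Im i; rewrite mulnSr in rQ rG.
have [||s [t [a [b [f sa sb mg e]]]]] := @mgad_exists (Is i) Q G.
- by apply: room_leq rQ _; move: mi; clear; lia.
- by apply: room_leq rG _; move: mi; clear; lia.
have [//|||F [F1 F2]] := IH (Q :|: [set x in a]) (G :|: [set x in b]).
- by apply: room_leq (room_add rQ _) _; rewrite sa; move: mi; clear; lia.
- by apply: room_leq (room_add rG _) _; rewrite sb; move: mi; clear; lia.
have nel j : j \in l -> (j == i) = false by move=> jl; apply: contraNF il => /eqP<-.
exists (fun j => if j == i then ((s, t), (a, b)) else F j); split.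
  move=> j; rewrite inE => /orP[/eqP->|jl]; first by rewrite eqxx.
  rewrite nel //; have [fj ? ? ? ?] := F1 j jl; split=> //.
  by apply: fresh_sub fj; apply: subsetUl.
move=> j k; rewrite !inE => /orP[/eqP->|jl] /orP[/eqP->|kl]; rewrite ?eqxx ?nel //=.
- have [[_ _ h1 h2] _ _ _ _] := F1 k kl; split=> x xa.
    by move=> /h1; rewrite !inE xa orbT.
  by move=> /h2; rewrite !inE xa orbT.
- have [[_ _ h1 h2] _ _ _ _] := F1 j jl; split=> x.
    by move=> /h1 + xa; rewrite !inE xa orbT.
  by move=> /h2 + xa; rewrite !inE xa orbT.
exact: F2.
Qed.

End Gadgets.
End Spans.

(** * Partial embeddings of a tree *)

Section Trees.
Variables (V : finType) (T : sgraph V).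
Local Notation ad := (adj T).

Lemma adjC : symmetric ad.
Proof. by move=> x y; rewrite /adj /= setUC. Qed.

Lemma adj_irr : irreflexive ad.
Proof.
move=> x; apply/negP => h; have := subsetP (edges_pairs T) _ h.
by rewrite inE setUid cards1.
Qed.

Lemma edgeP e : e \in edges T -> exists x y, [/\ e = [set x; y], x != y & ad x y].
Proof.
move=> eT; have := subsetP (edges_pairs T) _ eT; rewrite inE => /cards2P[x [y [xy e2]]].
by exists x, y; split=> //; rewrite /adj /= -e2.
Qed.

Definition nbrs (D : {set V}) v := [set u in D | ad v u].
Definition iedges (D : {set V}) := [set e in edges T | e \subset D].

Lemma iedges_add (D : {set V}) v : v \notin D ->
  iedges (v |: D) = iedges D :|: [set [set v; u] | u in nbrs D v].
Proof.
move=> vD; apply/setP => e; rewrite !inE; apply/andP/orP.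
  case=> eT eD; case: (boolP (v \in e)) => ve; last first.
    left; rewrite eT; apply/subsetP => x xe; have := subsetP eD x xe.
    by rewrite !inE => /orP[/eqP xv|//]; rewrite -xv xe in ve.
  right; have [x [y [ee xy axy]]] := edgeP eT.
  have [u [eu au]] : exists u, e = [set v; u] /\ ad v u.
    move: ve; rewrite ee !inE => /orP[]/eqP->; first by exists y.
    by exists x; rewrite setUC adjC.
  apply/imsetP; exists u => //; rewrite inE au andbT.
  have := subsetP eD u; rewrite eu !inE eqxx orbT => /(_ isT) /orP[/eqP uv|//].
  by rewrite uv adj_irr in au.
case=> [/andP[eT eD]|/imsetP[u]]; first by split=> //; apply: subset_trans eD (subsetUr _ _).
rewrite inE => /andP[uD au] ->; split=> //; rewrite subUset !sub1set !inE eqxx uD.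
by rewrite orbT.
Qed.

Lemma card_iedges_add (D : {set V}) v : v \notin D -> #|iedges (v |: D)| = #|iedges D| + #|nbrs D v|.
Proof.
move=> vD; rewrite iedges_add // cardsU disjoint_setI0 ?cards0 ?subn0; last first.
  rewrite disjoint_subset; apply/subsetP => e; rewrite !inE => /andP[_ eD].
  by apply/imsetP => -[u _ eu]; case/negP: vD; apply: (subsetP eD); rewrite eu !inE eqxx.
congr (_ + _); apply: card_in_imset => u u'; rewrite !inE => /andP[uD _] /andP[u'D _] /setP /(_ u).
rewrite !inE eqxx orbT => /esym /orP[/eqP uv|/eqP //].
by rewrite uv (negbTE vD) in uD.
Qed.

Hypothesis treeT : is_tree T.

Let conn_in (s : seq V) := [rel x y | [&& ad x y, x \in s & y \in s]].

(** The order grows by adding neighbours. A second earlier neighbour would close a cycle with a path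
    inside the earlier vertices, which is why connectedness within the sequence is part of the
    induction. *)
Lemma tree_order m : 0 < m <= #|V| -> exists s : seq V,
  [/\ uniq s, size s = m, (forall x y, x \in s -> y \in s -> connect (conn_in s) x y) &
   forall s1 v s2, s = s1 ++ v :: s2 -> count (ad v) s1 = (s1 != [::])].
Proof.
have [V0 con acyc] := treeT.
elim: m => // -[_ _|m IH /andP[_ mV]].
  have [v0 _] := card_gt0P V0; exists [:: v0]; split=> //.
    by move=> x y; rewrite !inE => /eqP-> /eqP->.
  by case=> [|a [|b s1]] v s2 // [].
have [|s [us ss cs os]] := IH; first by rewrite /= ltnW.
have [u us'] : exists u, u \in s by case: s ss {us cs os} => // u s _; exists u; rewrite inE eqxx.
have [w ws] : exists w, w \notin s.
  apply/existsP; apply: contraLR mV; rewrite negb_exists => /forallP h.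
  have : #|V| <= size s by rewrite -(card_uniqP us); apply: subset_leq_card; apply/subsetP => x _; have := h x; rewrite negbK.
  by rewrite ss -ltnNge.
have [v [vs [u' [u's auv]]]] : exists v, v \notin s /\ exists u', u' \in s /\ ad u' v.
  case/connectP: (con u w) => p; elim: p u us' => [|x p IHp] u us' /=.
    by move=> _ e; rewrite e us' in ws.
  case/andP=> aux px e; case: (boolP (x \in s)) => xs; first exact: IHp px e.
  by exists x; split=> //; exists u.
have cv : count (ad v) s = 1.
  apply/eqP; rewrite eqn_leq; apply/andP; split; last first.
    by rewrite -has_count; apply/hasP; exists u' => //; rewrite adjC.
  rewrite leqNgt -size_filter; apply/negP => h.
  have [x [y [xs ys xy avx avy]]] : exists x y, [/\ x \in s, y \in s, x != y, ad v x & ad v y].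
    have uf : uniq (filter (ad v) s) by apply: filter_uniq.
    case ef : (filter (ad v) s) h uf => [|x [|y f]] //= _ /andP[]; rewrite inE negb_or => /andP[xy _] _.
    have xf : x \in filter (ad v) s by rewrite ef inE eqxx.
    have yf : y \in filter (ad v) s by rewrite ef !inE eqxx orbT.
    move: xf yf; rewrite !mem_filter => /andP[a1 a2] /andP[a3 a4].
    by exists x, y.
  case/connectP: (cs x y xs ys) => p0 pp0 e0.
  case/shortenP: pp0 e0 => p pp up _ ey.
  have ps : {subset p <= s}.
    move=> z zp; have hp := pp; clear -zp hp; elim: p x zp hp => //= a p IHp x.
    by rewrite inE => /orP[/eqP->|zp] /andP[/and3P[_ _ as_]] //; apply: IHp.
  case: (acyc (v :: x :: p)).
    by case: p ey {pp up ps} => [/= e|//]; rewrite e eqxx in xy.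
  rewrite /ucycle /= avx rcons_path -ey adjC avy andbT.
  apply/and3P; split; last by move: up; rewrite /= => /andP[-> ->].
    apply: sub_path pp => a b /=; by case/and3P.
  rewrite inE negb_or; apply/andP; split; first by apply: contraNneq vs => ->.
  by apply: contra vs => /ps.
exists (rcons s v); split.
- by rewrite rcons_uniq vs.
- by rewrite size_rcons ss.
- have sub : subrel (connect (conn_in s)) (connect (conn_in (rcons s v))).
    apply: connect_sub => a b /and3P[h1 h2 h3]; apply: connect1.
    by rewrite /= h1 !mem_rcons !inE h2 h3 !orbT.
  have cu : connect (conn_in (rcons s v)) u' v.
    by apply: connect1; rewrite /= auv !mem_rcons !inE u's eqxx orbT.
  have cu' : connect (conn_in (rcons s v)) v u'.
    by apply: connect1; rewrite /= adjC auv !mem_rcons !inE u's eqxx orbT.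
  move=> x y; rewrite !mem_rcons !inE => /orP[/eqP->|xs] /orP[/eqP->|ys] //.
  + exact: connect_trans cu' (sub _ _ (cs _ _ u's ys)).
  + exact: connect_trans (sub _ _ (cs _ _ xs u's)) cu.
  + exact: sub (cs _ _ xs ys).
move=> s1 w' s2; case/lastP: s2 => [|s2 z].
  rewrite cats1 => /rcons_inj[<- <-]; rewrite cv.
  by case: s ss {us cs os us' ws vs u's cv}.
by rewrite -rcons_cons -rcons_cat => /rcons_inj[e _]; apply: os e.
Qed.

Lemma tree_order_full : exists s : seq V, [/\ uniq s, (forall x, x \in s) &
   forall s1 v s2, s = s1 ++ v :: s2 -> count (ad v) s1 = (s1 != [::])].
Proof.
have [V0 _ _] := treeT.
have [|s [us ss _ os]] := @tree_order #|V|; first by rewrite V0 leqnn.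
exists s; split=> // x.
have : [set y in s] == [set: V] by rewrite eqEcard subsetT cardsT cardsE (card_uniqP us) ss leqnn.
by move=> /eqP/setP/(_ x); rewrite !inE.
Qed.

Lemma card_tree_edges : #|edges T| = #|V|.-1.
Proof.
have [s [us sV os]] := tree_order_full.
have H s1 s2 : s = s1 ++ s2 -> #|iedges [set x in s1]| = (size s1).-1.
  elim/last_ind: s1 s2 => [|s1 v IH] s2 e.
    apply: eq_card0 => f; rewrite !inE; apply/negP => /andP[/edgeP[x [y [-> _ _]]]].
    by move/subsetP/(_ x); rewrite !inE eqxx => /(_ isT).
  have e' : s = s1 ++ v :: s2 by rewrite e cat_rcons.
  have vs1 : v \notin s1.
    by move: us; rewrite e' cat_uniq /= negb_or => /and3P[_ /andP[]].
  have -> : [set x in rcons s1 v] = v |: [set x in s1].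
    by apply/setP => x; rewrite !inE mem_rcons inE.
  rewrite card_iedges_add ?inE // (IH (v :: s2)) // size_rcons /=.
  have us1 : uniq s1 by move: us; rewrite e' cat_uniq => /andP[].
  have -> : #|nbrs [set x in s1] v| = count (ad v) s1.
    rewrite -size_filter -(card_uniqP (filter_uniq (ad v) us1)).
    by apply: eq_card => x; rewrite !inE mem_filter andbC.
  by rewrite (os _ _ _ e'); case: (s1) => //= a l; rewrite addn1.
have := H s [::]; rewrite cats0 => /(_ erefl).
have -> : [set x in s] = [set: V] by apply/setP => x; rewrite !inE sV.
rewrite -(card_uniqP us) (eq_card (_ : s =i V)) // => <-.
by apply: eq_card => e; rewrite inE subsetT andbT.
Qed.

End Trees.

(** * Extension of partial rainbow embeddings *)

Section Partial.
Variables (V W K : finType) (T : sgraph V) (ge : rel W) (cs : {set W} -> K).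
Hypothesis geC : symmetric ge.
Local Notation ad := (adj T).
Local Notation col x y := (cs [set x; y]).
Implicit Types (D : {set V}) (f : V -> W).

Definition edge_colours D f := [set cs (f @: (e : {set V})) | e in iedges T D].

(** Only the values of the total function [f] on [D] are constrained. Colours are read on the
    unordered images [f @: e]. *)
Definition partial D f :=
  [/\ {in D &, injective f},
      (forall x y, x \in D -> y \in D -> ad x y -> ge (f x) (f y)) &
      {in iedges T D &, injective (fun e : {set V} => cs (f @: e))}].

Definition upd f v (x : W) := fun w => if w == v then x else f w.

Lemma upd_out f v x w : w != v -> upd f v x w = f w.
Proof. by rewrite /upd => /negbTE->. Qed.

Lemma upd_in f v x : upd f v x v = x.
Proof. by rewrite /upd eqxx. Qed.

Lemma upd_imset f v x (A : {set V}) : v \notin A -> upd f v x @: A = f @: A.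
Proof.
move=> vA; apply: eq_in_imset => w wA; rewrite upd_out //.
by apply: contraNneq vA => <-.
Qed.

Lemma partial_add D f v x : partial D f -> v \notin D -> x \notin f @: D ->
  (forall u, u \in nbrs T D v -> ge x (f u) && (col x (f u) \notin edge_colours D f)) ->
  {in nbrs T D v &, injective (fun u => col x (f u))} ->
  [/\ partial (v |: D) (upd f v x), upd f v x @: (v |: D) = x |: f @: D &
    edge_colours (v |: D) (upd f v x) = edge_colours D f :|: [set col x (f u) | u in nbrs T D v]].
Proof.
move=> [finj fge finjc] vD xD hx xinj.
have img : upd f v x @: (v |: D) = x |: f @: D.
  by rewrite imsetU1 upd_in upd_imset.
have old e : e \in iedges T D -> upd f v x @: e = f @: e.
  by rewrite inE => /andP[_ eD]; apply: upd_imset; apply: contra vD => /(subsetP eD).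
have new u : u \in nbrs T D v -> upd f v x @: [set v; u] = [set x; f u].
  rewrite inE => /andP[uD _]; rewrite imsetU1 imset_set1 upd_in upd_out //.
  by apply: contraNneq vD => <-.
have ecE : edge_colours (v |: D) (upd f v x) = edge_colours D f :|: [set col x (f u) | u in nbrs T D v].
  rewrite /edge_colours iedges_add // imsetU; congr (_ :|: _).
    by apply: eq_in_imset => e /old->.
  by rewrite -imset_comp; apply: eq_in_imset => u /new /= ->.
split=> //; split.
- move=> y z; rewrite !inE => /orP[/eqP->|yD] /orP[/eqP->|zD] //; rewrite ?upd_in.
  + rewrite upd_out; last by apply: contraNneq vD => <-.
    by move=> e; case/negP: xD; rewrite e; apply: imset_f.
  + rewrite upd_out; last by apply: contraNneq vD => <-.
    by move=> e; case/negP: xD; rewrite -e; apply: imset_f.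
  + by rewrite !upd_out; [exact: finj| |]; apply: contraNneq vD => <-.
- move=> y z; rewrite !inE => /orP[/eqP->|yD] /orP[/eqP->|zD] //; rewrite ?upd_in.
  + by rewrite adj_irr.
  + rewrite upd_out; last by apply: contraNneq vD => <-.
    move=> avz; have zn : z \in nbrs T D v by rewrite inE zD.
    by have /andP[] := hx z zn.
  + rewrite upd_out; last by apply: contraNneq vD => <-.
    rewrite adjC => avz; have yn : y \in nbrs T D v by rewrite inE yD.
    by have /andP[h _] := hx y yn; rewrite geC.
  + by rewrite !upd_out; [exact: fge| |]; apply: contraNneq vD => <-.
move=> e e'; rewrite iedges_add // !inE -!/(iedges T D).
have inI (d : {set V}) : (d \in edges T) && (d \subset D) = (d \in iedges T D) by rewrite inE.
rewrite !inI; case/orP=> [eD|/imsetP[u un ->]] /orP[e'D|/imsetP[u' un' ->]].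
- by rewrite !old //; apply: finjc.
- rewrite old // new // => ee; have /andP[_ /negP[]] := hx u' un'.
  by rewrite -ee; apply: imset_f.
- rewrite new // old // => ee; have /andP[_ /negP[]] := hx u un.
  by rewrite ee; apply: imset_f.
- by rewrite !new // => /(xinj _ _ un un') ->.
Qed.

Definition bare (a : V) (q : seq V) (b : V) :=
  [&& path ad a (rcons q b), uniq (a :: rcons q b) & all (fun v => deg T v == 2) q].

(** Degree two leaves no third neighbour. Hence a bare path can be added vertex by vertex, each new
    vertex meeting only its predecessor and, at the end, [b]. *)
Lemma bare_nbrs a v q b : bare a (v :: q) b -> forall w, ad v w -> w \in [:: a; head b q].
Proof.
case/and3P=> /= /andP[aav pv] /andP[an uq] /andP[/eqP dv _] w avw.
have nx : ad v (head b q) by case: q pv {an uq} => /= [|z q] /andP[].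
have ne : a != head b q.
  apply: contraNneq an => ->; rewrite inE; apply/orP; right.
  by case: q {pv uq nx} => /= [|z q]; rewrite !inE eqxx ?orbT.
apply: contraT => wn; have : #|[set a; head b q; w]| <= 2.
  rewrite -dv; apply: subset_leq_card; apply/subsetP => z; rewrite !inE -orbA.
  by case/or3P=> /eqP->; rewrite ?nx ?avw // adjC.
rewrite -setUA cardsU1 cards2 !inE negb_or ne /=.
by move: wn; rewrite !inE !negb_or => /andP[wa wb]; rewrite eq_sym wa eq_sym wb.
Qed.

Lemma partial_add_path q D f a b p : partial D f -> bare a q b -> q != [::] ->
  a \in D -> b \in D -> {in q, forall v, v \notin D} -> size p = size q ->
  path ge (f a) (rcons p (f b)) -> uniq p -> {in p, forall x, x \notin f @: D} ->
  let cl := pairmap (fun x y => col x y) (f a) (rcons p (f b)) in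
  uniq cl -> {in cl, forall c, c \notin edge_colours D f} ->
  exists f', [/\ partial (D :|: [set v in q]) f', {in D, f' =1 f},
    f' @: (D :|: [set v in q]) = f @: D :|: [set x in p] &
    edge_colours (D :|: [set v in q]) f' = edge_colours D f :|: [set c in cl]].
Proof.
elim: q p D f a => // v q IH [|x p] // D f a pt bq _ aD bD qD [spq] /= /andP[gax gp] /andP[xp up] pD.
case/andP=> cn ucl clD.
have vD : v \notin D by apply: qD; rewrite inE eqxx.
have xD : x \notin f @: D by apply: pD; rewrite inE eqxx.
have va w : w \in D -> ad v w -> w = a \/ q = [::] /\ w = b.
  move=> wD /(bare_nbrs bq); rewrite !inE => /orP[/eqP->|/eqP ew]; first by left.
  case: q ew qD {IH bq spq} => [-> _|z q /= ew qD]; first by right.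
  by have := qD z; rewrite !inE eqxx orbT => /(_ isT); rewrite -ew wD.
have ava : ad v a by case/and3P: bq => /= /andP[+ _] _ _; rewrite adjC.
case: q p spq IH bq qD va gp xp up pD cn ucl clD => [|z q] [|y p] // spq IH bq qD va gp xp up pD cn ucl clD.
  have avb : ad v b by case/and3P: bq => /= /andP[_ /andP[]].
  have nE : nbrs T D v = [set a; b].
    apply/setP => w; rewrite !inE; apply/andP/orP => [[wD avw]|[]/eqP-> //].
    by case: (va w wD avw) => [->|[_ ->]]; rewrite eqxx; [left|right].
  have [||pt' im ec] := @partial_add D f v x pt vD xD.
  - move=> u; rewrite nE !inE => /orP[]/eqP->.
      rewrite geC gax /= setUC; apply: clD; by rewrite inE eqxx.
    move: gp => /= /andP[-> _] /=; apply: clD; by rewrite !inE eqxx orbT.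
  - move: cn; rewrite /= inE => cn u u'; rewrite nE !inE => /orP[]/eqP-> /orP[]/eqP-> //.
      by rewrite [X in cs X]setUC => e; rewrite e eqxx in cn.
    by rewrite [X in _ = cs X]setUC => e; rewrite e eqxx in cn.
  exists (upd f v x); have -> : D :|: [set w in [:: v]] = v |: D.
    by apply/setP => w; rewrite !inE orbC.
  split=> //.
  - by move=> w wD; rewrite upd_out //; apply: contraNneq vD => <-.
  - by rewrite im; apply/setP => w; rewrite !inE orbC.
  rewrite ec nE imsetU1 imset_set1 [X in cs X]setUC; congr (_ :|: _).
  by apply/setP => c; rewrite !inE.
have nE : nbrs T D v = [set a].
  apply/setP => w; rewrite !inE; apply/andP/eqP => [[wD avw]|-> //].
  by case: (va w wD avw) => [//|[]].
have [||pt' im ec] := @partial_add D f v x pt vD xD.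
- move=> u; rewrite nE inE => /eqP->; rewrite geC gax /= setUC; apply: clD; by rewrite inE eqxx.
- by move=> u u'; rewrite nE !inE => /eqP-> /eqP->.
have fb : upd f v x b = f b by rewrite upd_out //; apply: contraNneq vD => <-.
have ec1 : edge_colours (v |: D) (upd f v x) = edge_colours D f :|: [set col (f a) x].
  by rewrite ec nE imset_set1 (setUC [set x]).
have [||||||||||||f' [pt2 ff im2 ec2]] := IH (y :: p) (v |: D) (upd f v x) v.
- by [].
- case/and3P: bq => /= /andP[_ h1] /andP[_ h2] /andP[_ h3]; exact/and3P.
- by [].
- by rewrite !inE eqxx.
- by rewrite !inE bD orbT.
- move=> w wq; rewrite !inE negb_or qD ?andbT; last by rewrite inE wq orbT.
  case/and3P: bq => _ /= /andP[_ /andP[vn _]] _; apply: contraNneq vn => <-.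
  by rewrite -rcons_cons mem_rcons inE wq orbT.
- by [].
- by rewrite upd_in fb.
- by [].
- move=> w wp; rewrite im !inE negb_or pD ?andbT; last by rewrite inE wp orbT.
  by apply: contraNneq xp => <-.
- by rewrite upd_in fb.
- rewrite upd_in fb => c cc; rewrite ec1 in_setU in_set1 negb_or clD /=; last by rewrite inE cc orbT.
  by apply: contraNneq cn => <-.
exists f'; have -> : D :|: [set w in v :: z :: q] = v |: D :|: [set w in z :: q].
  by apply/setP => w; rewrite !inE; case: (w \in D); rewrite ?orbT ?orbF.
split=> //.
- move=> w wD; rewrite ff ?inE ?wD ?orbT // upd_out //; by apply: contraNneq vD => <-.
- by rewrite im2 im; apply/setP => w; rewrite !inE; case: (w \in f @: D); rewrite ?orbT ?orbF.
rewrite ec2 upd_in fb ec1; apply/setP => c; rewrite !inE.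
by case: (c \in edge_colours D f); rewrite ?orbT //=.
Qed.

End Partial.

Lemma leq_card_setD (U : finType) (A B : {set U}) m l : #|A :&: B| <= m -> m + l <= #|A| -> l <= #|A :\: B|.
Proof. by rewrite -(cardsID B A) => h1 h2; rewrite -(leq_add2l m) (leq_trans h2) // leq_add2r. Qed.

(** * Greedy embedding of the forest, with rescue through the reserve *)

Section Embedding.
Variables (V : finType) (T : sgraph V) (n : nat) (K : finType).
Local Notation W := 'I_n.
Variables (nb hb : rel W) (cs : {set W} -> K).
Hypotheses (nbC : symmetric nb) (hbC : symmetric hb).
Local Notation col := (fun x y : W => cs [set x; y]).
Local Notation ge := (joined nb hb).
Local Notation ad := (adj T).
Local Notation partial := (partial T ge cs).
Local Notation ecols := (edge_colours T cs).

Lemma geC : symmetric ge.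
Proof. by move=> x y; rewrite /joined /= nbC hbC. Qed.

Section Greedy.
Variables (s : seq V) (F D0 : {set V}) (f0 : V -> W) (U0 V' : {set W}) (G0 C' : {set K}).
Variables (d l0 X M Mj : nat).
Hypotheses (us : uniq s) (sV : forall x, x \in s).
Hypothesis os : forall s1 v s2, s = s1 ++ v :: s2 -> count (ad v) s1 <= 1.
Hypothesis dT : forall v, deg T v <= d.
Hypothesis FD0 : [disjoint F & D0].
Hypothesis D0F : forall x y, x \in D0 -> y \in D0 :|: F -> ~~ ad x y.
Hypothesis f0inj : {in D0 &, injective f0}.
Hypothesis U0f : [disjoint U0 & f0 @: D0].
Hypothesis V'f : [disjoint V' & f0 @: D0].
Hypothesis U0V' : [disjoint U0 & V'].
Hypothesis G0C' : [disjoint G0 & C'].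
Hypothesis cU : #|F| + l0 <= #|U0|.
Hypothesis cG : #|iedges T F| + l0 <= #|G0|.
Hypothesis l0n : n <= l0 * Mj.
Hypothesis n0 : 0 < n.
Hypothesis L : Lprop nb col V' C' M.
Hypothesis J : Jprop hb col Mj.
Hypothesis Xn : X * M <= n.
Hypothesis dX : d * n <= X * Mj.

Let Fs (s1 : seq V) := [set x in s1 | x \in F].

Lemma iedges_isolated (A : {set V}) : A \subset F -> iedges T (D0 :|: A) = iedges T A.
Proof.
move=> AF; apply/setP => e; rewrite !inE; case eT: (e \in edges T) => //=.
have [x [y [-> xy axy]]] := edgeP eT.
have sub z : z \in A -> z \in D0 :|: F by move=> /(subsetP AF) zF; rewrite inE zF orbT.
rewrite !subUset !sub1set !inE; apply/andP/andP => [[]|[-> ->]]; last by rewrite !orbT.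
case/orP=> [xD|xA] /orP[yD|yA] //.
- by have := D0F xD (_ : y \in D0 :|: F); rewrite inE yD axy => /(_ isT).
- by have := D0F xD (sub _ yA); rewrite axy.
- by have := D0F yD (sub _ xA); rewrite adjC axy.
Qed.

Definition greedy_inv (s1 : seq V) f (Bd Rs : {set V}) :=
  let D := D0 :|: Fs s1 in
  [/\ partial D f, {in D0, f =1 f0}, f @: Fs s1 \subset U0 :|: V',
      ecols D f \subset G0 :|: C' &
  [/\ (Bd \subset Fs s1) && (Rs \subset Fs s1), (forall w, w \in Fs s1 -> f w \in V' -> w \in Rs),
      (forall w, w \in Rs -> exists2 u, u \in Bd & ad u w), #|ecols D f :&: C'| <= #|Rs| &
      forall u x, u \in Bd -> x \in U0 :\: f @: D -> hb (f u) x -> col (f u) x \notin G0 :\: ecols D f]].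

Let Fs_sub s1 : Fs s1 \subset F.
Proof. by apply/subsetP => x; rewrite inE => /andP[]. Qed.

Let iFs s1 : #|iedges T (Fs s1)| <= #|iedges T F|.
Proof.
apply: subset_leq_card; apply/subsetP => e; rewrite !inE => /andP[-> eF] /=.
exact: subset_trans eF (Fs_sub s1).
Qed.

Let pool_card s1 f Bd Rs : greedy_inv s1 f Bd Rs ->
  l0 <= #|U0 :\: f @: (D0 :|: Fs s1)| /\ l0 <= #|G0 :\: ecols (D0 :|: Fs s1) f|.
Proof.
move=> [pt ff _ _ _]; split.
  apply: leq_card_setD cU.
    apply: leq_trans (_ : #|f @: Fs s1| <= _); last first.
      exact: leq_trans (leq_imset_card _ _) (subset_leq_card (Fs_sub s1)).
    apply: subset_leq_card; rewrite imsetU (eq_in_imset ff) setIUr.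
    by rewrite (disjoint_setI0 U0f) set0U subsetIr.
apply: leq_card_setD cG.
  apply: leq_trans (subset_leq_card (subsetIr _ _)) _.
  apply: leq_trans (leq_imset_card _ _) _; rewrite iedges_isolated //; exact: iFs.
Qed.

Let rescue_card s1 f Bd Rs : greedy_inv s1 f Bd Rs -> #|Rs| <= X.
Proof.
move=> inv; have [pU pG] := pool_card inv; case: inv => pt ff _ _ [/andP[BF _] _ RB _ noe].
have Bn : #|Bd| * Mj < n.
  rewrite ltnNge; apply/negP => h.
  have cB : #|f @: Bd| = #|Bd|.
    apply: card_in_imset => x y xB yB; case: pt => inj _ _; apply: inj.
      by rewrite inE (subsetP BF) ?orbT.
    by rewrite inE (subsetP BF) ?orbT.
  have l0M c : l0 <= c -> n <= c * Mj by move=> lc; apply: leq_trans l0n _; rewrite leq_mul2r lc orbT.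
  have [|a [b [/imsetP[u uB ->] bU _ hab cab]]] := J _ (l0M _ pU) (l0M _ pG) (A := f @: Bd).
    by rewrite cB.
  by have := noe u b uB bU hab; rewrite cab.
have : #|Rs| <= #|Bd| * d.
  apply: leq_trans (_ : #|\bigcup_(u in Bd) [set w | ad u w]| <= _).
    apply: subset_leq_card; apply/subsetP => w /RB[u uB uw].
    by apply/bigcupP; exists u => //; rewrite inE.
  rewrite -sum_nat_const; elim/big_rec2: _ => [|u a A uB IH]; first by rewrite cards0.
  have [+ _] := leq_card_setU [set w | ad u w] A.
  by have := dT u; rewrite /deg; move: IH; clear; lia.
move=> RB'; rewrite leqNgt; apply/negP => XR.
have h1 : X < #|Bd| * d by apply: leq_trans XR RB'.
have := leq_mul h1 (leqnn Mj); rewrite -mulnA (mulnC d) mulnA mulSn => h2.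
have Mj0 : 0 < Mj by case: (Mj) l0n => //; rewrite muln0; move: n0; clear; lia.
have := leq_mul (ltnW Bn) (leqnn d); rewrite (mulnC n).
by move: h2 dX Mj0; clear; lia.
Qed.

Lemma greedy_step s1 v s2 f Bd Rs : s = s1 ++ v :: s2 -> greedy_inv s1 f Bd Rs ->
  exists f' Bd' Rs', greedy_inv (rcons s1 v) f' Bd' Rs'.
Proof.
move=> es inv; have vs1 : v \notin s1.
  by move: us; rewrite es cat_uniq /= negb_or => /and3P[_ /andP[]].
case: (boolP (v \in F)) => vF; last first.
  exists f, Bd, Rs; rewrite /greedy_inv.
  have -> // : Fs (rcons s1 v) = Fs s1.
  apply/setP => x; rewrite !inE mem_rcons inE; case: eqP => // ->.
  by rewrite (negbTE vF) !andbF.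
have FE : Fs (rcons s1 v) = v |: Fs s1.
  by apply/setP => x; rewrite !inE mem_rcons inE; case: eqP => // ->; rewrite vF.
have [pU pG] := pool_card inv; have RX := rescue_card inv.
case: (inv) => pt ff fU eG [/andP[BF RF] fV RB cR noe].
pose D := D0 :|: Fs s1; have DE : D0 :|: Fs (rcons s1 v) = v |: D.
  by rewrite FE /D setUCA.
have vD : v \notin D by rewrite !inE (negbTE vs1) orbF (disjointFr FD0 vF).
have iD : f @: D = f0 @: D0 :|: f @: Fs s1 by rewrite imsetU (eq_in_imset ff).
have nbF u : u \in nbrs T D v -> u \in Fs s1.
  rewrite in_set => /andP[]; rewrite [u \in D]in_setU => /orP[uD|//] avu.
  by have := D0F uD (_ : v \in D0 :|: F); rewrite inE vF orbT adjC avu => /(_ isT).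
have nb1 u u' : u \in nbrs T D v -> u' \in nbrs T D v -> u = u'.
  move=> un un'; have := os es; rewrite -size_filter.
  have [a1 a2] : ad v u /\ ad v u' by move: un un'; rewrite !inE => /andP[_ ->] /andP[_ ->].
  have := nbF _ un; have := nbF _ un'; rewrite !inE => /andP[u's _] /andP[us' _].
  have i1 : u \in filter (ad v) s1 by rewrite mem_filter a1.
  have i2 : u' \in filter (ad v) s1 by rewrite mem_filter a2.
  case: (filter (ad v) s1) i1 i2 => [|a [|b l]] //.
  by rewrite !inE => /eqP-> /eqP->.
(* The part common to the three cases below, [x] being the image of [v]: no placed neighbour, a
   random edge from it into the pool, or a stuck neighbour. *)
have ext x (Bd' Rs' : {set V}) : x \notin f @: D -> x \in U0 :|: V' ->
    (forall u, u \in nbrs T D v -> [/\ ge x (f u), col x (f u) \notin ecols D f & col x (f u) \in G0 :|: C']) ->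
    Bd' \subset Fs s1 -> Rs' \subset v |: Fs s1 -> Rs \subset Rs' -> (x \in V' -> v \in Rs') ->
    (forall w, w \in Rs' -> exists2 u, u \in Bd' & ad u w) ->
    #|ecols D f :&: C'| + #|[set col x (f u) | u in nbrs T D v] :&: C'| <= #|Rs'| ->
    (forall u y, u \in Bd' -> y \in U0 :\: f @: D -> hb (f u) y -> col (f u) y \notin G0 :\: ecols D f) ->
    exists f' Bd' Rs', greedy_inv (rcons s1 v) f' Bd' Rs'.
  move=> xD xU hx BF' RF' RR' xV RB' cR' noe'.
  have [||pt' im ec] := @partial_add _ _ _ _ _ _ geC D f v x pt vD xD.
  - by move=> u /hx[-> ->].
  - by move=> u u' un un' _; apply: nb1.
  have uo w : w \in D -> upd f v x w = f w.
    by move=> wD; rewrite upd_out //; apply: contraNneq vD => <-.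
  have uF w : w \in Fs s1 -> upd f v x w = f w by move=> wF; apply: uo; rewrite inE wF orbT.
  exists (upd f v x), Bd', Rs'; rewrite /greedy_inv DE FE; split=> //.
  - by move=> w wD; rewrite uo ?ff // inE wD.
  - rewrite imsetU1 upd_in subUset sub1set xU (eq_in_imset uF) //.
  - rewrite ec subUset eG; apply/subsetP => c /imsetP[u un ->]; by have [] := hx u un.
  split.
  - by rewrite RF' andbT; apply: subset_trans BF' _; apply: subsetUr.
  - move=> w; rewrite !inE => /orP[/eqP->|/andP[ws wF]]; first by rewrite upd_in.
    have wFs : w \in Fs s1 by rewrite inE ws.
    by rewrite uF // => /(fV _ wFs) /(subsetP RR').
  - exact: RB'.
  - rewrite ec setIUl; apply: leq_trans cR'; by have [] := leq_card_setU (ecols D f :&: C') ([set col x (f u) | u in nbrs T D v] :&: C').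
  move=> u y uB; rewrite im ec in_setD in_setU1 negb_or => /andP[/andP[yx yD] yU].
  rewrite uF ?(subsetP BF') // => hu.
  have := noe' u y uB (_ : y \in U0 :\: f @: D) hu; rewrite in_setD yD yU => /(_ isT).
  by apply: contra; rewrite !in_setD in_setU negb_or => /andP[/andP[-> _] ->].
case: (set_0Vmem (nbrs T D v)) => [n0'|[u un]].
  have /card_gt0P[x] : 0 < #|U0 :\: f @: D|.
    apply: leq_trans pU; case: (l0) l0n => //; rewrite mul0n; move: n0; clear; lia.
  rewrite in_setD => /andP[xD xU].
  apply: (ext x Bd Rs) => //.
  - by rewrite inE xU.
  - by move=> u; rewrite n0' inE.
  - by apply: subset_trans RF _; apply: subsetUr.
  - by move=> xV; rewrite (disjointFr U0V' xU) in xV.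
  - by rewrite n0' imset0 set0I cards0 addn0.
have nE : nbrs T D v = [set u].
  by apply/setP => w; rewrite inE; apply/idP/eqP => [wn|-> //]; apply: nb1.
have uFs := nbF _ un.
case: (boolP [exists x in U0 :\: f @: D, hb (f u) x && (col (f u) x \in G0 :\: ecols D f)]).
  case/exists_inP=> x; rewrite in_setD => /andP[xD xU] /andP[hux]; rewrite in_setD => /andP[cD cG0].
  have cC : col (f u) x \notin C' by rewrite (disjointFr G0C' cG0).
  apply: (ext x Bd Rs) => //.
  - by rewrite inE xU.
  - move=> u'; rewrite nE inE => /eqP->; rewrite /joined /= (hbC x) hux orbT setUC; split=> //.
    by rewrite inE cG0.
  - by apply: subset_trans RF _; apply: subsetUr.
  - by move=> xV; rewrite (disjointFr U0V' xU) in xV.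
  - rewrite nE imset_set1 setUC (_ : [set _] :&: C' = set0) ?cards0 ?addn0 //.
    by apply/setP => c; rewrite !inE; case: eqP => // ->; rewrite (negbTE cC).
rewrite negb_exists => /forallP none.
(* The reserve has lost at most [#|Rs| <= X] vertices and as many colours, few enough to be
   forbidden in [L]. *)
have cV : #|V' :&: f @: D| * M <= n.
  apply: leq_trans Xn; rewrite leq_mul2r; apply/orP; right; apply: leq_trans RX.
  rewrite iD setIUr (disjoint_setI0 V'f) set0U.
  apply: leq_trans (_ : #|f @: Rs| <= _); last exact: leq_imset_card.
  apply: subset_leq_card; apply/subsetP => x; rewrite inE => /andP[xV /imsetP[w wF xw]].
  by apply/imsetP; exists w => //; apply: fV => //; rewrite -xw.
have cC : #|ecols D f :&: C'| * M <= n.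
  by apply: leq_trans Xn; rewrite leq_mul2r (leq_trans cR RX) orbT.
have [r] := L (f u) cV cC; rewrite in_setD in_setI => /andP[+ rV].
rewrite rV /= => rD /andP[nr]; rewrite in_setD in_setI => /andP[+ cr]; rewrite cr andbT => cD.
apply: (ext r (u |: Bd) (v |: Rs)) => //.
- by rewrite inE rV orbT.
- move=> u'; rewrite nE inE => /eqP->; rewrite /joined /= (nbC r) nr setUC; split=> //.
  by rewrite inE cr orbT.
- by rewrite subUset sub1set uFs BF.
- by rewrite setUS.
- exact: subsetUr.
- by rewrite !inE eqxx.
- move=> w; rewrite !inE => /orP[/eqP->|wR].
    by exists u; rewrite ?inE ?eqxx // adjC; move: un; rewrite inE => /andP[].
  by have [u' u'B ?] := RB w wR; exists u' => //; rewrite inE u'B orbT.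
- have vR : v \notin Rs.
    by apply/negP => /(subsetP RF); rewrite inE (negbTE vs1).
  rewrite nE imset_set1 cardsU1 vR /= [1 + _]addnC leq_add //.
  by rewrite -(cards1 (col r (f u))) subset_leq_card // subsetIl.
move=> u' y; rewrite in_setU1 => /orP[/eqP->|u'B]; last exact: noe.
move=> yU hy; have := none y; rewrite yU hy /=.
by [].
Qed.

(* The tree is embedded vertex by vertex, along random edges into the pool; a vertex whose parent is stuck is rescued through the reserve. *)
Lemma greedy_forest : exists f, [/\ partial (D0 :|: F) f, {in D0, f =1 f0}, f @: F \subset U0 :|: V',
  ecols (D0 :|: F) f \subset G0 :|: C' & #|f @: F :&: V'| <= X /\ #|ecols (D0 :|: F) f :&: C'| <= X].
Proof.
have pre s1 s2 : s = s1 ++ s2 -> exists f Bd Rs, greedy_inv s1 f Bd Rs.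
  elim/last_ind: s1 s2 => [|s1 v IH] s2 es.
    have FE : Fs [::] = set0 by apply/setP => x; rewrite !inE.
    exists f0, set0, set0; rewrite /greedy_inv FE setU0 imset0 !sub0set.
    have i0 : iedges T D0 = set0.
      apply/setP => e; rewrite !inE; apply/negbTE/negP => /andP[eT].
      have [x [y [-> xy axy]]] := edgeP eT; rewrite subUset !sub1set => /andP[xD yD].
      by have := D0F xD (_ : y \in D0 :|: F); rewrite inE yD axy => /(_ isT).
    have e0 : ecols D0 f0 = set0 by rewrite /edge_colours i0 imset0.
    rewrite e0 set0I cards0 sub0set; split=> //; last by split=> // w; rewrite inE.
    split=> //; first by move=> x y xD yD axy; have := D0F xD (_ : y \in D0 :|: F); rewrite inE yD axy => /(_ isT).
    by move=> e e'; rewrite i0 inE.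
  rewrite cat_rcons in es; have [f [Bd [Rs inv]]] := IH _ es.
  exact: greedy_step es inv.
have [f [Bd [Rs inv]]] := pre s [::] (esym (cats0 s)).
have FE : Fs s = F by apply/setP => x; rewrite !inE sV.
have RX := rescue_card inv; case: inv; rewrite FE => pt ff fU eG [_ fV _ cR _].
exists f; split=> //; split; last exact: leq_trans cR RX.
apply: leq_trans RX; apply: leq_trans (leq_imset_card f Rs).
apply: subset_leq_card; apply/subsetP => x; rewrite inE => /andP[/imsetP[w wF ->] xV].
by apply/imsetP; exists w => //; apply: fV.
Qed.

End Greedy.
End Embedding.

(** * Systems of disjoint bare paths *)

Section PathSystems.
Variables (V : finType) (T : sgraph V) (I : eqType) (pa pb : I -> V) (pq : I -> seq V).
Local Notation ad := (adj T).

Implicit Types (D : {set V}) (l : seq I).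

Definition path_dom (D : {set V}) (l : seq I) := [set x | (x \in D) || has (fun i => x \in pq i) l].

Definition path_system (D : {set V}) (l : seq I) :=
  [/\ uniq l,
   forall i, i \in l -> [/\ bare T (pa i) (pq i) (pb i), pq i != [::], pa i \in D, pb i \in D &
     {in pq i, forall v, v \notin D}] &
   forall i j v, i \in l -> j \in l -> v \in pq i -> v \in pq j -> i = j].

Lemma path_dom_cons D i l : path_dom D (i :: l) = path_dom (D :|: [set v in pq i]) l.
Proof. by apply/setP => x; rewrite !inE /= orbA. Qed.

Lemma path_dom0 D : path_dom D [::] = D.
Proof. by apply/setP => x; rewrite inE orbF. Qed.

Lemma path_system_cons D i l : path_system D (i :: l) ->
  [/\ bare T (pa i) (pq i) (pb i), pq i != [::], pa i \in D, pb i \in D &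
     {in pq i, forall v, v \notin D}] /\ path_system (D :|: [set v in pq i]) l.
Proof.
case=> /= /andP[il ul] h1 h2; split; first by apply: h1; rewrite inE eqxx.
split=> //; last by move=> j k v jl kl; apply: h2; rewrite inE ?jl ?kl orbT.
move=> j jl; have [|? ? aD bD qD] := h1 j; first by rewrite inE jl orbT.
split=> //; rewrite ?inE ?aD ?bD // => v vq; rewrite !inE negb_or qD //=.
by apply: contra il => vi; rewrite (h2 i j v) // !inE ?eqxx ?jl ?orbT.
Qed.

Lemma bare_uniq a q b : bare T a q b -> uniq q.
Proof. by case/and3P=> _ /= /andP[_ +] _; rewrite rcons_uniq => /andP[]. Qed.

Lemma card_path_dom D l : path_system D l -> #|path_dom D l| = #|D| + sumn [seq size (pq i) | i <- l].
Proof.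
elim: l D => [|i l IH] D; first by rewrite path_dom0 /= addn0.
move=> /path_system_cons[[bi _ _ _ qD] /IH]; rewrite path_dom_cons => -> /=.
rewrite addnA cardsU disjoint_setI0 ?cards0 ?subn0 ?cardsE ?(card_uniqP (bare_uniq bi)) //.
by rewrite disjoint_sym disjoint_subset; apply/subsetP => v; rewrite !inE => /qD.
Qed.

Lemma card_iedges_path q D a b : bare T a q b -> q != [::] -> a \in D -> b \in D ->
  {in q, forall v, v \notin D} -> #|iedges T (D :|: [set v in q])| = #|iedges T D| + (size q).+1.
Proof.
elim: q D a => // v q IH D a bq _ aD bD qD.
have vD : v \notin D by apply: qD; rewrite inE eqxx.
have va w : w \in D -> ad v w -> w = a \/ q = [::] /\ w = b.
  move=> wD /(bare_nbrs bq); rewrite !inE => /orP[/eqP->|/eqP ew]; first by left.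
  case: q ew qD {IH bq} => [-> _|z q /= ew qD]; first by right.
  by have := qD z; rewrite !inE eqxx orbT => /(_ isT); rewrite -ew wD.
have ava : ad v a by case/and3P: bq => /= /andP[+ _] _ _; rewrite adjC.
have -> : D :|: [set w in v :: q] = v |: D :|: [set w in q].
  by apply/setP => w; rewrite !inE; case: (w \in D); rewrite ?orbT ?orbF.
case: q IH bq qD va => [|z q] IH bq qD va.
  have avb : ad v b by case/and3P: bq => /= /andP[_ /andP[]].
  have nE : nbrs T D v = [set a; b].
    apply/setP => w; rewrite !inE; apply/andP/orP => [[wD avw]|[]/eqP-> //].
    by case: (va w wD avw) => [->|[_ ->]]; rewrite eqxx; [left|right].
  have ab : a != b.
    by case/and3P: bq => _ /= /andP[+ _] _; rewrite !inE negb_or => /andP[].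
  have -> : v |: D :|: [set w in [::]] = v |: D by apply/setP => w; rewrite !inE orbF.
  by rewrite card_iedges_add // nE cards2 ab.
have nE : nbrs T D v = [set a].
  apply/setP => w; rewrite !inE; apply/andP/eqP => [[wD avw]|-> //].
  by case: (va w wD avw) => [//|[]].
rewrite (IH (v |: D) v) ?inE ?eqxx ?bD ?orbT //.
- by rewrite card_iedges_add // nE cards1 /= -addnA.
- case/and3P: bq => /= /andP[_ h1] /andP[_ h2] /andP[_ h3]; exact/and3P.
move=> w wq; rewrite !inE negb_or qD ?andbT; last by rewrite inE wq orbT.
case/and3P: bq => _ /= /andP[_ /andP[vn _]] _; apply: contraNneq vn => <-.
by rewrite -rcons_cons mem_rcons inE wq orbT.
Qed.

Lemma card_iedges_paths D l : path_system D l ->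
  #|iedges T (path_dom D l)| = #|iedges T D| + sumn [seq (size (pq i)).+1 | i <- l].
Proof.
elim: l D => [|i l IH] D; first by rewrite path_dom0 /= addn0.
move=> /path_system_cons[[bi qi aD bD qD] /IH]; rewrite path_dom_cons => -> /=.
by rewrite (card_iedges_path bi) // addnA.
Qed.

Variables (W K : finType) (ge : rel W) (cs : {set W} -> K).
Hypothesis geC : symmetric ge.
Local Notation partial := (partial T ge cs).
Local Notation ecols := (edge_colours T cs).

Lemma partial_add_paths (pp : I -> seq W) (l : seq I) D f : partial D f -> path_system D l ->
  let cl i := pairmap (fun x y => cs [set x; y]) (f (pa i)) (rcons (pp i) (f (pb i))) in
  (forall i, i \in l -> [/\ size (pp i) = size (pq i), path ge (f (pa i)) (rcons (pp i) (f (pb i))),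
     uniq (pp i) & {in pp i, forall x, x \notin f @: D}]) ->
  (forall i j x, i \in l -> j \in l -> x \in pp i -> x \in pp j -> i = j) ->
  (forall i, i \in l -> uniq (cl i) /\ {in cl i, forall c, c \notin ecols D f}) ->
  (forall i j c, i \in l -> j \in l -> c \in cl i -> c \in cl j -> i = j) ->
  exists2 f', partial (path_dom D l) f' & {in D, f' =1 f}.
Proof.
elim: l D f => [|i l IH] D f pt ps cl hp dp hc dc; first by exists f; rewrite ?path_dom0.
have [[bi qi aD bD qD] ps'] := path_system_cons ps.
have il : i \in i :: l by rewrite inE eqxx.
have sl j : j \in l -> j \in i :: l by rewrite inE => ->; rewrite orbT.
have iNl : i \notin l by case: ps => /= /andP[].
have [sp gp up pD] := hp i il; have [uc cD] := hc i il.
have [f1 [pt1 ff im ec]] := partial_add_path geC pt bi qi aD bD qD sp gp up pD uc cD.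
have fab j : j \in l -> f1 (pa j) = f (pa j) /\ f1 (pb j) = f (pb j).
  by move=> jl; case: ps => _ /(_ _ (sl _ jl))[_ _ aj bj _] _; rewrite !ff.
have [||||f2 pt2 ff2] := IH _ _ pt1 ps'.
- move=> j jl; have [-> ->] := fab j jl; have [? ? ? pjD] := hp j (sl _ jl); split=> // x xp.
  rewrite im in_setU negb_or pjD //= inE; apply: contra iNl => xi.
  by have -> : i = j by apply: (dp i j x) => //; apply: sl.
- by move=> j k x jl kl; apply: dp; apply: sl.
- move=> j jl; have [-> ->] := fab j jl; have [? cjD] := hc j (sl _ jl); split=> // c cc.
  rewrite ec in_setU negb_or cjD //= inE; apply: contra iNl => ci.
  by have -> : i = j by apply: (dc i j c) => //; apply: sl.
- move=> j k c jl kl; have [-> ->] := fab j jl; have [-> ->] := fab k kl.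
  by apply: dc; apply: sl.
exists f2; first by rewrite path_dom_cons.
by move=> x xD; rewrite ff2 ?ff // inE xD.
Qed.

End PathSystems.

(** * Filling the holes *)

Section Holes.
Variables (V : finType) (T : sgraph V) (n : nat) (K : finType).
Local Notation W := 'I_n.
Variables (nb hb : rel W) (cs : {set W} -> K).
Hypotheses (nbC : symmetric nb) (hbC : symmetric hb).
Local Notation col := (fun x y : W => cs [set x; y]).
Local Notation ge := (joined nb hb).
Local Notation partial := (partial T ge cs).
Local Notation ecols := (edge_colours T cs).
Variables (V' : {set W}) (C' : {set K}) (M Mj : nat).
Hypotheses (M0 : 0 < M) (Mn : 4 * M <= n) (MMj : 8 * M <= Mj).
Hypotheses (L : Lprop nb col V' C' M) (J : Jprop hb col Mj) (Cn : n <= #|C'| * M).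

Let colC x y : col x y = col y x.
Proof. by rewrite /= setUC. Qed.

Let budget (U : finType) (A : {set U}) (a : seq U) k : (#|A| + k) * (4 * M) <= n -> size a <= k ->
  #|A :|: [set x in a]| * (4 * M) <= n.
Proof.
move=> h ak; apply: leq_trans h; rewrite leq_mul2r; apply/orP; right.
have [h1 _] := leq_card_setU A [set x in a]; apply: leq_trans h1 _; rewrite leq_add2l.
by apply: leq_trans ak; rewrite cardsE card_size.
Qed.

(** The inner vertices become [r1 r2 x y r3 r4]: a connector from [f a] to [x], the middle edge, a
    connector from [y] to [f b]. The second connector must also avoid [x, y, r1, r2] and four
    colours, whence the [4] in the budgets. *)
Lemma fill_hole D f a q b x y : partial D f -> bare T a q b -> size q = 6 ->
  a \in D -> b \in D -> {in q, forall v, v \notin D} ->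
  x \notin f @: D -> y \notin f @: D -> x != y -> nb x y -> col x y \notin ecols D f ->
  (#|V' :&: f @: D| + 4) * (4 * M) <= n -> (#|C' :&: ecols D f| + 4) * (4 * M) <= n ->
  exists f' r k, [/\ partial (D :|: [set v in q]) f', {in D, f' =1 f},
     f' @: (D :|: [set v in q]) = f @: D :|: (x |: (y |: [set z in r])),
     ecols (D :|: [set v in q]) f' = ecols D f :|: (col x y |: [set c in k]) &
     [/\ size r = 4, size k = 6, {subset r <= V'} & {subset k <= C'}]].
Proof.
move=> pt bq sq aD bD qD xD yD xy nxy cD hV hC.
set Q := V' :&: f @: D in hV; set G := C' :&: ecols D f in hC.
have hQ1 := budget hV (isT : size [:: x; y] <= 4).
have hG1 := budget hC (isT : size [:: col x y] <= 4).
have [r1 [r2 [r1V r2V r12 /and3P[e1 e2 e3] [uk1 k1C]]]] := connector nbC colC (f a) x M0 Mn MMj L J Cn hQ1 hG1.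
set k1 := [:: _; _; _] in uk1 k1C.
have hQ2 := budget hV (isT : size [:: x; y; r1; r2] <= 4).
have hG2 := budget hC (isT : size (col x y :: k1) <= 4).
have [r3 [r4 [r3V r4V r34 /and3P[e4 e5 e6] [uk2 k2C]]]] := connector nbC colC y (f b) M0 Mn MMj L J Cn hQ2 hG2.
set k2 := [:: _; _; _] in uk2 k2C.
have inV r (l : seq W) : r \in V' :\: (Q :|: [set z in l]) -> [/\ r \in V', r \notin f @: D & r \notin l].
  by rewrite in_setD in_setU in_setI negb_or => /andP[/andP[+ +] rV]; rewrite rV inE.
have inC c (l : seq K) : c \in C' :\: (G :|: [set z in l]) -> [/\ c \in C', c \notin ecols D f & c \notin l].
  by rewrite in_setD in_setU in_setI negb_or => /andP[/andP[+ +] rV]; rewrite rV inE.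
have [v1 d1 o1] := inV _ _ r1V; have [v2 d2 o2] := inV _ _ r2V.
have [v3 d3 o3] := inV _ _ r3V; have [v4 d4 o4] := inV _ _ r4V.
pose p := [:: r1; r2; x; y; r3; r4].
have clE : pairmap (fun x y => col x y) (f a) (rcons p (f b)) = k1 ++ col x y :: k2 by [].
have gp : path ge (f a) (rcons p (f b)).
  by rewrite /= /joined /= e1 e2 e3 nxy e4 e5 e6 !orbT.
have up : uniq p.
  move: o1 o2 o3 o4; rewrite /= !inE !negb_or => /andP[-> ->] /andP[-> ->].
  move=> /and4P[a1 a2 a3 a4] /and4P[b1 b2 b3 b4].
  by rewrite r12 xy r34 (eq_sym r1 r3) (eq_sym r1 r4) (eq_sym r2 r3) (eq_sym r2 r4)
    (eq_sym x r3) (eq_sym x r4) (eq_sym y r3) (eq_sym y r4) a1 a2 a3 a4 b1 b2 b3 b4.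
have pD : {in p, forall z, z \notin f @: D}.
  by move=> z; rewrite !inE => /or4P[/eqP->|/eqP->|/eqP->|/or3P[/eqP->|/eqP->|/eqP->]].
have uc : uniq (k1 ++ col x y :: k2).
  rewrite cat_uniq uk1 andTb cons_uniq uk2 andbT; apply/andP; split.
    apply/hasPn => c; rewrite inE => /orP[/eqP->|/k2C /inC[_ _]]; last first.
      by rewrite inE negb_or => /andP[].
    by apply/negP => /k1C /inC[_ _]; rewrite inE eqxx.
  by apply/negP => /k2C /inC[_ _]; rewrite inE eqxx.
have ccD : {in k1 ++ col x y :: k2, forall c, c \notin ecols D f}.
  by move=> c; rewrite mem_cat inE => /or3P[/k1C /inC[]|/eqP->|/k2C /inC[]].
have q0 : q != [::] by case: (q) sq.
have [f' [pt' ff im ec]] := partial_add_path (geC nbC hbC) pt bq q0 aD bD qD (esym sq : size p = size q) gp up pD uc ccD.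
exists f', [:: r1; r2; r3; r4], (k1 ++ k2); split=> //.
- rewrite im; congr (_ :|: _); apply/setP => z; rewrite !inE.
  by case: (z == r1); case: (z == r2); case: (z == x); case: (z == y); rewrite ?orbT.
- have -> : ecols (D :|: [set v in q]) f' = ecols D f :|: [set c in k1 ++ col x y :: k2] by [].
  congr (_ :|: _); apply/setP => c; rewrite in_setU1 !in_set !mem_cat [c \in cs [set x; y] :: k2]in_cons.
  by case: (c \in k1); rewrite ?orbT.
split=> //; first by move=> z; rewrite !inE => /or4P[] /eqP->.
by move=> c; rewrite mem_cat => /orP[/k1C|/k2C] /inC[].
Qed.

Hypothesis Ed : forall c (Q : {set W}), #|Q| * M <= n ->
  exists x y, [/\ x \in V' :\: Q, y \in V' :\: Q, x != y, nb x y & col x y = c].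

(* The three kinds of middle edges: through a leftover vertex, of a leftover colour, or a filler inside the reserve. *)
Lemma middle_edge (D : {set V}) (f : V -> W) (l : nat) (Lv : seq W) (Lc : seq K) (a : W) : uniq Lv -> uniq Lc ->
  {in Lv, forall x, (x \notin f @: D) && (x \notin V')} ->
  {in Lc, forall c, (c \notin ecols D f) && (c \notin C')} ->
  size Lv + size Lc <= l.+1 ->
  (#|V' :&: f @: D| + 1) * (4 * M) <= n -> #|C' :&: ecols D f| * M <= n ->
  exists x y Lv' Lc', [/\ x \notin f @: D, y \notin f @: D, x != y, nb x y & col x y \notin ecols D f] /\
  [/\ [/\ x \in [set z in Lv] :|: V', y \in V' & col x y \in [set c in Lc] :|: C'],
    [/\ uniq Lv', {subset Lv' <= Lv}, x \notin Lv' & {in Lv, forall z, (z == x) || (z \in Lv')}],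
    [/\ uniq Lc', {subset Lc' <= Lc}, col x y \notin Lc' & {in Lc, forall c, (c == col x y) || (c \in Lc')}] &
    size Lv' + size Lc' <= l].
Proof.
move=> uL uLc hL hLc sl hV hC.
have le4 k : k * (4 * M) <= n -> k * M <= n.
  by apply: leq_trans; rewrite leq_mul2l leq_pmull ?orbT.
have hV1 : #|V' :&: f @: D| * M <= n.
  by apply: le4; apply: leq_trans hV; rewrite leq_mul2r leq_addr orbT.
have lp b (Q : {set W}) : #|V' :&: f @: D :|: Q| * M <= n -> exists r,
    [/\ r \in V', r \notin f @: D, r \notin Q, nb b r & col b r \in C' /\ col b r \notin ecols D f].
  move=> hQ; have [r] := L b hQ hC; rewrite in_setD in_setU in_setI negb_or => /andP[/andP[+ rQ] rV].
  rewrite rV /= => rD /andP[nr]; rewrite in_setD in_setI => /andP[+ cC]; rewrite cC /= => cD.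
  by exists r.
have vertex v Lv' : (v \in V') || (v \in Lv) -> v \notin f @: D -> uniq Lv' -> {subset Lv' <= Lv} ->
    v \notin Lv' -> {in Lv, forall z, (z == v) || (z \in Lv')} -> size Lv' + size Lc <= l ->
    exists x y Lv' Lc', [/\ x \notin f @: D, y \notin f @: D, x != y, nb x y & col x y \notin ecols D f] /\
  [/\ [/\ x \in [set z in Lv] :|: V', y \in V' & col x y \in [set c in Lc] :|: C'],
    [/\ uniq Lv', {subset Lv' <= Lv}, x \notin Lv' & {in Lv, forall z, (z == x) || (z \in Lv')}],
    [/\ uniq Lc', {subset Lc' <= Lc}, col x y \notin Lc' & {in Lc, forall c, (c == col x y) || (c \in Lc')}] &
    size Lv' + size Lc' <= l].
  move=> vV vD h1 h2 h3 h4 h5.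
  have [|r [rV rD]] := lp v [set z in [:: v]].
    by apply: le4; apply: budget hV _.
  rewrite !inE eq_sym => vr nvr [cC cD].
  exists v, r, Lv', Lc; split=> //; split=> //.
    by rewrite !inE orbC vV rV cC orbT.
  split=> //; last by move=> c ->; rewrite orbT.
  by apply/negP => /hLc/andP[_]; rewrite cC.
case eL : Lv => [|v L0].
  case ec : Lc => [|c L1].
    have [|x [xV xD _ _ _]] := lp a set0; first by rewrite setU0.
    have := vertex x [::]; rewrite eL ec; apply=> //; by rewrite xV.
  have [x [y [xV yV xy nxy cxy]]] := Ed c hV1.
  move: xV yV; rewrite !in_setD !in_setI => /andP[+ xV] /andP[+ yV]; rewrite xV yV /= => xD yD.
  have /andP[cD cC] : (c \notin ecols D f) && (c \notin C') by apply: hLc; rewrite ec inE eqxx.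
  move: uLc sl; rewrite ec eL /= => /andP[cL uL1] sl.
  exists x, y, [::], L1; rewrite cxy; split=> //; split=> //.
    by rewrite !inE eqxx xV yV.
  by split=> // z zL; rewrite inE zL orbT.
have vL : v \in Lv by rewrite eL inE eqxx.
have /andP[vD vV] := hL v vL; rewrite -eL.
have /andP[vL0 uL0] : uniq (v :: L0) by rewrite -eL.
apply: (vertex v L0) => //.
- by rewrite vL orbT.
- by move=> z zL; rewrite eL inE zL orbT.
- by move=> z; rewrite eL inE.
by move: sl; rewrite eL /= addSn.
Qed.

Variables (I : eqType) (pa pb : I -> V) (pq : I -> seq V).
Local Notation pdom := (path_dom pq).
Local Notation psys := (path_system T pa pb pq).

(** As long as leftovers remain, each hole disposes of one, so [size l] holes suffice. A hole uses
    six vertices and seven colours, covered by a budget of [7] of each kind. *)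
Lemma fill_holes (l : seq I) D f (Lv : seq W) (Lc : seq K) : partial D f -> psys D l ->
  (forall i, i \in l -> size (pq i) = 6) -> uniq Lv -> uniq Lc ->
  {in Lv, forall x, (x \notin f @: D) && (x \notin V')} ->
  {in Lc, forall c, (c \notin ecols D f) && (c \notin C')} ->
  size Lv + size Lc <= size l ->
  (#|V' :&: f @: D| + 7 * size l) * (4 * M) <= n -> (#|C' :&: ecols D f| + 7 * size l) * (4 * M) <= n ->
  exists f', [/\ partial (pdom D l) f', {in D, f' =1 f},
    (f @: D :|: [set x in Lv] \subset f' @: pdom D l) && (f' @: pdom D l \subset f @: D :|: [set x in Lv] :|: V') &
    (ecols D f :|: [set c in Lc] \subset ecols (pdom D l) f') &&
    (ecols (pdom D l) f' \subset ecols D f :|: [set c in Lc] :|: C')].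
Proof.
elim: l D f Lv Lc => [|i l IH] D f Lv Lc pt ps s6 uL uLc hL hLc sl hV hC.
  move: sl; rewrite leqn0 addn_eq0 !size_eq0 => /andP[/eqP-> /eqP->].
  exists f; rewrite !path_dom0.
  have e (U : finType) : [set x : U in [::]] = set0 by apply/setP => x; rewrite !inE.
  by rewrite !e !setU0 !subxx !subsetUl.
have [[bi qi aD bD qD] ps'] := path_system_cons ps.
have si : size (pq i) = 6 by apply: s6; rewrite inE eqxx.
have le_n (U : finType) (A : {set U}) k k' : (#|A| + k) * (4 * M) <= n -> k' <= k -> (#|A| + k') * (4 * M) <= n.
  by move=> h kk; apply: leq_trans h; rewrite leq_mul2r leq_add2l kk orbT.
rewrite /= mulnS in hV hC.
have hC0 : #|C' :&: ecols D f| * M <= n.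
  apply: leq_trans (le_n _ _ _ 0 hC isT); by rewrite addn0 leq_mul2l leq_pmull ?orbT.
have [|x [y [Lv' [Lc' [[xD yD xy nxy cD] [[xV yV cC] [uL' sL' xL' cov] [uLc' sLc' cLc' covc] sl']]]]]] :=
   middle_edge (f (pa i)) uL uLc hL hLc sl _ hC0.
  by apply: le_n hV _; rewrite addSn.
have [||f1 [r [k [pt1 ff im ec [sr sk rV kC]]]]] := fill_hole pt bi si aD bD qD xD yD xy nxy cD.
- by apply: le_n hV _; rewrite !addSn.
- by apply: le_n hC _; rewrite !addSn.
have cardV : #|V' :&: f1 @: (D :|: [set v in pq i])| <= #|V' :&: f @: D| + 7.
  rewrite im setIUr; have [h1 _] := leq_card_setU (V' :&: f @: D) (V' :&: (x |: (y |: [set z in r]))).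
  apply: leq_trans h1 _; rewrite leq_add2l; apply: leq_trans (subset_leq_card (subsetIr _ _)) _.
  apply: leq_trans (_ : size (x :: y :: r) <= _); last by rewrite /= sr.
  rewrite -[X in #|pred_of_set X|](_ : [set z in x :: y :: r] = _) ?cardsE ?card_size //.
  by apply/setP => z; rewrite !inE.
have cardC : #|C' :&: ecols (D :|: [set v in pq i]) f1| <= #|C' :&: ecols D f| + 7.
  rewrite ec setIUr; have [h1 _] := leq_card_setU (C' :&: ecols D f) (C' :&: (cs [set x; y] |: [set c in k])).
  apply: leq_trans h1 _; rewrite leq_add2l; apply: leq_trans (subset_leq_card (subsetIr _ _)) _.
  apply: leq_trans (_ : size (cs [set x; y] :: k) <= _); last by rewrite /= sk.
  rewrite -[X in #|pred_of_set X|](_ : [set z in cs [set x; y] :: k] = _) ?cardsE ?card_size //.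
  by apply/setP => z; rewrite !inE.
have [||||||f2 [pt2 ff2 /andP[im2a im2b] /andP[ec2a ec2b]]] := IH _ f1 Lv' Lc' pt1 ps' _ uL' uLc'.
- by move=> j jl; apply: s6; rewrite inE jl orbT.
- move=> z zL; have /andP[zD zV] := hL z (sL' z zL); rewrite zV andbT im !inE !negb_or zD /=.
  apply/and3P; split; first by apply: contraNneq xL' => <-.
    by apply: contraNneq zV => ->.
  by apply: contra zV => /rV.
- move=> c cL; have /andP[cD' cC'] := hLc c (sLc' c cL); rewrite cC' andbT ec !inE !negb_or cD' /=.
  apply/andP; split; first by apply: contraNneq cLc' => <-.
  by apply: contra cC' => /kC.
- exact: sl'.
- by apply: leq_trans hV; rewrite leq_mul2r addnA leq_add2r cardV orbT.
- by apply: leq_trans hC; rewrite leq_mul2r addnA leq_add2r cardC orbT.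
exists f2; rewrite !path_dom_cons; split=> //.
- by move=> z zD; rewrite ff2 ?ff // inE zD.
- apply/andP; split.
    apply: subset_trans im2a; rewrite im; apply/subsetP => z; rewrite !inE => /orP[->//|/cov/orP[->|->]]; by rewrite ?orbT.
  apply: subset_trans im2b _; rewrite im; apply/subsetP => z; rewrite !inE -!orbA.
  case/or4P=> [->//|/eqP->|/eqP->|]; first by move: xV; rewrite !inE => ->; rewrite orbT.
    by rewrite yV !orbT.
  by case/or3P=> [/rV->|/sL'->|->]; rewrite ?orbT.
apply/andP; split.
  apply: subset_trans ec2a; rewrite ec; apply/subsetP => c; rewrite !inE => /orP[->//|/covc/orP[->|->]]; by rewrite ?orbT.
apply: subset_trans ec2b _; rewrite ec; apply/subsetP => c; rewrite !inE -!orbA.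
case/or4P=> [->//|/eqP->|/kC->|]; rewrite ?orbT //; first by move: cC; rewrite !inE => ->; rewrite orbT.
by case/orP=> [/sLc'->|->]; rewrite ?orbT.
Qed.

End Holes.

(** * Cutting the bare paths into holes and gadget segments *)

Lemma belast_cat_cons (U : Type) (x : U) q y r : belast x (q ++ y :: r) = x :: q ++ belast y r.
Proof. by elim: q x => //= a q IH x; rewrite IH. Qed.

Lemma bare_of_path (V : finType) (T : sgraph V) s1 x q y r :
  bare_path T (s1 ++ x :: q ++ y :: r) -> bare T x q y.
Proof.
have [a [b [-> ea eb]]] : exists a b, [/\ bare_path T (s1 ++ x :: q ++ y :: r) =
  [&& sorted (adj T) (a ++ x :: q ++ y :: r), uniq (a ++ x :: q ++ y :: r) &
   all (fun v => deg T v == 2) (b ++ q ++ belast y r)], True & True].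
  case: s1 => [|z s1]; first by exists [::], [::]; rewrite /= belast_cat_cons.
  exists (z :: s1), (s1 ++ [:: x]); rewrite /= belast_cat_cons /= belast_cat_cons -catA.
  by split.
rewrite cat_uniq => /and3P[so /and3P[_ _ u] d].
apply/and3P; split.
- by have [_] := cat_sorted2 so; rewrite /= -cat_rcons cat_path => /andP[].
- by move: u; rewrite -cat_cons -cat_rcons cat_uniq => /and3P[].
by move: d; rewrite !all_cat => /and3P[].
Qed.

Section Decomposition.
Variables (V : finType) (T : sgraph V) (g : nat).
Variables (sx su sv sy : 'I_g -> V) (q1 m q2 sr : 'I_g -> seq V).
Local Notation ad := (adj T).
Local Notation whole i := (sx i :: q1 i ++ su i :: m i ++ sv i :: q2 i ++ sy i :: sr i).
Hypothesis hb : forall i, bare_path T (whole i).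
Hypothesis hd : forall i j w, w \in whole i -> w \in whole j -> i = j.
Hypotheses (s1 : forall i, size (q1 i) = 6) (s2 : forall i, size (q2 i) = 6) (m0 : forall i, m i != [::]).

Definition inner i := q1 i ++ su i :: m i ++ sv i :: q2 i.
Definition outside := [set x | ~~ [exists i, x \in inner i]].
(** These receive the ends of the gadgets beforehand. They have no neighbour among anchors and
    outside vertices, so no edge at them is embedded before the holes are filled. *)
Definition anchors := [set x | [exists i, (x == su i) || (x == sv i)]].
Definition hole_a (z : 'I_g * bool) := if z.2 then sx z.1 else sv z.1.
Definition hole_b (z : 'I_g * bool) := if z.2 then su z.1 else sy z.1.
Definition hole_q (z : 'I_g * bool) := if z.2 then q1 z.1 else q2 z.1.

(** Distinctness of the parts of a path as a single inequality, which turns each later exclusion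
    into linear arithmetic. *)
Lemma whole_excl i w :
  (w == sx i) + (w \in q1 i) + (w == su i) + (w \in m i) + (w == sv i) + (w \in q2 i) + (w == sy i) <= 1.
Proof.
have u : uniq (whole i) by have := hb i; rewrite /bare_path => /and3P[].
have c : count_mem w (whole i) <= 1 by rewrite (count_uniq_mem _ u) leq_b1.
have cm (q : seq V) : (w \in q : nat) <= count_mem w q.
  by case: (boolP (w \in q)) => // wq; rewrite -has_count has_pred1.
have := cm (q1 i); have := cm (m i); have := cm (q2 i).
move: c; rewrite /= !count_cat /= !count_cat /= !count_cat /= ![_ == w]eq_sym; clear; lia.
Qed.

Lemma inner_whole i w : w \in inner i -> w \in whole i.
Proof.
rewrite /inner !inE !mem_cat !inE !mem_cat !inE !mem_cat !inE.
by case/orP=> [->|/or4P[->|->|->|->]]; rewrite ?orbT.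
Qed.

Lemma memw i w : [|| w == sx i, w \in q1 i, w == su i, w \in m i, w == sv i, w \in q2 i | w == sy i] -> w \in whole i.
Proof.
rewrite !inE !mem_cat !inE !mem_cat !inE !mem_cat !inE.
by case/orP=> [->//|/orP[->|/orP[->|/orP[->|/orP[->|/orP[->|->]]]]]]; rewrite ?orbT.
Qed.

Lemma memi i w : (w \in inner i) = [|| w \in q1 i, w == su i, w \in m i, w == sv i | w \in q2 i].
Proof. by rewrite /inner !mem_cat !inE !mem_cat !inE. Qed.

Lemma bare_inner i : bare T (sx i) (inner i) (sy i).
Proof.
apply: (@bare_of_path _ _ [::] _ _ _ (sr i)).
by rewrite /inner /= -catA /= -catA /=; apply: hb.
Qed.

Lemma bare_hole1 i : bare T (sx i) (q1 i) (su i).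
Proof. exact: (@bare_of_path _ _ [::] _ _ _ _ (hb i)). Qed.

Lemma bare_mid i : bare T (su i) (m i) (sv i).
Proof. exact: (@bare_of_path _ _ (sx i :: q1 i) _ _ _ _ (hb i)). Qed.

Lemma bare_hole2 i : bare T (sv i) (q2 i) (sy i).
Proof.
have e : whole i = (sx i :: q1 i ++ su i :: m i) ++ sv i :: q2 i ++ sy i :: sr i by rewrite /= -catA.
by have := hb i; rewrite e; apply: bare_of_path.
Qed.

Lemma nbr_su i w : ad (su i) w -> (w \in q1 i) || (w \in m i).
Proof.
have := hb i; case/lastP: (q1 i) (s1 i) => // q z _; rewrite cat_rcons -cat_cons.
rewrite -[su i :: m i ++ _]cat_cons => /bare_of_path/bare_nbrs h /h.
rewrite !inE => /orP[/eqP->|/eqP->]; first by rewrite mem_rcons inE eqxx.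
by case: (m i) (m0 i) => // a l _; rewrite /= inE eqxx orbT.
Qed.

Lemma nbr_sv i w : ad (sv i) w -> (w \in m i) || (w \in q2 i).
Proof.
have := hb i; case/lastP: (m i) (m0 i) => // q z _.
rewrite cat_rcons -[su i :: q ++ _]cat_cons -cat_cons catA.
rewrite -[sv i :: q2 i ++ _]cat_cons => /bare_of_path/bare_nbrs h /h.
rewrite !inE => /orP[/eqP->|/eqP->]; first by rewrite mem_rcons inE eqxx.
by case: (q2 i) (s2 i) => // a l _; rewrite /= inE eqxx orbT.
Qed.

Lemma su_inj : injective su.
Proof. by move=> i j e; apply: (hd (w := su i)); apply: memw; rewrite ?e eqxx !orbT. Qed.

Lemma sv_inj : injective sv.
Proof. by move=> i j e; apply: (hd (w := sv i)); apply: memw; rewrite ?e eqxx !orbT. Qed.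

Lemma suv i j : su i != sv j.
Proof.
apply/negP => /eqP e; have ij : i = j by apply: (hd (w := su i)); apply: memw; rewrite ?e eqxx !orbT.
by move: e; rewrite -ij => e; have := whole_excl i (su i); rewrite -e eqxx; clear; lia.
Qed.

Lemma outside_end i : (sx i \in outside) && (sy i \in outside).
Proof.
by rewrite !inE; apply/andP; split; apply/negP => /existsP[j]; [set w := sx i|set w := sy i] => wi;
  have ij : i = j by [apply: (hd (w := w)); [apply: memw; rewrite eqxx ?orbT|apply: inner_whole]];
  have := whole_excl i w; move: wi; rewrite -ij memi /w eqxx;
  case/orP=> [->|/or4P[->|->|->|->]]; clear; lia.
Qed.

Lemma psys_inner : path_system T sx sy inner outside (enum 'I_g).
Proof.
split; first exact: enum_uniq.
  move=> i _; have /andP[? ?] := outside_end i; split=> //; first exact: bare_inner.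
    by rewrite /inner; case: (q1 i) (s1 i).
  by move=> w wi; rewrite inE negbK; apply/existsP; exists i.
by move=> i j w _ _ wi wj; apply: (hd (w := w)); apply: inner_whole.
Qed.

Lemma pdom_inner : path_dom inner outside (enum 'I_g) = setT.
Proof.
apply/setP => x; rewrite !inE; case: existsP => //= -[i xi].
by apply/hasP; exists i; rewrite ?mem_enum.
Qed.

Lemma outside_anchors : [disjoint outside & anchors].
Proof.
rewrite disjoint_sym disjoint_subset; apply/subsetP => x; rewrite !inE negbK => /existsP[i h].
by apply/existsP; exists i; rewrite memi; case/orP: h => ->; rewrite ?orbT.
Qed.

Lemma not_core x : x \in anchors :|: outside -> forall i, [/\ x \notin q1 i, x \notin m i & x \notin q2 i].
Proof.
rewrite !inE => /orP[/existsP[j xj]|h] i; last first.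
  by move: h; rewrite negb_exists => /forallP/(_ i); rewrite memi !negb_or => /and5P[-> _ -> _ ->].
split; apply/negP => xi; have ij : i = j by
  [apply: (hd (w := x)); apply: memw; rewrite ?xi ?orbT //; case/orP: xj => ->; rewrite ?orbT].
all: have := whole_excl i x; rewrite xi; move: xj; rewrite -ij => /orP[]->; clear; lia.
Qed.

Lemma anchors_isolated x y : x \in anchors -> y \in anchors :|: outside -> ~~ ad x y.
Proof.
rewrite inE => /existsP[i xi] /not_core /(_ i)[n1 n2 n3]; apply/negP.
by case/orP: xi => /eqP-> => [/nbr_su|/nbr_sv] /orP[]; apply/negP.
Qed.

Lemma psys_holes : path_system T hole_a hole_b hole_q (anchors :|: outside) (enum {: 'I_g * bool}).
Proof.
split; first exact: enum_uniq.
  move=> [i b] _; have /andP[ox oy] := outside_end i.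
  have [ua va] : su i \in anchors /\ sv i \in anchors.
    by rewrite !inE; split; apply/existsP; exists i; rewrite eqxx ?orbT.
  rewrite /hole_a /hole_b /hole_q /=; case: b; rewrite !in_setU ?ox ?oy ?ua ?va ?orbT; split=> //.
  - exact: bare_hole1.
  - by case: (q1 i) (s1 i).
  - by move=> w wq; apply/negP => /not_core /(_ i)[/negP[]].
  - exact: bare_hole2.
  - by case: (q2 i) (s2 i).
  by move=> w wq; apply/negP => /not_core /(_ i)[_ _ /negP[]].
move=> [i b] [j c] w _ _; rewrite /hole_q /= => wi wj.
have ij : i = j by apply: (hd (w := w)); apply: memw; [case: (b) wi|case: (c) wj] => ->; rewrite ?orbT.
by subst j; case: b c wi wj => -[] // h1 h2; have := whole_excl i w; rewrite h1 h2; clear; lia.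
Qed.

Lemma mem_holes x : (x \in path_dom hole_q (anchors :|: outside) (enum {: 'I_g * bool})) = ~~ [exists i, x \in m i].
Proof.
rewrite inE; apply/idP/idP.
  move=> h; apply/negP => /existsP[i xm]; case/orP: h => [/not_core/(_ i)[_ /negP[]]//|/hasP[[j b] _]].
  rewrite /hole_q /= => xj.
  have ij : i = j by apply: (hd (w := x)); apply: memw; [rewrite xm ?orbT|case: (b) xj => ->; rewrite ?orbT].
  by have := whole_excl i x; move: xj; rewrite -ij xm; case: b => ->; clear; lia.
rewrite negb_exists => /forallP h.
case: (boolP (x \in anchors :|: outside)) => //= xD.
move: xD; rewrite in_setU negb_or => /andP[xa xo].
have na i : ~~ ((x == su i) || (x == sv i)).
  by apply: contra xa => h'; rewrite inE; apply/existsP; exists i.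
move: xo; rewrite inE negbK => /existsP[i].
have := na i; rewrite memi negb_or (negbTE (h i)) => /andP[/negbTE-> /negbTE->] /=.
by case/orP=> xq; apply/hasP; [exists (i, true)|exists (i, false)]; rewrite ?mem_enum.
Qed.

Lemma psys_mid : path_system T su sv m (path_dom hole_q (anchors :|: outside) (enum {: 'I_g * bool})) (enum 'I_g).
Proof.
split; first exact: enum_uniq.
  have core x : x \in anchors -> x \in path_dom hole_q (anchors :|: outside) (enum {: 'I_g * bool}).
    by move=> xa; rewrite inE in_setU xa.
  move=> i _; split=> //; first exact: bare_mid.
  - by apply: core; rewrite inE; apply/existsP; exists i; rewrite eqxx.
  - by apply: core; rewrite inE; apply/existsP; exists i; rewrite eqxx orbT.
  by move=> w wm; rewrite mem_holes negbK; apply/existsP; exists i.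
by move=> i j w _ _ wi wj; apply: (hd (w := w)); apply: memw; rewrite ?wi ?wj ?orbT.
Qed.

Lemma pdom_mid : path_dom m (path_dom hole_q (anchors :|: outside) (enum {: 'I_g * bool})) (enum 'I_g) = setT.
Proof.
apply/setP => x; rewrite inE mem_holes in_setT; case: existsP => //= -[i xi].
by apply/hasP; exists i; rewrite ?mem_enum.
Qed.

End Decomposition.

Lemma sumn_shift (I : Type) (f h : I -> nat) c (l : seq I) : (forall i, f i = h i + c) ->
  sumn [seq f i | i <- l] = sumn [seq h i | i <- l] + size l * c.
Proof. by move=> fh; elim: l => //= i l ->; rewrite fh mulSn; lia. Qed.

Lemma card_has (I : eqType) (U : finType) (a : I -> seq U) (l : seq I) : uniq l ->
  (forall i, uniq (a i)) -> (forall i j x, x \in a i -> x \in a j -> i = j) ->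
  #|[set x | has (fun i => x \in a i) l]| = sumn [seq size (a i) | i <- l].
Proof.
move=> + ua da; elim: l => [_|i l IH /= /andP[il ul]].
  by apply: eq_card0 => x; rewrite inE.
have -> : [set x | (x \in a i) || has (fun j => x \in a j) l] =
   [set x in a i] :|: [set x | has (fun j => x \in a j) l] by apply/setP => x; rewrite !inE.
rewrite cardsU disjoint_setI0 ?cards0 ?subn0 ?IH ?cardsE ?(card_uniqP (ua i)) //.
rewrite disjoint_subset; apply/subsetP => x; rewrite !inE => xi; apply/hasPn => j jl.
by apply: contra il => xj; rewrite (da i j x).
Qed.

Lemma inj_into (B U : finType) (S : {set U}) : #|B| <= #|S| ->
  exists2 u : B -> U, injective u & forall b, u b \in S.
Proof.
move=> h; exists (fun b => enum_val (widen_ord h (enum_rank b))) => [b b' /enum_val_inj e|b].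
  by apply: enum_rank_inj; apply: val_inj; have /(congr1 val) := e.
exact: enum_valP.
Qed.

Lemma all2_map_in (I A B : eqType) (r : A -> B -> bool) (f : I -> A) (h : I -> B) (l : seq I) :
  (forall i, r (f i) (h i)) -> all2 r (map f l) (map h l).
Proof. by move=> fh; elim: l => //= i l ->; rewrite fh. Qed.

Lemma all2_cat_size (A B : Type) (r : A -> B -> bool) s1 s2 t1 t2 : size s1 = size t1 ->
  all2 r (s1 ++ s2) (t1 ++ t2) = all2 r s1 t1 && all2 r s2 t2.
Proof. by elim: s1 t1 => [|x s IH] [|y t] //= [e]; rewrite IH // andbA. Qed.

(** * Item lists of the gadgets and bookkeeping *)

Section Items.
Variables (g om : nat) (W K : finType).
Local Notation B := ('I_g * 'I_om)%type.

(** Gadgets swallow pairs, whereas leftover vertices and leftover colours are matched by two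
    unrelated templates. So each slot [b] has a dummy colour [cz b] to accompany vertices and a
    dummy vertex [uz b] to accompany colours. *)
Definition item_lists (EV : W -> B -> bool) (EC : K -> B -> bool) (uz : B -> W) (cz : B -> K) (i : 'I_g) :=
  [seq [seq (v, cz (i, j)) | v <- enum [set v | EV v (i, j)]] | j <- enum 'I_om] ++
  [seq [seq (uz (i, j), c) | c <- enum [set c | EC c (i, j)]] | j <- enum 'I_om].

(** Everything of one kind that gadget [i] finally carries: matched elements, dummies, and its own
    elements [a i]. *)
Definition owner_list (U : finType) (h u : B -> U) (a : 'I_g -> seq U) i :=
  ([seq h (i, j) | j <- enum 'I_om] ++ [seq u (i, j) | j <- enum 'I_om]) ++ a i.

Lemma owner_lists (U : finType) (h u : B -> U) (a : 'I_g -> seq U) (S1 S2 : {set U}) :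
  injective h -> injective u -> (forall b, h b \in S1) -> (forall b, u b \in S2) -> [disjoint S1 & S2] ->
  (forall i x, x \in a i -> x \notin S1 :|: S2) -> (forall i, uniq (a i)) ->
  (forall i j x, x \in a i -> x \in a j -> i = j) ->
  (forall i, uniq (owner_list h u a i)) /\
  (forall i j x, x \in owner_list h u a i -> x \in owner_list h u a j -> i = j).
Proof.
move=> hi ui hS uS S12 aS ua da.
have mE i x : x \in owner_list h u a i -> [\/ exists j, x = h (i, j), exists j, x = u (i, j) | x \in a i].
  rewrite !mem_cat -orbA => /or3P[/mapP[j _ ->]|/mapP[j _ ->]|]; by [constructor 1; exists j|constructor 2; exists j|constructor 3].
have hu b b' : h b = u b' -> False.
  by move=> e; have := disjointFr S12 (hS b); rewrite e uS.
have ha b i : h b \in a i -> False by move=> /aS; rewrite inE hS.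
have ua' b i : u b \in a i -> False by move=> /aS; rewrite inE uS orbT.
split=> [i|i j x].
  have uh : uniq [seq h (i, j) | j <- enum 'I_om] by rewrite map_inj_uniq ?enum_uniq // => j j' /hi[].
  have uu : uniq [seq u (i, j) | j <- enum 'I_om] by rewrite map_inj_uniq ?enum_uniq // => j j' /ui[].
  rewrite !cat_uniq ua uh uu !andbT /=; apply/andP; split; apply/hasPn => x.
    by case/mapP=> j _ ->; apply/negP => /mapP[j' _ /esym/hu].
  move=> xa; apply/negP; rewrite mem_cat => /orP[]/mapP[j _ e]; move: xa; rewrite e; [exact: ha|exact: ua'].
move=> /mE[[k ->]|[k ->]|xi] /mE[[k' e]|[k' e]|xj].
- by case/hi: e.
- by case: (hu _ _ e).
- by case: (ha _ _ xj).
- by case: (hu _ _ (esym e)).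
- by case/ui: e.
- by case: (ua' _ _ xj).
- by rewrite e in xi; case: (ha _ _ xi).
- by rewrite e in xi; case: (ua' _ _ xi).
exact: da xi xj.
Qed.

Lemma item_choice (EV : W -> B -> bool) (EC : K -> B -> bool) uz cz (hv : B -> W) (hc : B -> K) i :
  (forall b, EV (hv b) b) -> (forall b, EC (hc b) b) ->
  all2 (fun x (l : seq (W * K)) => x \in l)
    ([seq (hv (i, j), cz (i, j)) | j <- enum 'I_om] ++ [seq (uz (i, j), hc (i, j)) | j <- enum 'I_om])
    (item_lists EV EC uz cz i).
Proof.
move=> hV hC; rewrite /item_lists all2_cat_size ?size_map //.
apply/andP; split; apply: all2_map_in => j.
  by apply/mapP; exists (hv (i, j)) => //; rewrite mem_enum inE.
by apply/mapP; exists (hc (i, j)) => //; rewrite mem_enum inE.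
Qed.

End Items.

(** [3606 = 2 * (20 * 90 + 3)]: each slot has two lists of at most [90] items. *)
Lemma gad_size_items g om n (K : finType) (EV : 'I_n -> 'I_g * 'I_om -> bool) (EC : K -> 'I_g * 'I_om -> bool) uz cz i : (forall b, #|[set v | EV v b]| <= 90) -> (forall b, #|[set c | EC c b]| <= 90) ->
  gad_size (item_lists EV EC uz cz i) <= 3606 * om.
Proof.
move=> h1 h2; rewrite /gad_size /item_lists map_cat sumn_cat.
have : size (enum 'I_om) = om by rewrite -cardE card_ord.
move: (enum 'I_om) => e se; rewrite -!map_comp.
have bnd (f : 'I_om -> nat) : (forall j, f j <= 1803) -> sumn [seq f j | j <- e] <= 1803 * size e.
  by move=> hf; elim: e {se} => //= j l IH; rewrite mulnS leq_add.
have -> : 3606 * om = 1803 * size e + 1803 * size e by rewrite se; clear; lia.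
have ar k : k <= 90 -> 20 * k + 3 <= 1803 by clear; lia.
by apply: leq_add; apply: bnd => j /=; rewrite size_map -cardE; apply: ar; [apply: h1|apply: h2].
Qed.

(** Serves vertices and colours alike: the pool exceeds the needs of the forest by [l], and each of
    the at most [X] elements taken from the reserve leaves one more pool element over. *)
Lemma leftover_bound (b F I Iu Iv Up L U X S c n l : nat) : I = F -> I <= Iu + Iv -> Iu <= Up -> Iv <= X ->
  F + S + c = n -> U + b + S = n -> b + l = c -> Up + L = U -> L <= l + X.
Proof. lia. Qed.

Lemma reserve_count (Z b A Ar U c S n E v y D : nat) : E = A + U + Ar -> D + S + 2 * Z = n + c ->
  U + (v + y + Z) + S + b = n -> A = b + c -> E = D -> forall Vd, Ar + Vd = v -> Vd + y = Z.
Proof. lia. Qed.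

(** * Completion of the embedding *)

Section Finish.
Variables (V : finType) (T : sgraph V) (n : nat) (K : finType) (x0 : 'I_n).
Local Notation W := 'I_n.
Variables (nb hb : rel W) (cs : {set W} -> K).
Hypotheses (nbC : symmetric nb) (hbC : symmetric hb).
Local Notation col := (fun x y : W => cs [set x; y]).
Local Notation ge := (joined nb hb).
Local Notation partial := (partial T ge cs).
Local Notation ecols := (edge_colours T cs).
Variables (d l0 X Ml Mj g om : nat).
Hypotheses (treeT : is_tree T) (cV : #|V| = n) (cK : #|K| = n.-1) (dT : forall v, deg T v <= d).
Local Notation B := ('I_g * 'I_om)%type.
Variables (sx su sv sy : 'I_g -> V) (q1 m q2 sr : 'I_g -> seq V) (gam : 'I_g -> nat).
Hypothesis hbp : forall i, bare_path T (sx i :: q1 i ++ su i :: m i ++ sv i :: q2 i ++ sy i :: sr i).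
Hypothesis hd : forall i j w, w \in sx i :: q1 i ++ su i :: m i ++ sv i :: q2 i ++ sy i :: sr i ->
  w \in sx j :: q1 j ++ su j :: m j ++ sv j :: q2 j ++ sy j :: sr j -> i = j.
Hypotheses (s1 : forall i, size (q1 i) = 6) (s2 : forall i, size (q2 i) = 6).
(** The gadget has [gam i + 1] vertices of its own and swallows [2 * om] more; two of them are
    placed at the anchors and do not count in [m i]. *)
Hypothesis sm : forall i, size (m i) + 1 = gam i + 2 * om.
Hypothesis om0 : 0 < om.
Variables (V' YV : {set W}) (C' YC : {set K}) (uz : B -> W) (cz : B -> K).
Hypotheses (uzi : injective uz) (czi : injective cz) (VY : [disjoint V' & YV]) (CY : [disjoint C' & YC]).
Hypotheses (uzS : forall b, uz b \notin V' :|: YV) (czS : forall b, cz b \notin C' :|: YC).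
Variables (EV : W -> B -> bool) (EC : K -> B -> bool).
Hypothesis HEV : forall A' : {set W}, A' \subset V' :|: YV -> #|A'| = #|{: B}| -> YV \subset A' ->
  exists2 h : B -> W, injective h & forall b, (h b \in A') && EV (h b) b.
Hypothesis HEC : forall A' : {set K}, A' \subset C' :|: YC -> #|A'| = #|{: B}| -> YC \subset A' ->
  exists2 h : B -> K, injective h & forall b, (h b \in A') && EC (h b) b.
Variables (gs gt : 'I_g -> W) (ga : 'I_g -> seq W) (gb : 'I_g -> seq K).
Let UZ := [set uz b | b in [set: B]].
Let CZ := [set cz b | b in [set: B]].
Let QV := V' :|: YV :|: UZ.
Let QC := C' :|: YC :|: CZ.
Hypothesis gf : forall i, fresh (ga i) (gb i) QV QC.
Hypotheses (sa : forall i, size (ga i) = gam i + 1) (sb : forall i, size (gb i) = gam i).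
Hypothesis gm : forall i, mgad nb hb col (gs i) (gt i) (ga i) (gb i) (item_lists EV EC uz cz i).
Hypotheses (gsa : forall i, gs i \in ga i) (gta : forall i, gt i \in ga i) (gst : forall i, gs i != gt i).
Hypothesis daa : forall i j x, x \in ga i -> x \in ga j -> i = j.
Hypothesis dbb : forall i j c, c \in gb i -> c \in gb j -> i = j.
(** With its colour counterpart, this makes the pool exceed the needs of the forest by exactly [l0]:
    the two holes of a path have [12] inner vertices and [14] edges. *)
Hypothesis hV : #|V'| + #|YV| + l0 = g * om + 12 * g.
Hypothesis hC : #|C'| + #|YC| + l0 = g * om + 14 * g.
Hypotheses (n0 : 0 < n) (l0n : n <= l0 * Mj) (Xn : X * Ml <= n) (dX : d * n <= X * Mj) (lX : l0 + X <= g).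
Hypotheses (Ml0 : 0 < Ml) (Mln : 4 * Ml <= n) (MlMj : 8 * Ml <= Mj) (Cn : n <= #|C'| * Ml).
Hypothesis hXg : (X + 14 * g) * (4 * Ml) <= n.
Hypotheses (Ll : Lprop nb col V' C' Ml) (J : Jprop hb col Mj).
Hypothesis Ed : forall c (Q : {set W}), #|Q| * Ml <= n ->
  exists x y, [/\ x \in V' :\: Q, y \in V' :\: Q, x != y, nb x y & col x y = c].

Let m0 i : m i != [::].
Proof. by have := sm i; case: (m i) => //=; move: om0; clear; lia. Qed.

Let F := outside su sv q1 m q2.
Let D0 := anchors su sv.
Let hq := hole_q q1 q2.
Let D1 := path_dom hq (D0 :|: F) (enum {: 'I_g * bool}).
Let S := sumn [seq gam i | i <- enum 'I_g].

Let PI : path_system T sx sy (inner su sv q1 m q2) F (enum 'I_g).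
Proof. by eapply psys_inner; eassumption. Qed.

Let PH : path_system T (hole_a sx sv) (hole_b su sy) hq (D0 :|: F) (enum {: 'I_g * bool}).
Proof. by eapply psys_holes; eassumption. Qed.

Let PM : path_system T su sv m D1 (enum 'I_g).
Proof. by eapply psys_mid; eassumption. Qed.

Let domI : path_dom (inner su sv q1 m q2) F (enum 'I_g) = setT.
Proof. by eapply pdom_inner; eassumption. Qed.

Let domM : path_dom m D1 (enum 'I_g) = setT.
Proof. by eapply pdom_mid; eassumption. Qed.

Let FD0 : [disjoint F & D0].
Proof. by eapply outside_anchors; eassumption. Qed.

Let D0F x y : x \in D0 -> y \in D0 :|: F -> ~~ adj T x y.
Proof. by eapply anchors_isolated; eassumption. Qed.

Let usu : injective su.
Proof. by eapply su_inj; eassumption. Qed.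

Let usv : injective sv.
Proof. by eapply sv_inj; eassumption. Qed.

Let usuv i j : su i != sv j.
Proof. by eapply suv; eassumption. Qed.

Let sen : size (enum 'I_g) = g.
Proof. by rewrite -cardE card_ord. Qed.

Let edgesT : #|iedges T setT| = n.-1.
Proof.
rewrite -cV -(card_tree_edges treeT); apply: eq_card => e; by rewrite inE subsetT andbT.
Qed.

Let size_inner i : size (inner su sv q1 m q2 i) = gam i + (2 * om + 13).
Proof. by rewrite /inner !size_cat /= !size_cat /= s1 s2; have := sm i; clear; lia. Qed.

Let cF : #|F| + S + 13 * g + 2 * (g * om) = n.
Proof.
have := card_path_dom PI; rewrite domI cardsT cV (sumn_shift _ size_inner) sen -/S.
by move=> ->; clear; lia.
Qed.

Let ciF : #|iedges T F| + S + 14 * g + 2 * (g * om) = n.-1.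
Proof.
have := card_iedges_paths PI; rewrite domI edgesT (@sumn_shift _ _ gam (2 * om + 14)) ?sen -/S.
  by move=> ->; clear; lia.
by move=> i; rewrite size_inner; clear; lia.
Qed.

Let cD1 : #|D1| + S + 2 * (g * om) = n + g.
Proof.
have := card_path_dom PM; rewrite domM cardsT cV (@sumn_shift _ _ gam (2 * om - 1)) ?sen -/S.
  by move=> ->; move: om0; clear; case: om => // o _; lia.
by move=> i; have := sm i; move: om0; clear; lia.
Qed.

Let ciD1 : #|iedges T D1| + S + 2 * (g * om) = n.-1.
Proof.
have := card_iedges_paths PM; rewrite domM edgesT (@sumn_shift _ _ gam (2 * om)) ?sen -/S.
  by move=> ->; clear; lia.
by move=> i; have := sm i; clear; lia.
Qed.

Let size_hole z : size (hq z) = 6.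
Proof. by rewrite /hq /hole_q; case: (z.2). Qed.

Let cD0 : #|D0| = 2 * g.
Proof.
have := card_path_dom PH; rewrite -/D1 (@sumn_shift _ _ (fun=> 0) 6) ?size_hole; last by move=> z; rewrite size_hole.
have -> : sumn [seq 0 | _ <- enum {: 'I_g * bool}] = 0 by elim: (enum _).
rewrite -cardE card_prod card_ord card_bool cardsU disjoint_setI0 ?cards0 ?subn0; last by rewrite disjoint_sym.
by move: cD1 cF; clear; lia.
Qed.

Let f0 (x : V) := if [pick i | x == su i] is Some i then gs i else
  if [pick i | x == sv i] is Some i then gt i else x0.

Let f0u i : f0 (su i) = gs i.
Proof. by rewrite /f0; case: pickP => [j /eqP/usu <- //|/(_ i)]; rewrite eqxx. Qed.

Let f0v i : f0 (sv i) = gt i.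
Proof.
rewrite /f0; case: pickP => [j|_]; first by rewrite eq_sym (negbTE (usuv j i)).
by case: pickP => [j /eqP/usv <- //|/(_ i)]; rewrite eqxx.
Qed.

Let D0P x : x \in D0 -> exists i, x = su i \/ x = sv i.
Proof. by rewrite inE => /existsP[i /orP[]/eqP->]; exists i; [left|right]. Qed.

Let f0inj : {in D0 &, injective f0}.
Proof.
move=> x y /D0P[i [->|->]] /D0P[j [->|->]]; rewrite ?f0u ?f0v => e.
- by rewrite (daa (gsa i) (_ : gs i \in ga j)) // e.
- have ij : i = j by apply: (daa (gsa i)); rewrite e.
  by move: e; rewrite -ij => e; have := gst i; rewrite e eqxx.
- have ij : i = j by apply: (daa (gta i)); rewrite e.
  by move: e; rewrite -ij => e; have := gst i; rewrite e eqxx.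
by rewrite (daa (gta i) (_ : gt i \in ga j)) // e.
Qed.

Let AA := [set x | has (fun i => x \in ga i) (enum 'I_g)].
Let BB := [set c | has (fun i => c \in gb i) (enum 'I_g)].
Let U0 := ~: (QV :|: AA).
Let G0 := ~: (QC :|: BB).

Let AAi i x : x \in ga i -> x \in AA.
Proof. by move=> xi; rewrite inE; apply/hasP; exists i; rewrite ?mem_enum. Qed.

Let BBi i c : c \in gb i -> c \in BB.
Proof. by move=> xi; rewrite inE; apply/hasP; exists i; rewrite ?mem_enum. Qed.

Let QA : [disjoint QV & AA].
Proof.
rewrite disjoint_sym disjoint_subset; apply/subsetP => x; rewrite inE => /hasP[i _ xi].
by have [_ _ h _] := gf i; rewrite inE; apply: h.
Qed.

Let QB : [disjoint QC & BB].
Proof.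
rewrite disjoint_sym disjoint_subset; apply/subsetP => x; rewrite inE => /hasP[i _ xi].
by have [_ _ _ h] := gf i; rewrite inE; apply: h.
Qed.

Let cUnion (U : finType) (A A' : {set U}) : [disjoint A & A'] -> #|A :|: A'| = #|A| + #|A'|.
Proof. by move=> h; rewrite cardsU disjoint_setI0 ?cards0 ?subn0. Qed.

Let cQV : #|QV| = #|V'| + #|YV| + g * om.
Proof.
rewrite cUnion; last first.
  rewrite disjoint_sym disjoint_subset; apply/subsetP => x /imsetP[b _ ->]; exact: uzS.
by rewrite cUnion // card_imset // cardsT card_prod !card_ord.
Qed.

Let cQC : #|QC| = #|C'| + #|YC| + g * om.
Proof.
rewrite cUnion; last first.
  rewrite disjoint_sym disjoint_subset; apply/subsetP => x /imsetP[b _ ->]; exact: czS.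
by rewrite cUnion // card_imset // cardsT card_prod !card_ord.
Qed.

Let cU0 : #|U0| + (#|V'| + #|YV| + g * om) + S + g = n.
Proof.
have cA : #|AA| = S + g.
  rewrite card_has ?enum_uniq //; last by move=> i; have [] := gf i.
  by rewrite (sumn_shift _ sa) sen muln1.
have := cardsC (QV :|: AA); rewrite cUnion // cQV cA card_ord -/U0; clear; lia.
Qed.

Let cG0 : #|G0| + (#|C'| + #|YC| + g * om) + S = n.-1.
Proof.
have cA : #|BB| = S.
  rewrite card_has ?enum_uniq //; last by move=> i; have [] := gf i.
  by congr sumn; apply: eq_map => i; rewrite sb.
have := cardsC (QC :|: BB); rewrite cUnion // cQC cA cK -/G0; clear; lia.
Qed.

Let f0A x : x \in D0 -> f0 x \in AA.
Proof. by move=> /D0P[i [->|->]]; rewrite ?f0u ?f0v; apply: (AAi (i := i)). Qed.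

Let f0D0A : f0 @: D0 \subset AA.
Proof. by apply/subsetP => x /imsetP[y yD ->]; apply: f0A. Qed.

Let U0f : [disjoint U0 & f0 @: D0].
Proof.
rewrite disjoint_sym disjoint_subset; apply/subsetP => x /(subsetP f0D0A) xA.
by rewrite !inE negbK; rewrite inE in xA; rewrite xA orbT.
Qed.

Let VQ : V' \subset QV.
Proof. by rewrite /QV -setUA subsetUl. Qed.

Let CQ : C' \subset QC.
Proof. by rewrite /QC -setUA subsetUl. Qed.

Let V'f : [disjoint V' & f0 @: D0].
Proof. by apply: disjointWl VQ _; apply: disjointWr f0D0A QA. Qed.

Let U0V' : [disjoint U0 & V'].
Proof.
rewrite disjoint_sym disjoint_subset; apply/subsetP => x /(subsetP VQ) xQ.
by rewrite /U0 inE in_setC negbK in_setU xQ.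
Qed.

Let G0C' : [disjoint G0 & C'].
Proof.
rewrite disjoint_sym disjoint_subset; apply/subsetP => x /(subsetP CQ) xQ.
by rewrite /G0 inE in_setC negbK in_setU xQ.
Qed.

Let iD : iedges T (D0 :|: F) = iedges T F.
Proof. exact: (iedges_isolated D0F). Qed.

Let forest : exists f, [/\ partial (D0 :|: F) f, {in D0, f =1 f0}, f @: F \subset U0 :|: V',
  ecols (D0 :|: F) f \subset G0 :|: C' & #|f @: F :&: V'| <= X /\ #|ecols (D0 :|: F) f :&: C'| <= X].
Proof.
have [s [us sV os]] := tree_order_full treeT.
have os' t1 v t2 : s = t1 ++ v :: t2 -> count (adj T v) t1 <= 1 by move=> /os->; rewrite leq_b1.
have cU : #|F| + l0 <= #|U0| by move: cF cU0 hV; clear; lia.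
have cG : #|iedges T F| + l0 <= #|G0| by move: ciF cG0 hC; clear; lia.
by eapply (@greedy_forest V T n K nb hb cs nbC hbC s F D0 f0 U0 V' G0 C' d l0 X Ml Mj); eassumption.
Qed.

Let ecols_card D f : partial D f -> #|ecols D f| = #|iedges T D|.
Proof. by case=> _ _ h; rewrite /edge_colours card_in_imset. Qed.

Let image_card D f : partial D f -> #|f @: D| = #|D|.
Proof. by case=> h _ _; rewrite card_in_imset. Qed.

(** At most [l0 + X] pool vertices and [l0 + X] pool colours are left over; as [l0 + X <= g], the
    [2 * g] holes take all of them. Afterwards the pool is exhausted. *)
Let holes : exists f, [/\ partial D1 f, (forall i, f (su i) = gs i /\ f (sv i) = gt i),
  (f0 @: D0 :|: U0 \subset f @: D1) && (f @: D1 \subset f0 @: D0 :|: U0 :|: V') &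
  (G0 \subset ecols D1 f) && (ecols D1 f \subset G0 :|: C')].
Proof.
have [f [pt ff fU eG [XV XC]]] := forest.
have imD : f @: (D0 :|: F) = f0 @: D0 :|: f @: F by rewrite imsetU (eq_in_imset ff).
pose Lv := U0 :\: f @: (D0 :|: F); pose Lc := G0 :\: ecols (D0 :|: F) f.
have cLv : #|Lv| <= l0 + X.
  have e1 : #|f @: F| = #|F|.
    rewrite card_in_imset // => x y xF yF; case: pt => inj _ _; apply: inj; by rewrite inE ?xF ?yF orbT.
  have e2 : #|f @: F| <= #|f @: F :&: U0| + #|f @: F :&: V'|.
    have [h _] := leq_card_setU (f @: F :&: U0) (f @: F :&: V'); apply: leq_trans h.
    by rewrite -setIUr (setIidPl fU).
  have e3 : #|f @: F :&: U0| <= #|U0 :&: f @: (D0 :|: F)|.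
    by apply: subset_leq_card; rewrite imD setIC setIS // subsetUr.
  have e4 := cardsID (f @: (D0 :|: F)) U0; rewrite -/Lv in e4.
  apply: (leftover_bound (S := S) (c := 13 * g + 2 * (g * om)) (n := n) (b := #|V'| + #|YV| + g * om + g)
    e1 e2 e3 XV _ _ _ e4).
  - by move: cF; clear; lia.
  - by rewrite addnA addnAC; apply: cU0.
  by move: hV; clear; lia.
have cLc : #|Lc| <= l0 + X.
  have e1 : #|ecols (D0 :|: F) f| = #|iedges T F| by rewrite ecols_card // iD.
  have e2 : #|ecols (D0 :|: F) f| <= #|G0 :&: ecols (D0 :|: F) f| + #|ecols (D0 :|: F) f :&: C'|.
    have [h _] := leq_card_setU (ecols (D0 :|: F) f :&: G0) (ecols (D0 :|: F) f :&: C').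
    by rewrite setIC; apply: leq_trans h; rewrite -setIUr (setIidPl eG).
  have e4 := cardsID (ecols (D0 :|: F) f) G0; rewrite -/Lc in e4.
  apply: (leftover_bound (S := S) (c := 14 * g + 2 * (g * om)) (n := n.-1) (b := #|C'| + #|YC| + g * om)
    e1 e2 (leqnn _) XC _ _ _ e4).
  - by move: ciF; clear; lia.
  - exact: cG0.
  by move: hC; clear; lia.
have sz : size (enum {: 'I_g * bool}) = 2 * g.
  by rewrite -cardE card_prod card_ord card_bool mulnC.
have VX : #|V' :&: f @: (D0 :|: F)| <= X.
  by rewrite imD setIUr (disjoint_setI0 V'f) set0U setIC.
have [||||||||f1 [pt1 ff1 /andP[im1 im2] /andP[ec1 ec2]]] := @fill_holes V T n K nb hb cs nbC hbC V' C' Ml Mj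
    Ml0 Mln MlMj Ll J Cn Ed _ (hole_a sx sv) (hole_b su sy) hq (enum {: 'I_g * bool}) _ f (enum Lv) (enum Lc) pt PH.
- by move=> z _; apply: size_hole.
- exact: enum_uniq.
- exact: enum_uniq.
- by move=> x; rewrite mem_enum in_setD => /andP[-> /(disjointFr U0V')->].
- by move=> c; rewrite mem_enum in_setD => /andP[-> /(disjointFr G0C')->].
- rewrite sz -!cardE; apply: leq_trans (leq_add cLv cLc) _; by move: lX; clear; lia.
- rewrite sz; apply: leq_trans hXg; rewrite leq_mul2r mulnA; apply/orP; right; by rewrite leq_add2r.
- by rewrite sz; apply: leq_trans hXg; rewrite leq_mul2r mulnA leq_add2r setIC XC orbT.
exists f1; split=> //.
- move=> i; have [ua va] : su i \in D0 /\ sv i \in D0.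
    by rewrite !inE; split; apply/existsP; exists i; rewrite eqxx ?orbT.
  by rewrite !ff1 ?in_setU ?ua ?va // !ff // f0u f0v.
- apply/andP; split.
    apply: subset_trans im1; rewrite imD; apply/subsetP => x; rewrite !in_setU in_set mem_enum in_setD imD in_setU.
    by case/orP=> [->//|xU]; case: (x \in f0 @: D0) => //=; case: (x \in f @: F) => //=; rewrite xU.
  apply/subsetP => x /(subsetP im2); rewrite imD !in_setU in_set mem_enum in_setD.
  case/orP=> [/orP[/orP[->//|xF]|/andP[_ ->]]|->]; rewrite ?orbT //.
  by have := subsetP fU x xF; rewrite in_setU => /orP[]->; rewrite ?orbT.
apply/andP; split.
  apply: subset_trans ec1; apply/subsetP => c cG; rewrite in_setU in_set mem_enum in_setD cG andbT.
  by case: (c \in ecols _ _).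
apply: subset_trans ec2 _; rewrite !subUset eG subsetUr andbT /=.
by apply/subsetP => c; rewrite in_set mem_enum in_setD in_setU => /andP[_ ->].
Qed.

Let cB : #|{: B}| = g * om.
Proof. by rewrite card_prod !card_ord. Qed.

Lemma finish : exists f, partial setT f.
Proof.
have [f [pt fs /andP[im1 im2] /andP[ec1 ec2]]] := holes.
pose AV := (V' :\: f @: D1) :|: YV; pose AC := (C' :\: ecols D1 f) :|: YC.
have cAV : #|AV| = #|{: B}|.
  have e1 : #|f @: D1| = #|f0 @: D0| + #|U0| + #|V' :&: f @: D1|.
    have -> : f @: D1 = f0 @: D0 :|: U0 :|: (V' :&: f @: D1).
      apply/eqP; rewrite eqEsubset; apply/andP; split; last by rewrite subUset im1 subsetIr.
      apply/subsetP => x xD; have := subsetP im2 x xD; rewrite !in_setU in_setI xD andbT.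
      by [].
    rewrite cUnion; last first.
      rewrite disjoint_sym disjoint_subset; apply/subsetP => x; rewrite in_setI => /andP[xV _].
      by rewrite inE in_setU negb_or (disjointFr V'f xV) (disjointFl U0V' xV).
    rewrite cUnion; last by rewrite disjoint_sym.
    congr (_ + #|pred_of_set _|); apply/setP => x; rewrite !in_setI in_setU in_setI in_setU.
    case xV: (x \in V') => //=; by rewrite (disjointFr V'f xV) (disjointFl U0V' xV).
  have e2 : #|f0 @: D0| = 2 * g by rewrite card_in_imset.
  rewrite cUnion; last by apply: disjointWl VY; apply: subsetDl.
  rewrite cB; apply: (reserve_count e1 cD1 cU0 _ (image_card pt) (cardsID (f @: D1) V')).
  by rewrite e2 mul2n -addnn.
have cAC : #|AC| = #|{: B}|.
  have e1 : #|ecols D1 f| = #|G0| + #|C' :&: ecols D1 f|.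
    have -> : ecols D1 f = G0 :|: (C' :&: ecols D1 f).
      apply/eqP; rewrite eqEsubset; apply/andP; split; last by rewrite subUset ec1 subsetIr.
      by apply/subsetP => x xD; have := subsetP ec2 x xD; rewrite !in_setU in_setI xD andbT.
    rewrite cUnion; last by rewrite disjoint_sym; apply: disjointWl (subsetIl _ _) _; rewrite disjoint_sym.
    congr (_ + #|pred_of_set _|); apply/setP => x; rewrite !in_setI in_setU in_setI.
    by case xV: (x \in C') => //=; rewrite (disjointFl G0C' xV).
  rewrite cUnion; last by apply: disjointWl CY; apply: subsetDl.
  rewrite cB; apply: (@reserve_count _ 0 0 _ _ 0 S n.-1 _ _ _ _ e1 _ _ _ (ecols_card pt) _ (cardsID (ecols D1 f) C')) => //.
    by rewrite addn0.
  by rewrite addn0.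
have AVs : AV \subset V' :|: YV by rewrite setSU // subsetDl.
have ACs : AC \subset C' :|: YC by rewrite setSU // subsetDl.
have [hv hvi hvE] := HEV AVs cAV (subsetUr _ _).
have [hc hci hcE] := HEC ACs cAC (subsetUr _ _).
have fD x : x \in f @: D1 -> [|| x \in f0 @: D0, x \in U0 | x \in V'].
  by move=> /(subsetP im2); rewrite !in_setU -orbA.
have inQ x : x \in QV :|: AA -> x \notin U0 by rewrite /U0 in_setC => ->.
have inQC x : x \in QC :|: BB -> x \notin G0 by rewrite /G0 in_setC => ->.
have inA x : x \in QV -> x \notin f0 @: D0.
  by move=> xQ; apply/negP => /(subsetP f0D0A) xA; rewrite (disjointFr QA xQ) in xA.
have AVQ x : x \in V' :|: YV -> x \in QV by move=> h; rewrite in_setU h.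
have ACQ x : x \in C' :|: YC -> x \in QC by move=> h; rewrite in_setU h.
have hvD b : hv b \notin f @: D1.
  have /andP[hA _] := hvE b; have hQ := AVQ _ (subsetP AVs _ hA).
  apply/negP => hD; have := fD _ hD; rewrite (negbTE (inA _ hQ)) (negbTE (inQ _ _)) /=; last by rewrite in_setU hQ.
  move=> hV'; move: hA; rewrite in_setU in_setD hD /= => hY.
  by rewrite (disjointFr VY hV') in hY.
have hcD b : hc b \notin ecols D1 f.
  have /andP[hA _] := hcE b; have hQ := ACQ _ (subsetP ACs _ hA).
  apply/negP => hD; have := subsetP ec2 _ hD; rewrite in_setU (negbTE (inQC _ _)) /=; last by rewrite in_setU hQ.
  move=> hC'; move: hA; rewrite in_setU in_setD hD /= => hY.
  by rewrite (disjointFr CY hC') in hY.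
have uzQ b : uz b \in QV by rewrite in_setU imset_f ?orbT.
have czQ b : cz b \in QC by rewrite in_setU imset_f ?orbT.
have uzD b : uz b \notin f @: D1.
  apply/negP => /fD; rewrite (negbTE (inA _ (uzQ b))) (negbTE (inQ _ _)) /=; last by rewrite in_setU uzQ.
  by move=> uV; have := uzS b; rewrite in_setU uV.
have czD b : cz b \notin ecols D1 f.
  apply/negP => /(subsetP ec2); rewrite in_setU (negbTE (inQC _ _)) /=; last by rewrite in_setU czQ.
  by move=> uV; have := czS b; rewrite in_setU uV.
have gaD i x : x \in ga i -> x \in f @: D1 -> x = gs i \/ x = gt i.
  move=> xi /fD; rewrite (negbTE (inQ _ _)) /=; last by rewrite in_setU (AAi xi) orbT.
  case/orP=> [/imsetP[y /D0P[j [->|->]] e]|xV]; last first.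
  - by have := disjointFr QA (subsetP VQ _ xV); rewrite (AAi xi).
  - by move: e; rewrite f0v => e; right; rewrite e (@daa i j x) // e.
  by move: e; rewrite f0u => e; left; rewrite e (@daa i j x) // e.
have gbD i c : c \in gb i -> c \notin ecols D1 f.
  move=> ci; apply/negP => /(subsetP ec2); rewrite in_setU (negbTE (inQC _ _)) /=; last by rewrite in_setU (BBi ci) orbT.
  by move=> cC; have := disjointFr QB (subsetP CQ _ cC); rewrite (BBi ci).
have [uV dV] : (forall i, uniq (owner_list hv uz ga i)) /\
    (forall i j x, x \in owner_list hv uz ga i -> x \in owner_list hv uz ga j -> i = j).
  apply: (@owner_lists g om W hv uz ga (V' :|: YV) UZ) => //.
  - by move=> b; have /andP[/(subsetP AVs)] := hvE b.
  - by move=> b; apply: imset_f.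
  - rewrite disjoint_sym disjoint_subset; apply/subsetP => x /imsetP[b _ ->]; exact: uzS.
  - by move=> i x xi; have [_ _ h _] := gf i; apply: h.
  by move=> i; have [] := gf i.
have [uC dC] : (forall i, uniq (owner_list cz hc gb i)) /\
    (forall i j x, x \in owner_list cz hc gb i -> x \in owner_list cz hc gb j -> i = j).
  apply: (@owner_lists g om K cz hc gb CZ (C' :|: YC)) => //.
  - by move=> b; apply: imset_f.
  - by move=> b; have /andP[/(subsetP ACs)] := hcE b.
  - rewrite disjoint_subset; apply/subsetP => x /imsetP[b _ ->]; exact: czS.
  - by move=> i x xi; rewrite setUC; have [_ _ _ h] := gf i; apply: h.
  by move=> i; have [] := gf i.
(* Each gadget is set to swallow what its slots are matched to. Its ends are split off, being
   already the images of [su i] and [sv i]. *)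
have sp i : exists p, [/\ path ge (gs i) (rcons p (gt i)), perm_eq (gs i :: rcons p (gt i)) (owner_list hv uz ga i) &
    perm_eq (pairmap col (gs i) (rcons p (gt i))) (owner_list cz hc gb i)].
  have hE b : EV (hv b) b by have /andP[] := hvE b.
  have hE' b : EC (hc b) b by have /andP[] := hcE b.
  have := gm (item_choice uz cz i hE hE').
  rewrite !map_cat -(map_comp fst (fun j => (hv (i, j), cz (i, j)))) -(map_comp fst (fun j => (uz (i, j), hc (i, j)))).
  rewrite -(map_comp snd (fun j => (hv (i, j), cz (i, j)))) -(map_comp snd (fun j => (uz (i, j), hc (i, j)))) => -[p [h1 h2 h3 h4]].
  case/lastP: p h1 h2 h3 h4 => [|p t] h1 h2 h3 h4; first by have := gst i; rewrite -h2 eqxx.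
  by move: h1 h2 h3 h4; rewrite last_rcons => h1 <- h3 h4; exists p.
have [pp hpp] := fin_all_exists sp.
have nst i x : x \in pp i -> [/\ x \in owner_list hv uz ga i, x != gs i & x != gt i].
  move=> xp; have [_ pe _] := hpp i.
  have := perm_uniq pe; rewrite uV /= rcons_uniq mem_rcons inE negb_or => /andP[/andP[_ h1] /andP[h2 _]].
  split; first by rewrite -(perm_mem pe) inE mem_rcons inE xp !orbT.
    by apply: contraNneq h1 => <-.
  by apply: contraNneq h2 => <-.
have oD i x : x \in owner_list hv uz ga i -> x != gs i -> x != gt i -> x \notin f @: D1.
  rewrite !mem_cat -orbA => /or3P[/mapP[j _ ->]|/mapP[j _ ->]|xa] // ns nt.
  by apply/negP => /(gaD _ _ xa)[] e; [rewrite e eqxx in ns|rewrite e eqxx in nt].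
have oC i c : c \in owner_list cz hc gb i -> c \notin ecols D1 f.
  by rewrite !mem_cat -orbA => /or3P[/mapP[j _ ->]|/mapP[j _ ->]|/gbD].
have [||||f' pt' _] := @partial_add_paths V T _ su sv m W K ge cs (geC nbC hbC) pp (enum 'I_g) D1 f pt PM.
- move=> i _; have [-> ->] := fs i; have [h1 pe _] := hpp i; split=> //.
  + have := perm_size pe; rewrite /owner_list /= size_rcons !size_cat sa.
    rewrite (size_map (fun j => hv (i, j))) (size_map (fun j => uz (i, j))) size_enum_ord.
    by have := sm i; clear; lia.
  + by have := perm_uniq pe; rewrite uV /= rcons_uniq => /andP[_ /andP[]].
  by move=> x /nst[h2 h3 h4]; apply: oD h2 h3 h4.
- by move=> i j x _ _ /nst[h _ _] /nst[h' _ _]; apply: dV h h'.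
- move=> i _; have [-> ->] := fs i; have [_ _ pe] := hpp i; split; first by rewrite (perm_uniq pe).
  by move=> c; rewrite (perm_mem pe); apply: oC.
- move=> i j c _ _; have [-> ->] := fs i; have [-> ->] := fs j.
  have [_ _ pe] := hpp i; have [_ _ pe'] := hpp j; rewrite (perm_mem pe) (perm_mem pe'); exact: dC.
by exists f'; rewrite -domM.
Qed.

End Finish.

(** * Assembly of templates, gadgets and paths *)

Lemma split_nth (U : Type) (s : seq U) k : k < size s -> exists a x b, s = a ++ x :: b /\ size a = k.
Proof.
case: s => // z s h; exists (take k (z :: s)), (nth z (z :: s) k), (drop k.+1 (z :: s)).
by rewrite -drop_nth // cat_take_drop size_takel // ltnW.
Qed.

Record splitting (U : Type) := Splitting {
  sp_x : U; sp_q1 : seq U; sp_u : U; sp_m : seq U; sp_v : U; sp_q2 : seq U; sp_y : U; sp_r : seq U }.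

Lemma splitting_exists (U : Type) (s : seq U) k : k + 16 <= size s -> exists S : splitting U,
  [/\ s = sp_x S :: sp_q1 S ++ sp_u S :: sp_m S ++ sp_v S :: sp_q2 S ++ sp_y S :: sp_r S,
    size (sp_q1 S) = 6, size (sp_q2 S) = 6 & size (sp_m S) = k].
Proof.
case: s => [|x s]; first by rewrite leqn0 addnC.
rewrite [size _]/= => h.
have [|q1 [u [r1 [e1 z1]]]] := @split_nth _ s 6; first by move: h; clear; lia.
have [|m [v [r2 [e2 z2]]]] := @split_nth _ r1 k.
  by move: h; rewrite e1 size_cat /= z1; clear; lia.
have [|q2 [y [r [e3 z3]]]] := @split_nth _ r2 6.
  by move: h; rewrite e1 size_cat /= z1 e2 size_cat /= z2; clear; lia.
by exists (Splitting x q1 u m v q2 y r); rewrite /= -e3 -e2 -e1.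
Qed.

Lemma embed_tree (V : finType) (T : sgraph V) (n : nat) (K : finType) (nb hb : rel 'I_n)
    (cs : {set 'I_n} -> K) (d l0 X Me Ml Mj g om yv : nat) (V' : {set 'I_n}) (C' : {set K}) (P : 'I_g -> seq V) :
  let col := fun x y : 'I_n => cs [set x; y] in
  symmetric nb -> symmetric hb -> is_tree T -> #|V| = n -> #|K| = n.-1 -> (forall v, deg T v <= d) ->
  (forall i, bare_path T (P i)) -> (forall i j w, w \in P i -> w \in P j -> i = j) ->
  (forall i, 3608 * om + 17 <= size (P i)) -> 0 < g -> 0 < om -> #|C'| = #|V'| ->
  #|V'| + yv + l0 = g * om + 12 * g -> 14 * g <= g * om -> 6 * (g * om) <= 10 * yv ->
  (#|V'| + yv + 2 * g + g * om + (3606 * om + 1) * g + 3) * (4 * Me) <= n ->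
  2 <= Me -> 1000 * Me <= n -> 8 * Me <= Mj ->
  Lprop nb col setT setT Me -> Sprop nb col Me -> Jprop hb col Mj ->
  n <= l0 * Mj -> X * Ml <= n -> d * n <= X * Mj -> l0 + X <= g -> 0 < Ml -> 4 * Ml <= n -> 8 * Ml <= Mj ->
  n <= #|C'| * Ml -> (X + 14 * g) * (4 * Ml) <= n -> Lprop nb col V' C' Ml ->
  (forall c (Q : {set 'I_n}), #|Q| * Ml <= n ->
    exists x y, [/\ x \in V' :\: Q, y \in V' :\: Q, x != y, nb x y & col x y = c]) ->
  exists f, partial T (joined nb hb) cs setT f.
Proof.
move=> col nbC hbC treeT cV cK dT bP dP sP g0 om0 cC hY h14 h6 hR Me2 Men MeMj Le Sw J l0n Xn dX lX Ml0 Mln MlMj Cn hXg Ll Ed.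
have Me0 : 0 < Me by apply: leq_trans Me2.
have n2 : 2 <= n by apply: leq_trans Men; move: Me2; clear; lia.
have x0 : 'I_n by apply: (@Ordinal n 0); apply: leq_trans n2.
have colC x y : col x y = col y x by rewrite /col setUC.
have tot : #|V'| + yv + 2 * g + g * om + 3 <= n.
  apply: leq_trans hR; apply: leq_trans (leq_pmulr _ _); last by rewrite muln_gt0.
  by move: ((3606 * om + 1) * g) => z; clear; lia.
have cB : #|{: 'I_g * 'I_om}| = g * om by rewrite card_prod !card_ord.
have [|YV sYV cYV] := @subset_of_card _ (~: V') yv.
  by have := cardsC V'; rewrite card_ord; move: tot; clear; lia.
(* The [2 * g] extra flexible colours reflect that the two holes of a path have two more edges than
   inner vertices. *)
have [|YC sYC cYC] := @subset_of_card _ (~: C') (yv + 2 * g).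
  by have := cardsC C'; rewrite cK cC; move: tot; clear; lia.
have VY : [disjoint V' & YV] by rewrite disjoint_sym disjoints_subset.
have CY : [disjoint C' & YC] by rewrite disjoint_sym disjoints_subset.
have cVY : #|V' :|: YV| = #|V'| + yv by rewrite cardsU disjoint_setI0 ?cards0 ?subn0 ?cYV.
have cCY : #|C' :|: YC| = #|V'| + yv + 2 * g by rewrite cardsU disjoint_setI0 ?cards0 ?subn0 ?cYC ?cC ?addnA.
have [|uz uzi uzS] := @inj_into {: 'I_g * 'I_om} _ (~: (V' :|: YV)).
  by have := cardsC (V' :|: YV); rewrite cB card_ord cVY; move: tot; clear; lia.
have [|cz czi czS] := @inj_into {: 'I_g * 'I_om} _ (~: (C' :|: YC)).
  by have := cardsC (C' :|: YC); rewrite cB cK cCY; move: tot; clear; lia.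
have {}uzS b : uz b \notin V' :|: YV by rewrite -in_setC.
have {}czS b : cz b \notin C' :|: YC by rewrite -in_setC.
have [||||EV [EV90 HEV]] := @template_set _ {: 'I_g * 'I_om} (V' :|: YV) YV; rewrite ?cB.
- by move: h14 g0; clear; lia.
- by rewrite cVY; move: hY h14; clear; lia.
- exact: subsetUr.
- by rewrite cYV.
have [||||EC [EC90 HEC]] := @template_set _ {: 'I_g * 'I_om} (C' :|: YC) YC; rewrite ?cB.
- by move: h14 g0; clear; lia.
- by rewrite cCY; move: hY h14; clear; lia.
- exact: subsetUr.
- by rewrite cYC; move: h6; clear; lia.
pose Is := item_lists EV EC uz cz.
have Isz i : gad_size (Is i) <= 3606 * om by apply: gad_size_items.
pose QV := V' :|: YV :|: [set uz b | b in [set: 'I_g * 'I_om]].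
pose QC := C' :|: YC :|: [set cz b | b in [set: 'I_g * 'I_om]].
have rQ : room n Me QV ((3606 * om + 1) * size (enum 'I_g) + 3).
  apply: leq_trans hR; rewrite leq_mul2r; apply/orP; right; rewrite size_enum_ord.
  have [h _] := leq_card_setU (V' :|: YV) [set uz b | b in [set: 'I_g * 'I_om]].
  move: h; rewrite -/QV cVY card_imset // cardsT cB.
  by move: ((3606 * om + 1) * g) => z; clear; lia.
have rC : room n Me QC ((3606 * om + 1) * size (enum 'I_g) + 3).
  apply: leq_trans hR; rewrite leq_mul2r; apply/orP; right; rewrite size_enum_ord.
  have [h _] := leq_card_setU (C' :|: YC) [set cz b | b in [set: 'I_g * 'I_om]].
  move: h; rewrite -/QC cCY card_imset // cardsT cB.
  by move: ((3606 * om + 1) * g) => z; clear; lia.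
have KMe : n <= #|K| * Me.
  by rewrite cK; apply: leq_trans (leq_mul (leqnn _) Me2); move: n2; clear; lia.
have Ism i : gad_size (Is i) + 1 <= 3606 * om + 1 by rewrite leq_add2r.
have [G [G1 G2]] := mgads_exist nbC hbC colC Me0 Men MeMj Le J Sw KMe x0 (enum_uniq 'I_g) Ism rQ rC.
have in_e i : i \in enum 'I_g by rewrite mem_enum.
have IsN i : Is i != [::].
  by rewrite -size_eq0 size_cat !(size_map _ (enum 'I_om)) size_enum_ord addn_eq0 -leqn0 leqNgt om0.
(* The middle segment gets the length dictated by its own gadget; the bound on gadget sizes makes
   the path long enough, and any excess goes to [sp_r]. *)
have sE i : exists S : splitting V,
  [/\ P i = sp_x S :: sp_q1 S ++ sp_u S :: sp_m S ++ sp_v S :: sp_q2 S ++ sp_y S :: sp_r S,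
    size (sp_q1 S) = 6, size (sp_q2 S) = 6 & size (sp_m S) = gad_size (Is i) + 2 * om - 1].
  by apply: splitting_exists; have := Isz i; have := sP i; move: om0; clear; lia.
have [S hS] := fin_all_exists sE.
apply: (@finish V T n K x0 nb hb cs nbC hbC d l0 X Ml Mj g om treeT cV cK dT
  (fun i => sp_x (S i)) (fun i => sp_u (S i)) (fun i => sp_v (S i)) (fun i => sp_y (S i))
  (fun i => sp_q1 (S i)) (fun i => sp_m (S i)) (fun i => sp_q2 (S i)) (fun i => sp_r (S i))
  (fun i => gad_size (Is i)) _ _ _ _ _ om0 V' YV C' YC uz cz uzi czi VY CY uzS czS EV EC _ _
  (fun i => (G i).1.1) (fun i => (G i).1.2) (fun i => (G i).2.1) (fun i => (G i).2.2)) => //.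
- by move=> i; have [<- _ _ _] := hS i.
- move=> i j w; have [<- _ _ _] := hS i; have [<- _ _ _] := hS j; exact: dP.
- by move=> i; have [] := hS i.
- by move=> i; have [] := hS i.
- by move=> i; have [_ _ _ ->] := hS i; move: om0; clear; lia.
- by move=> i; have [] := G1 i (in_e i).
- by move=> i; have [] := G1 i (in_e i).
- by move=> i; have [] := G1 i (in_e i).
- by move=> i; have [] := G1 i (in_e i).
- by move=> i; have [_ _ _ _ []] := G1 i (in_e i).
- by move=> i; have [_ _ _ _ []] := G1 i (in_e i).
- by move=> i; have [_ _ _ _ [_ _]] := G1 i (in_e i); apply.
- by move=> i j x; have [h _] := G2 i j (in_e i) (in_e j); apply: h.
- by move=> i j x; have [_ h] := G2 i j (in_e i) (in_e j); apply: h.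
- by rewrite cYV; exact: hY.
- by rewrite cYC cC; move: hY; clear; lia.
by apply: leq_trans n2.
Qed.

(** [x != y] accompanies [ohit] because the sample also gives bits to singletons, which are not
    edges of [Hgraph o]. *)
Lemma partial_rainbow (V : finType) (T : sgraph V) (n : nat) (K : finType) (G0 : sgraph 'I_n)
    (o : {ffun {set 'I_n} -> bool * K}) (f : V -> 'I_n) :
  partial T (joined (adj G0) (fun x y => (x != y) && ohit o x y)) (fun e => (o e).2) setT f ->
  rainbow_copy T (colouring_of (gunion G0 (Hgraph o)) o).
Proof.
move=> [finj fge fcol]; pose F : {ffun V -> 'I_n} := [ffun x => f x].
have FE (e : {set V}) : F @: e = f @: e by apply: eq_imset => x; rewrite ffunE.
have eT (e : {set V}) : e \in edges T -> e \in iedges T setT by rewrite inE subsetT andbT.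
apply/existsP; exists F; apply/and3P; split.
- by apply/injectiveP => x y; rewrite !ffunE; apply: finj; rewrite in_setT.
- apply/subsetP => e' /imsetP[e ee ->]; rewrite FE.
  have [x [y [e2 xy axy]]] := edgeP ee; rewrite e2 imsetU1 imset_set1.
  have := fge x y (in_setT _) (in_setT _) axy; rewrite /joined /= => /orP[h|/andP[h1 h2]].
    by rewrite inE; apply/orP; left.
  by rewrite !inE cards2 h1; apply/orP; right.
apply/dinjectiveP => e1 e2; rewrite !inE => /imsetP[d1 i1 v1] /imsetP[d2 i2 v2].
rewrite !ffunE v1 v2 !FE => h; apply: val_inj; rewrite v1 v2.
by rewrite (fcol d1 d2 (eT _ i1) (eT _ i2) h).
Qed.

(** * Choice of the constants *)

Lemma small_class n r (f : {ffun 'I_n -> 'I_r}) : 0 < r -> exists i, #|[set x | f x == i]| * r <= n.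
Proof.
move=> r0; apply/existsP; apply: contraT => /existsPn h.
have S : \sum_i #|[set x | f x == i]| = n.
  rewrite -[RHS](card_ord n) -[RHS]sum1_card (partition_big f xpredT) //=; apply: eq_bigr => i _.
  by rewrite -sum1_card; apply: eq_bigl => x; rewrite inE.
have : \sum_(i < r) n.+1 <= \sum_i #|[set x | f x == i]| * r.
  by apply: leq_sum => i _; rewrite ltnNge.
by rewrite -big_distrl /= S sum_nat_const card_ord mulnC leq_pmul2r // ltnn.
Qed.

(** Ordering the ends by [z.1 < z.2] makes distinct pairs distinct edges. *)
Definition inner_pairs n (nb : rel 'I_n) (V' : {set 'I_n}) :=
  [set z : 'I_n * 'I_n | [&& z.1 \in V', z.2 \in V', nb z.1 z.2 & z.1 < z.2]].

Lemma inner_pairs_inj n (nb : rel 'I_n) V' : {in inner_pairs nb V' &, injective (fun z => [set z.1; z.2])}.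
Proof.
move=> [a b] [c d]; rewrite !inE /= => /and4P[_ _ _ ab] /and4P[_ _ _ cd] e.
have h1 : a \in [set c; d] by rewrite -e !inE eqxx.
have h2 : b \in [set c; d] by rewrite -e !inE eqxx orbT.
move: h1 h2; rewrite !inE => /orP[]/eqP ea /orP[]/eqP eb; rewrite ea eb // in ab *.
- by rewrite ltnn in ab.
- by move: ab cd; clear; lia.
by rewrite ltnn in ab.
Qed.

Lemma card_inner_pairs n (nb : rel 'I_n) V' M : symmetric nb -> irreflexive nb ->
  (forall v, n <= #|[set x | nb v x] :&: V'| * M) -> n <= #|V'| * M ->
  n * n <= #|inner_pairs nb V'| * (2 * (M * M)).
Proof.
move=> nbC nbI hN hV; pose Q := [set z : 'I_n * 'I_n | (z.1 \in V') && ((z.2 \in V') && nb z.1 z.2)].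
have cQ : n * n <= #|Q| * (M * M).
  have -> : #|Q| = \sum_(x in V') #|[set y | nb x y] :&: V'|.
    rewrite -sum1_card; under [RHS]eq_bigr do rewrite -sum1_card.
    by rewrite pair_big_dep /=; apply: eq_bigl => z; rewrite !inE [nb _ _ && _]andbC.
  have s1 : \sum_(x in V') n <= (\sum_(x in V') #|[set y | nb x y] :&: V'|) * M.
    by rewrite big_distrl; apply: leq_sum => x _; apply: hN.
  rewrite mulnA; apply: leq_trans (leq_mul s1 (leqnn M)).
  by rewrite sum_nat_const mulnAC leq_mul2r hV orbT.
apply: leq_trans cQ _; rewrite (mulnA _ 2) leq_mul2r; apply/orP; right; rewrite muln2 -addnn.
apply: leq_trans (_ : #|inner_pairs nb V' :|: [set (z.2, z.1) | z in inner_pairs nb V']| <= _).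
  apply: subset_leq_card; apply/subsetP => -[x y]; rewrite inE /= => /and3P[xV yV xy].
  case: (ltngtP x y) => [lt|lt|e].
  - by rewrite !inE /= xV yV xy lt.
  - by rewrite inE; apply/orP; right; apply/imsetP; exists (y, x); rewrite // !inE /= xV yV nbC xy lt.
  by move: xy; rewrite (val_inj e) nbI.
have [h _] := leq_card_setU (inner_pairs nb V') [set (z.2, z.1) | z in inner_pairs nb V'].
by apply: leq_trans h _; rewrite leq_add2l leq_imset_card.
Qed.

(** Let [q = 2 * (d + 2)]. Since [n = 4 * k * g], the random edges join sets of size [g / q]; the
    slack [l0] is just above that, [X = d * l0], and the choice of [q] gives [l0 + X <= g]. With
    [g * om] about [3 * s] slots, the reserve [s] fills about a third of them and the flexible set
    more than [6 / 10]. *)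
Lemma parameters (d k g n s Me Ml Mv : nat) : n = 4 * k * g -> 2 <= d -> 2 * (d + 1) <= g ->
  50 * Me + 20 * Ml + 2 * Mv + 32 <= k -> 2 <= Me -> 0 < Ml -> 0 < Mv ->
  s * (866 * (100 * Me)) <= n -> n <= s * Mv ->
  exists l0 X om yv, [/\ [/\ 3608 * om + 17 <= k.+1, 0 < om, s + yv + l0 = g * om + 12 * g,
       14 * g <= g * om & 6 * (g * om) <= 10 * yv],
    (s + yv + 2 * g + g * om + (3606 * om + 1) * g + 3) * (4 * Me) <= n,
    [/\ 1000 * Me <= n, 8 * Me <= 4 * k * (2 * (d + 2)), n <= l0 * (4 * k * (2 * (d + 2))), X * Ml <= n &
        d * n <= X * (4 * k * (2 * (d + 2)))] &
    [/\ l0 + X <= g, 4 * Ml <= n, 8 * Ml <= 4 * k * (2 * (d + 2)) & (X + 14 * g) * (4 * Ml) <= n]].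
Proof.
move=> nE d2 gd kk Me2 Ml0 Mv0 sr sv.
have g0 : 0 < g by move: gd; clear; lia.
pose q := 2 * (d + 2); have q0 : 0 < q by rewrite /q; clear; lia.
have [kMe kMl kMv k32] : [/\ 50 * Me <= k, 20 * Ml <= k, 2 * Mv <= k & 32 <= k].
  by move: kk; clear => h; split; lia.
pose l0 := g %/ q + 1; pose X := d * l0.
have lq : g %/ q * q <= g by apply: leq_trunc_div.
have lq2 : g <= l0 * q by rewrite /l0 mulnDl mul1n {1}(divn_eq g q) leq_add2l ltnW // ltn_mod.
have lX : l0 + X <= g.
  have : (d + 1) * (2 * (g %/ q)) <= g.
    apply: leq_trans lq; rewrite mulnCA mulnA mulnC leq_mul2l; apply/orP; right; rewrite /q; clear; lia.
  rewrite /X /l0; move: gd; move: (g %/ q) => z; rewrite mulnDl mul1n mulnDr muln1; clear.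
  by rewrite mulnDr muln1 mulnCA; move: (d * z) => w; lia.
pose om := (3 * s) %/ g.
have Z1 : g * om <= 3 * s by rewrite mulnC; apply: leq_trunc_div.
have Z2 : 3 * s < g * om + g by rewrite [_ + g]addnC -mulnS [g * _]mulnC; apply: ltn_ceil.
have s8 : 8 * g <= s.
  rewrite -(leq_pmul2r Mv0); apply: leq_trans sv; rewrite nE.
  have -> : 8 * g * Mv = 2 * Mv * (4 * g) by clear; ring.
  have -> : 4 * k * g = k * (4 * g) by clear; ring.
  by rewrite leq_mul2r kMv orbT.
have om14 : 14 <= om by rewrite leq_divRL //; move: s8; clear; lia.
(* Thus [3608 * om <= k / 4], and the gadget fits comfortably into its path. *)
have omk : om * (1732 * 100) <= 12 * k.
  rewrite -(leq_pmul2r g0).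
  apply: leq_trans (_ : g * om * (866 * (100 * Me)) <= _).
    have -> : om * (1732 * 100) * g = g * om * (866 * (100 * 2)) by clear; ring.
    by rewrite !leq_mul2l Me2 !orbT.
  apply: leq_trans (leq_mul Z1 (leqnn _)) _; rewrite -mulnA.
  apply: leq_trans (leq_mul (leqnn 3) sr) _; rewrite nE; clear; lia.
have l0g : l0 <= g by apply: leq_trans lX; rewrite leq_addr.
have h14 : 14 * g <= g * om by rewrite mulnC leq_mul2l om14 orbT.
have Xg : X <= g by apply: leq_trans lX; rewrite leq_addl.
have gk Y : Y <= 4 * k -> g * Y <= n by move=> h; rewrite nE mulnC leq_mul2r h orbT.
exists l0, X, om, (g * om + 12 * g - l0 - s).
set yv := _ - _ - _; have yE : s + yv + l0 = g * om + 12 * g.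
  by rewrite /yv; move: Z2 l0g s8 h14; clear; lia.
split; [split| |split|split] => //.
- by move: omk k32; clear; lia.
- by apply: leq_trans om14.
- by move: yE Z2 l0g; clear; lia.
(* Here [433 * 25] exceeds [3 * 3608]. Multiplied by [2 * (4 * Me)] it is the factor
   [866 * 100 * Me] by which the reserve is smaller than [n]; the other half of [n] pays for the
   multiple of [g]. *)
- have b : s + yv + 2 * g + g * om + (3606 * om + 1) * g + 3 <= 433 * (25 * s) + 18 * g.
    have -> : (3606 * om + 1) * g = 3606 * (g * om) + g by clear; ring.
    by move: yE Z1 g0; move: (g * om) => Z; clear; lia.
  apply: leq_trans (leq_mul b (leqnn _)) _.
  have e1 : 2 * (18 * g * (4 * Me)) <= n.
    have -> : 2 * (18 * g * (4 * Me)) = g * (144 * Me) by clear; ring.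
    by apply: gk; move: kMe; clear; lia.
  have e2 : 2 * (433 * (25 * s) * (4 * Me)) <= n by apply: leq_trans sr; rewrite leq_eqVlt; apply/orP; left; apply/eqP; clear; ring.
  by rewrite mulnDl; move: e1 e2; clear; lia.
- apply: leq_trans (gk (200 * Me) _); last by move: kMe; clear; lia.
  have g6 : 6 <= g by move: gd d2; clear; lia.
  by apply: leq_trans (leq_mul g6 (leqnn _)); clear; lia.
- apply: leq_trans (_ : 4 * k * 2 <= _); first by move: kMe; clear; lia.
  by rewrite leq_mul2l; apply/orP; right; clear; lia.
- rewrite nE -/q; have -> : l0 * (4 * k * q) = 4 * k * (l0 * q) by clear; ring.
  by rewrite leq_mul2l lq2 orbT.
- apply: leq_trans (gk Ml _); last by move: kMl; clear; lia.
  by rewrite leq_mul2r Xg orbT.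
- rewrite /X -mulnA leq_mul2l; apply/orP; right; rewrite nE -/q.
  have -> : l0 * (4 * k * q) = 4 * k * (l0 * q) by clear; ring.
  by rewrite leq_mul2l lq2 orbT.
- apply: leq_trans (gk (4 * Ml) _); last by move: kMl; clear; lia.
  by rewrite leq_pmull.
- apply: leq_trans (_ : 4 * k * 2 <= _); first by move: kMl; clear; lia.
  by rewrite leq_mul2l; apply/orP; right; clear; lia.
apply: leq_trans (gk (60 * Ml) _); last by move: kMl; clear; lia.
have -> : g * (60 * Ml) = (g + 14 * g) * (4 * Ml) by clear; ring.
by rewrite leq_mul2r leq_add2r Xg orbT.
Qed.

Lemma good_outcome n (V : finType) (T : sgraph V) (G0 : sgraph 'I_n)
    (o : {ffun {set 'I_n} -> bool * 'I_n.-1}) (d k g Me Ml Mv : nat)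
    (V' : {set 'I_n}) (C' : {set 'I_n.-1}) (P : 'I_g -> seq V) :
  n = 4 * k * g -> 2 <= d -> 2 * (d + 1) <= g -> 50 * Me + 20 * Ml + 2 * Mv + 32 <= k ->
  2 <= Me -> 0 < Ml -> 0 < Mv -> Mv <= Ml -> is_tree T -> #|V| = n -> (forall v, deg T v <= d) ->
  (forall i, bare_path T (P i)) -> (forall i j w, w \in P i -> w \in P j -> i = j) ->
  (forall i, size (P i) = k.+1) ->
  #|V'| * (866 * (100 * Me)) <= n -> n <= #|V'| * Mv -> #|C'| = #|V'| ->
  Lprop (adj G0) (ocol o) setT setT Me -> Sprop (adj G0) (ocol o) Me ->
  Jprop (fun x y => (x != y) && ohit o x y) (ocol o) (4 * k * (2 * (d + 2))) ->
  Lprop (adj G0) (ocol o) V' C' Ml ->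
  (forall c (Q : {set 'I_n}), #|Q| * Ml <= n ->
    exists x y, [/\ x \in V' :\: Q, y \in V' :\: Q, x != y, adj G0 x y & ocol o x y = c]) ->
  rainbow_copy T (colouring_of (gunion G0 (Hgraph o)) o).
Proof.
move=> nE d2 gd kk Me2 Ml0 Mv0 MvMl treeT cV dT bP dP sP sr sv cC Le Sw J Ll Ed.
have [l0 [X [om [yv [[p1 p2 p3 p4 p5] p6 [p7 p8 p9 p10 p11] [p12 p13 p14 p15]]]]]] :=
  parameters nE d2 gd kk Me2 Ml0 Mv0 sr sv.
have g0 : 0 < g by move: gd; clear; lia.
have hC : symmetric (fun x y : 'I_n => (x != y) && ohit o x y).
  by move=> x y; rewrite eq_sym /ohit setUC.
have [f pf] : exists f, partial T (joined (adj G0) (fun x y => (x != y) && ohit o x y)) (fun e => (o e).2) setT f.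
  apply: (@embed_tree V T n 'I_n.-1 (adj G0) _ (fun e => (o e).2) d l0 X Me Ml (4 * k * (2 * (d + 2))) g om yv V' C' P
    (@adjC _ G0) hC treeT cV _ dT bP dP _ g0 p2 cC p3 p4 p5 p6 Me2 p7 p8 Le Sw J p9 p10 p11 p12 Ml0 p13 p14 _ p15 Ll Ed).
  - by rewrite card_ord.
  - by move=> i; rewrite sP.
  by rewrite cC; apply: leq_trans sv _; rewrite leq_mul2l MvMl orbT.
exact: partial_rainbow pf.
Qed.

Local Open Scope ring_scope.

Lemma linear_degree (R : realType) (delta : R) : 0 < delta ->
  exists2 D : nat, (0 < D)%N & forall n x : nat, delta * n%:R <= x%:R -> (n <= x * D)%N.
Proof.
move=> d0; exists (Num.truncn delta^-1).+1 => // n x h; rewrite -(ler_nat R) natrM.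
have h1 : 1 <= delta * (Num.truncn delta^-1).+1%:R.
  by rewrite -[leLHS](mulfV (lt0r_neq0 d0)) ler_pM2l // ltW // truncnS_gt.
apply: le_trans (ler_wpM2r (ler0n _ _) h); rewrite mulrAC -[leLHS]mul1r.
by apply: ler_wpM2r => //; apply: ler0n.
Qed.

(** [4 * (6 / zeta) * (zeta * n / 24) = n]; the later counting uses only the integers [k] and
    [g]. *)
Lemma path_count (R : realType) (zeta : R) (k n : nat) : 0 < zeta -> k%:R = 6 / zeta ->
  zeta * n%:R / 24 \is a Num.int -> exists2 g : nat, zeta * n%:R / 24 = g%:R & n = (4 * k * g)%N.
Proof.
move=> z0 hk /intrP[m hm].
have m0 : 0 <= m by rewrite -(ler_int R) -hm divr_ge0 // mulr_ge0 // ltW.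
case: m m0 hm => // g _ hg; exists g => //.
apply/eqP; rewrite -(eqr_nat R) !natrM hk.
have -> : g%:R = zeta * n%:R / 24 by rewrite hg.
apply/eqP; field; exact: lt0r_neq0.
Qed.

Lemma disjoint_nth (V : finType) (P : seq (seq V)) g (i j : 'I_g) w : (g <= size P)%N -> vertex_disjoint P ->
  w \in nth [::] P i -> w \in nth [::] P j -> i = j.
Proof.
move=> gP vd; have lt (a b : 'I_g) : (a < b)%N -> w \in nth [::] P a -> w \in nth [::] P b -> False.
  move=> ab wa wb; have ia (c : 'I_g) : (c < size P)%N by apply: leq_trans gP.
  have := (elimT (pairwiseP [::]) vd) a b (ia a) (ia b) ab.
  by move=> /= dj; have := disjointFr dj wa; rewrite wb.
move=> wi wj; case: (ltngtP i j) => [h|h|/val_inj//]; first by case: (lt _ _ h wi wj).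
by case: (lt _ _ h wj wi).
Qed.

Theorem theorem4p3 (R : realType) (delta : R) (d : nat) :
  0 < delta < 1 -> (2 <= d)%N ->
  exists zeta0 : R, 0 < zeta0 /\
  forall zeta : R, 0 < zeta <= zeta0 ->
  exists C0 : R, forall C : R, C0 <= C ->
  forall eps : R, 0 < eps ->
  exists N : nat, forall n : nat, (N <= n)%N ->
  zeta * n%:R / 24 \is a Num.int ->
  forall (V : finType) (T : sgraph V) (G0 : sgraph 'I_n),
  #|V| = n -> is_tree T -> (forall v : V, (deg T v <= d)%N) ->
  (exists P : seq (seq V),
    [/\ zeta * n%:R / 24 <= (size P)%:R,
        vertex_disjoint P
      & forall s : seq V, s \in P ->
          bare_path T s /\ (path_length s)%:R = 6 / zeta]) ->
  (forall v : 'I_n, delta * n%:R <= (deg G0 v)%:R) ->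
  1 - eps <=
    perturbed_coloured_prob (K := 'I_n.-1) G0 (C / n%:R)
      (fun G c => rainbow_copy T c).
Proof.
case/andP=> d0 _ d2.
have [Dl Dl0 hDl] := linear_degree d0.
(* Three classes provide the disjoint parts [P1], [P2], [P3] of the switches. *)
have [M1 M10 [N1 H1]] := @classes_exist R 3 Dl isT Dl0.
have [Ms Ms0 Hs] := @switch_whp R M1 M10.
have [La La0 Hla] := @local_whp R Dl 2 Dl0 isT.
pose Me := (Ms + La + 2)%N; have Me2 : (2 <= Me)%N by rewrite leq_addl.
have r0 : (0 < 866 * (100 * Me))%N by rewrite !muln_gt0 /= (leq_trans _ Me2).
(* The reserve will be one of [866 * 100 * Me] classes, of at most average size, so [Me] is fixed
   before it. The constants [Mv] and [Ml] inside the reserve come after it, and [k0] last. *)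
have [Mv Mv0 [N2 H2]] := @classes_exist R (866 * (100 * Me)) Dl r0 Dl0.
have [Lb Lb0 Hlb] := @local_whp R Mv Mv Mv0 Mv0.
have MM : (0 < 2 * (Mv * Mv))%N by rewrite !muln_gt0 Mv0.
have [Lp Lp0 Hlp] := @pairs_hit_whp R _ MM.
pose Ml := (Lb + Lp + Mv)%N; have MvMl : (Mv <= Ml)%N by rewrite leq_addl.
have Ml0 : (0 < Ml)%N by apply: leq_trans MvMl.
pose k0 := (50 * Me + 20 * Ml + 2 * Mv + 32)%N.
have k00 : 0 < k0%:R :> R by rewrite ltr0n /k0 addn_gt0 orbT.
exists (6 / k0%:R); split; first by rewrite divr_gt0.
move=> zeta /andP[z0 zk].
(* If [6 / zeta] is not an integer, no path has that length; but for [n >= 1] at least one path is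
   assumed, so the claim is vacuous. *)
case: (pselect (exists k : nat, k%:R = 6 / zeta)) => [[k hk]|nok]; last first.
  exists 0 => C _ eps _; exists 1%N => n n1 _ V T G0 _ _ _ [P [sP _ hP]] _.
  case: P sP hP => [|s P] sP hP.
    have h : 0 < zeta * n%:R / 24 by rewrite divr_gt0 // mulr_gt0 // ltr0n.
    by have := lt_le_trans h sP; rewrite ltxx.
  by have [_ e] := hP s (mem_head _ _); case: nok; exists (path_length s).
have kk : (k0 <= k)%N.
  by rewrite -(ler_nat R) hk ler_pdivlMr // mulrC -ler_pdivlMr.
have k1 : (0 < k)%N by apply: leq_trans kk; rewrite /k0 addn_gt0 orbT.
pose Mj := (4 * k * (2 * (d + 2)))%N.
have Mj0 : (0 < Mj)%N by rewrite /Mj !muln_gt0 k1 addn_gt0 orbT.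
have [C0 HC] := @joint_whp R Mj Mj0.
exists C0 => C CC eps e0; have e5 : 0 < eps / 5 by rewrite divr_gt0.
have [N3 HN3] := Hs Me (leq_trans (leq_addr _ _) (leq_addr _ _)) _ e5.
have [N4 HN4] := Hla Me (leq_trans (leq_addl _ _) (leq_addr _ _)) _ e5.
have [N5 HN5] := Hlb Ml (leq_trans (leq_addr _ _) (leq_addr _ _)) _ e5.
have [N6 HN6] := Hlp Ml (leq_trans (leq_addl _ _) (leq_addr _ _)) _ e5.
have [N7 HN7] := HC C CC _ e5.
exists (N1 + N2 + N3 + N4 + N5 + N6 + N7 + 4 * k * (2 * (d + 1)) + 2)%N.
move=> n Nn zint V T G0 cV treeT dT [P [sP vdP hP]] hdeg.
have [n1 n2 n3 n4 [n5 n6 n7 n8 nn]] : [/\ N1 <= n, N2 <= n, N3 <= n, N4 <= n &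
   [/\ N5 <= n, N6 <= n, N7 <= n, 4 * k * (2 * (d + 1)) <= n & 2 <= n]]%N.
  move: Nn; move: (4 * k * (2 * (d + 1)))%N => Y; clear => h.
  by split; [lia|lia|lia|lia|split; lia].
have [g hg nE] := path_count z0 hk zint.
have gd : (2 * (d + 1) <= g)%N.
  by move: n8; rewrite nE leq_pmul2l // muln_gt0.
have gP : (g <= size P)%N by rewrite -(ler_nat R) -hg.
pose P' (i : 'I_g) := nth [::] P i.
have P'P i : P' i \in P by apply: mem_nth; apply: leq_trans gP.
have bP i : bare_path T (P' i) by have [] := hP _ (P'P i).
have sP' i : size (P' i) = k.+1.
  have [+ +] := hP _ (P'P i); rewrite -hk => bp /eqP; rewrite eqr_nat /path_length => /eqP <-.
  by case: (P' i) bp.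
have dP (i j : 'I_g) w : w \in P' i -> w \in P' j -> i = j := disjoint_nth gP vdP.
have Kn : (0 < #|'I_n.-1| <= n)%N by rewrite card_ord leq_pred andbT; move: nn; clear; lia.
have K2 : (n <= #|'I_n.-1| * 2)%N by rewrite card_ord; move: nn; clear; lia.
have K0 : (0 < #|'I_n.-1|)%N by case/andP: Kn.
have [p01 PJ] := HN7 n 'I_n.-1 n7 Kn.
set p := C / n%:R in p01 PJ *.
pose nb := adj G0; have nbC : symmetric nb by apply: adjC.
have nbI : irreflexive nb by apply: adj_irr.
have hN v : (n <= #|[set x | nb v x]| * Dl)%N by apply: hDl; apply: hdeg.
have cn : (#|'I_n| <= n)%N by rewrite card_ord.
have [f3 h3] := H1 n 'I_n (fun v => [set x | nb v x]) n1 cn hN.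
have clE r (f : {ffun 'I_n -> 'I_r}) (v : 'I_n) i :
    [set x in [set x | nb v x] | f x == i] = [set x | nb v x] :&: [set x | f x == i].
  by apply/setP => x; rewrite !inE.
have dj (i j : 'I_3) : i != j -> [disjoint [set x | f3 x == i] & [set x | f3 x == j]].
  move=> ij; rewrite disjoint_subset; apply/subsetP => x; rewrite !inE => /eqP->; exact: ij.
have h3' i v : (n <= #|[set x | nb v x] :&: [set x | f3 x == i]| * M1)%N by rewrite -clE; apply: h3.
pose c0 := @Ordinal 3 0 isT; pose c1 := @Ordinal 3 1 isT; pose c2 := @Ordinal 3 2 isT.
have PS := HN3 n 'I_n.-1 p nb [set x | f3 x == c0] [set x | f3 x == c1] [set x | f3 x == c2]
  n3 p01 Kn K2 nbC nbI (dj c0 c1 isT) (dj c0 c2 isT) (dj c1 c2 isT) (h3' c0) (h3' c1) (h3' c2).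
(* The classes, and with them the reserve, depend on [G0] only; they are fixed before any random
   edge or colour is drawn. *)
have [fr hr] := H2 n 'I_n (fun v => [set x | nb v x]) n2 cn hN.
have [i0 hi0] := small_class fr r0.
pose V' := [set x | fr x == i0].
have hV v : (n <= #|[set x | nb v x] :&: V'| * Mv)%N by rewrite -clE; apply: hr.
have n0 : (0 < n)%N by apply: leq_trans nn.
have hVn : (n <= #|V'| * Mv)%N.
  apply: leq_trans (hV (Ordinal n0)) _; rewrite leq_mul2r; apply/orP; right.
  exact: subset_leq_card (subsetIr _ _).
(* The colours are exchangeable, so any set of [#|V'|] colours can be the colour reserve. *)
have [|C' _ cC'] := @subset_of_card _ [set: 'I_n.-1] #|V'|.
  rewrite cardsT card_ord; have : (#|V'| * 2 <= n)%N.
    by apply: leq_trans hi0; rewrite leq_mul2l; apply/orP; right; move: Me2; clear; lia.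
  by move: nn; move: (#|V'|); clear; lia.
have J4 : (#|'I_n| <= n ^ 4)%N by rewrite card_ord -{1}(expn1 n) leq_pexp2l.
have irr1 v : v \notin [set x | nb v x] by rewrite inE nbI.
have irr2 v : v \notin [set x | nb v x] :&: V' by rewrite in_setI inE nbI.
have K2' : (n <= #|[set: 'I_n.-1]| * 2)%N by rewrite cardsT.
have hCn : (n <= #|C'| * Mv)%N by rewrite cC'.
have PE := HN4 n 'I_n.-1 'I_n p id (fun v => [set x | nb v x]) [set: 'I_n.-1] n4 p01 Kn J4 irr1 hN K2'.
have PL := HN5 n 'I_n.-1 'I_n p id (fun v => [set x | nb v x] :&: V') C' n5 p01 Kn J4 irr2 hV hCn.
have PP := HN6 n 'I_n.-1 p (inner_pairs nb V') n6 p01 Kn (@inner_pairs_inj _ nb V') (card_inner_pairs nbC nbI hV hVn).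
move: PS; set E1 := (X in Pr _ X <= _); move=> PS.
move: PE; set E2 := (X in Pr _ X <= _); move=> PE.
move: PL; set E3 := (X in Pr _ X <= _); move=> PL.
move: PP; set E4 := (X in Pr _ X <= _); move=> PP.
move: PJ; set E5 := (X in Pr _ X <= _); move=> PJ.
have ew0 := ew_ge0 (K := 'I_n.-1) p01.
rewrite perturbed_prob_product // (Pr_compl (ew_sum _ K0)) lerD2l lerN2.
apply: (@le_trans _ _ (Pr (ew p) (fun o => E1 o || (E2 o || (E3 o || (E4 o || E5 o)))))).
  apply: Pr_le => // o nA; apply: contraT => /norP[b1 /norP[b2 /norP[b3 /norP[b4 b5]]]].
  have g1 := contrapT (elimN (asboolP _) b1); have g2 := contrapT (elimN (asboolP _) b2).
  have g3 := contrapT (elimN (asboolP _) b3); have g4 := contrapT (elimN (asboolP _) b4).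
  have g5 := contrapT (elimN (asboolP _) b5).
  case/negP: nA; apply: (@good_outcome n V T G0 o d k g Me Ml Mv V' C' P' nE d2 gd kk Me2 Ml0 Mv0 MvMl treeT cV dT bP dP sP' hi0 hVn cC').
  - move=> a Q G hQ hG; have [r] := g2 a Q G hQ hG.
    by rewrite in_setD inE => /andP[rQ ar] hr'; exists r; [rewrite in_setD rQ in_setT|apply/andP; split].
  - exact: g1.
  - move=> A B G hA hB hG; have [a [b [aA bB ab hab cab]]] := g5 A B G hA hB hG.
    by exists a, b; rewrite ab hab.
  - move=> a Q G hQ hG; have [r] := g3 a Q G hQ hG.
    by rewrite in_setD in_setI inE => /and3P[rQ ar rV] hr'; exists r; [rewrite in_setD rQ|apply/andP; split].
  move=> c Q hQ; have [x [y [+ xQ yQ e]]] := g4 c Q hQ; rewrite inE /= => /and4P[xV yV xy lt].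
  exists x, y; rewrite !in_setD xQ yQ xV yV; split=> //.
  by apply: contraTneq lt => ->; rewrite ltnn.
apply: le_trans (Pr_union2 ew0 _ _) _.
apply: le_trans (lerD PS (le_trans (Pr_union2 ew0 _ _) (lerD PE (le_trans (Pr_union2 ew0 _ _)
  (lerD PL (le_trans (Pr_union2 ew0 _ _) (lerD PP PJ))))))) _.
by lra.
Qed.
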